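(* There does not exist a proper lightlike isotropic Lagrangian, Lorentzian surface of Type 1 in $\mathbb{C}P^2_1(4)$.
   Context: Let $b_{1,3}(z,w)=-z_1\bar w_1+z_2\bar w_2+z_3\bar w_3$ on $\mathbb{C}^3$ and $S^5_2(1)=\{z\in\mathbb{C}^3 : b_{1,3}(z,z)=1\}$. $\mathbb{C}P^2_1(4)$ is the quotient of $S^5_2(1)$ by multiplication by unit complex numbers, with the metric making the Hopf fibration $\Pi:S^5_2(1)\to\mathbb{C}P^2_1(4)$ a pseudo-Riemannian submersion; it is an indefinite Kähler manifold (complex structure $J$, complex dimension $2$, complex index $1$) of constant holomorphic sectional curvature $4$. A Lagrangian, Lorentzian surface $M$ is a (nonempty) immersed real surface whose induced metric $\langle\cdot,\cdot\rangle$ has signature $(1,1)$ and such that $J$ interchanges the tangent and the normal spaces. Let $h$ be its second fundamental form, $\widetilde\nabla_XY=\nabla_XY+h(X,Y)$. A tangent vector $v\neq 0$ is lightlike if $\langle v,v\rangle=0$. $M$ is lightlike (pseudo-)isotropic if for every lightlike tangent vector $v$ one has $\langle h(v,v),h(v,v)\rangle=0$. It is proper lightlike (pseudo-)isotropic if in addition it has no minimal points, i.e. the trace of $h$ vanishes at no point. A proper lightlike isotropic surface is of Type 1 at a point $p$ if there exists a lightlike $v\in T_pM$ such that $h(v,v)$ and $Jv$ are linearly independent (over $\mathbb{R}$); it is of Type 1 if it is of Type 1 at every point. *)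

(* Defs.v *)
From HB Require Import structures.
From mathcomp Require Import all_boot all_order all_algebra.
From mathcomp Require Import complex.
From mathcomp Require Import all_classical all_reals all_analysis.
From mathcomp Require Import ring.

Set Implicit Arguments.
Unset Strict Implicit.
Unset Printing Implicit Defensive.

Import Order.TTheory GRing.Theory Num.Theory.
Import numFieldNormedType.Exports.

Local Open Scope classical_set_scope.
Local Open Scope ring_scope.
Local Open Scope complex_scope.

Section Smooth.
Variables (R : realType) (n : nat) (V : normedModType R).
Implicit Types (f : 'rV[R]_n -> V) (s : seq 'I_n) (U : set 'rV[R]_n).

Definition basis_vec (i : 'I_n) : 'rV[R]_n := delta_mx 0 i.

Definition partials s f : 'rV[R]_n -> V :=
  foldr (fun i F => 'D_(basis_vec i) F) f s.

(* C^oo on U, meant for open U: all iterated partial derivatives exist and are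
   continuous at every point of U. *)
Definition smooth_on U f : Prop :=
  forall s x, U x ->
    {for x, continuous (partials s f)} /\
    forall i, derivable (partials s f) x (basis_vec i).

End Smooth.

Section Charts.
Variables (R : realType) (T : topologicalType).

(* [chart_inv] is only relevant on the image of [chart_dom]. *)
Record chart := Chart {
  chart_dom : set T;
  chart_fun : T -> 'rV[R]_2;
  chart_inv : 'rV[R]_2 -> T }.

Definition chart_homeo (c : chart) : Prop :=
  [/\ open (chart_dom c),
      open (chart_fun c @` chart_dom c),
      forall p, chart_dom c p -> chart_inv c (chart_fun c p) = p,
      forall p, chart_dom c p -> {for p, continuous (chart_fun c)} &
      forall p, chart_dom c p ->
        {for chart_fun c p, continuous (chart_inv c)}].

Definition chart_compat (c d : chart) : Prop :=
  smooth_on (chart_fun c @` (chart_dom c `&` chart_dom d))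
            (chart_fun d \o chart_inv c).

End Charts.

Record surface (R : realType) := Surface {
  surf_pt :> topologicalType;
  atlas : set (chart R surf_pt);
  surf_nonempty : [set: surf_pt] !=set0;
  surf_hausdorff : hausdorff_space surf_pt;
  surf_second_countable : @second_countable surf_pt;
  atlas_homeo : forall c, atlas c -> chart_homeo c;
  atlas_cover : forall p : surf_pt, exists2 c, atlas c & chart_dom c p;
  atlas_compat : forall c d, atlas c -> atlas d -> chart_compat c d }.

(* Pseudo-Riemannian geometry in coordinates.  A metric on (an open subset of)
   R^n is given by its Gram matrix g x in the coordinate frame; tangent vectors
   are row vectors. *)
Section Metric.
Variables (R : realType) (n : nat).
Implicit Types (g : 'rV[R]_n -> 'M[R]_n) (x u v : 'rV[R]_n) (i j k l : 'I_n).

Definition gform (G : 'M[R]_n) u v : R := (u *m G *m v^T) 0 0.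

(* Gamma^k_{ij}
     = 1/2 g^{kl} (d_i g_{jl} + d_j g_{il} - d_l g_{ij}) *)
Definition christoffel g x i j k : R :=
  2^-1 * \sum_l invmx (g x) k l *
    ('D_(basis_vec R i) (fun y => g y j l) x
     + 'D_(basis_vec R j) (fun y => g y i l) x
     - 'D_(basis_vec R l) (fun y => g y i j) x).

(* Levi-Civita derivative, in direction u, of the vector field with constant
   coefficients v. *)
Definition levi_civita g x u v : 'rV[R]_n :=
  \row_k \sum_i \sum_j u 0 i * v 0 j * christoffel g x i j k.

End Metric.

(* A map X : R^m -> R^n (coordinate expression of a map between manifolds) and
   a metric g on the target, at the point x.  A vector v in R^m stands for the
   tangent vector at x with coefficients v in the coordinate frame. *)
Section Immersion.
Variables (R : realType) (m n : nat).
Variables (X : 'rV[R]_m -> 'rV[R]_n) (g : 'rV[R]_n -> 'M[R]_n).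
Variable x : 'rV[R]_m.
Implicit Types v w : 'rV[R]_m.

Definition induced_metric (y : 'rV[R]_m) : 'M[R]_m :=
  \matrix_(i, j) gform (g (X y)) ('D_(basis_vec R i) X y) ('D_(basis_vec R j) X y).

Definition induced v w : R := gform (induced_metric x) v w.

(* Gauss formula h(v, w) = nabla~_v w - nabla_v w, with v and w extended to
   coordinate fields with constant coefficients; nabla is the Levi-Civita
   connection of the induced metric. *)
Definition sff v w : 'rV[R]_n :=
  'D_v (fun y => 'D_w X y) x + levi_civita g (X x) ('D_v X x) ('D_w X x)
  - 'D_(levi_civita induced_metric x v w) X x.

Definition sff_trace : 'rV[R]_n :=
  \sum_i \sum_j
     invmx (induced_metric x) i j *: sff (basis_vec R i) (basis_vec R j).

Definition immersive : Prop := forall v, 'D_v X x = 0 -> v = 0.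

Definition tangent_space : set 'rV[R]_n := range (fun v => 'D_v X x).

Definition normal_space : set 'rV[R]_n :=
  [set xi | forall v, gform (g (X x)) xi ('D_v X x) = 0].

Definition lightlike v : Prop := v <> 0 /\ induced v v = 0.

End Immersion.

(* The induced form has signature (1,1): it has an orthonormal basis with one
   timelike and one spacelike vector. *)
Definition signature11 (R : realType) (n : nat)
    (X : 'rV[R]_2 -> 'rV[R]_n) (g : 'rV[R]_n -> 'M[R]_n) (x : 'rV[R]_2) : Prop :=
  exists u v, [/\ induced X g x u u = -1, induced X g x v v = 1 &
                  induced X g x u v = 0].

Section ProjectiveSpace.
Variable R : realType.
Local Notation C := R[i].
Implicit Types (z u Z W : 'rV[C]_3) (k : 'I_3) (w X : 'rV[R]_(2 + 2)).

Definition b13 z u : C :=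
  - (z 0 0 * (u 0 0)^*%C) + z 0 1 * (u 0 1)^*%C + z 0 2 * (u 0 2)^*%C.

Definition S52 : set 'rV[C]_3 := [set z | b13 z z = 1].

Definition hopf_fibre z : set 'rV[C]_3 :=
  [set a *: z | a in [set a : C | `|a| = 1]].

(* Points of CP^2_1(4): the orbits of the unit complex numbers on S^5_2(1). *)
Record CP21 := MkCP21 {
  cp_fibre : set 'rV[C]_3;
  cp_fibreP : exists2 z, S52 z & cp_fibre = hopf_fibre z }.

Definition hopf z (Sz : S52 z) : CP21 := MkCP21 (ex_intro2 _ _ z Sz erefl).

(* C^2 = R^4, (x + i y) <-> (x, y) with x, y in R^2 *)
Definition to_cplx (w : 'rV[R]_(2 + 2)) : 'rV[C]_2 :=
  \row_j (lsubmx w 0 j +i* rsubmx w 0 j).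
Definition to_real (w : 'rV[C]_2) : 'rV[R]_(2 + 2) :=
  row_mx (\row_j complex.Re (w 0 j)) (\row_j complex.Im (w 0 j)).

(* Affine coordinates (z_j / z_k)_{j <> k}. *)
Definition aff k z : 'rV[R]_(2 + 2) :=
  to_real (\row_j (z 0 (lift k j) / z 0 k)).

(* The differential of [aff k] at z. *)
Definition daff k z Z : 'rV[R]_(2 + 2) :=
  to_real (\row_j ((Z 0 (lift k j) * z 0 k - z 0 (lift k j) * Z 0 k)
                   / z 0 k ^+ 2)).

(* The affine chart of CP^2_1(4) on { z_k <> 0 }; well defined since [aff k] is
   constant on fibres, see [cp_chart_hopf]. *)
Definition cp_dom k : set CP21 :=
  [set p | exists2 z, cp_fibre p z & z 0 k != 0].
Definition cp_chart k (p : CP21) : 'rV[R]_(2 + 2) := aff k (xget 0 (cp_fibre p)).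

(* (w, a) |-> the vector of C^3 with k-th entry a and other entries w *)
Definition ins k (a : C) (w : 'rV[C]_2) : 'rV[C]_3 :=
  \row_j (if unlift k j is Some i then w 0 i else a).

(* A point of S^5_2(1) over the point with affine coordinates w. *)
Definition cp_sec k w : 'rV[C]_3 :=
  let z := ins k 1 (to_cplx w) in
  ((Num.sqrt (complex.Re (b13 z z)))^-1)%:C *: z.

(* At z in S^5_2(1), the tangent space is { Z | Re b13 Z z = 0 } and the fibre
   is tangent to i z, so the horizontal space is { Z | b13 Z z = 0 }. *)
Definition horizontal z : set 'rV[C]_3 := [set Z | b13 Z z = 0].

Definition hor_proj z Z : 'rV[C]_3 := Z - b13 Z z *: z.

(* The horizontal lift to z of the tangent vector with affine components X. *)
Definition hlift k z X : 'rV[C]_3 :=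
  hor_proj z (z 0 k *: ins k 0 (to_cplx X)).

(* The metric of CP^2_1(4) in the k-th affine chart; the Hopf fibration is a
   pseudo-Riemannian submersion by [hopf_submersion]. *)
Definition cp_metric k w : 'M[R]_(2 + 2) :=
  \matrix_(i, j) complex.Re
    (b13 (hlift k (cp_sec k w) (basis_vec R i))
         (hlift k (cp_sec k w) (basis_vec R j))).

(* The complex structure, in any affine chart; see [hlift_cp_J]. *)
Definition cp_J X : 'rV[R]_(2 + 2) := to_real ('i *: to_cplx X).

End ProjectiveSpace.

(* Maps from a surface M to CP^2_1(4), read in charts. *)
Section SurfaceInCP.
Variables (R : realType) (M : surface R) (f : M -> CP21 R).
Implicit Types (c : chart R M) (k : 'I_3) (p : M).

Definition loc c k : 'rV[R]_2 -> 'rV[R]_(2 + 2) :=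
  cp_chart k \o f \o chart_inv c.

(* [P c k (chart_fun c p)] for all charts c around p and all affine charts k
   around f p.  Such charts always exist, and the properties below do not
   depend on them. *)
Definition in_charts
    (P : chart R M -> 'I_3 -> 'rV[R]_2 -> Prop) (p : M) : Prop :=
  forall c k, atlas c -> chart_dom c p -> cp_dom k (f p) ->
    P c k (chart_fun c p).

Definition smooth_at (p : M) : Prop :=
  in_charts (fun c k x =>
    exists U : set 'rV[R]_2,
      [/\ open_nbhs x U,
          U `<=` chart_fun c @` chart_dom c,
          forall y, U y -> cp_dom k (f (chart_inv c y)) &
          smooth_on U (loc c k)]) p.

Definition immersion : Prop :=
  forall p, smooth_at p /\ in_charts (fun c k x => immersive (loc c k) x) p.

Definition lorentzian : Prop :=
  forall p, in_charts (fun c k x => signature11 (loc c k) (cp_metric k) x) p.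

Definition lagrangian : Prop :=
  forall p, in_charts (fun c k x =>
    let T := tangent_space (loc c k) x in
    let N := normal_space (loc c k) (cp_metric k) x in
    @cp_J R @` T = N /\ @cp_J R @` N = T) p.

Definition lightlike_isotropic : Prop :=
  forall p, in_charts (fun c k x =>
    let g := cp_metric k in
    let h := sff (loc c k) g x in
    forall v, lightlike (loc c k) g x v ->
      gform (g (loc c k x)) (h v v) (h v v) = 0) p.

Definition no_minimal_points : Prop :=
  forall p, in_charts (fun c k x => sff_trace (loc c k) (cp_metric k) x <> 0) p.

Definition proper_lightlike_isotropic : Prop :=
  lightlike_isotropic /\ no_minimal_points.

Definition type1_at (p : M) : Prop :=
  in_charts (fun c k x =>
    let g := cp_metric k in
    exists2 v, lightlike (loc c k) g x v &
      forall a b : R,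
        a *: sff (loc c k) g x v v + b *: cp_J ('D_v (loc c k) x) = 0 ->
        a = 0 /\ b = 0) p.

Definition type1 : Prop := forall p, type1_at p.

End SurfaceInCP.

Section ProjectiveSpaceTheory.
Variable R : realType.
Local Notation C := R[i].
Implicit Types (z u Z W : 'rV[C]_3) (k : 'I_3) (w X Y : 'rV[R]_(2 + 2)).

Lemma to_realK : cancel (@to_real R) (@to_cplx R).
Proof.
move=> w; apply/rowP=> j; rewrite mxE /to_real row_mxKl row_mxKr !mxE.
by case: (w 0 j).
Qed.

Lemma to_cplxK : cancel (@to_cplx R) (@to_real R).
Proof.
move=> w; rewrite /to_real -[RHS]hsubmxK; congr row_mx;
  by apply/rowP=> j; rewrite !mxE.
Qed.

Lemma to_cplxP (r : R) X Y :
  to_cplx (r *: X + Y) = r%:C *: to_cplx X + to_cplx Y.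
Proof.
apply/rowP=> j; rewrite !mxE; apply/eqP; rewrite eq_complex /=.
by rewrite !mul0r subr0 addr0 !eqxx.
Qed.

Lemma b13Pl (a : C) z u W : b13 (a *: z + u) W = a * b13 z W + b13 u W.
Proof. by rewrite /b13 !mxE; ring. Qed.

Lemma b13Pr (a : C) z u W : b13 W (a *: z + u) = a^*%C * b13 W z + b13 W u.
Proof. by rewrite /b13 !mxE !rmorphD !rmorphM /=; ring. Qed.

Lemma b13Zl (a : C) z W : b13 (a *: z) W = a * b13 z W.
Proof. by rewrite /b13 !mxE; ring. Qed.

Lemma b13Zr (a : C) z W : b13 W (a *: z) = a^*%C * b13 W z.
Proof. by rewrite /b13 !mxE !rmorphM /=; ring. Qed.

Lemma conjCM (a : C) : `|a| = 1 -> a * a^*%C = 1.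
Proof. by move=> a1; rewrite -[a^*%C]/(Num.conj a) -normCK a1 expr1n. Qed.

Lemma insP k (a : C) (X Y : 'rV[C]_2) :
  ins k 0 (a *: X + Y) = a *: ins k 0 X + ins k 0 Y.
Proof.
by apply/rowP=> j; rewrite !mxE; case: (unlift k j) => [i|]; rewrite ?mxE ?mulr0 ?addr0.
Qed.

Lemma hor_projP (a : C) z Z W :
  hor_proj z (a *: Z + W) = a *: hor_proj z Z + hor_proj z W.
Proof.
by rewrite /hor_proj b13Pl; apply/rowP=> j; rewrite !mxE; ring.
Qed.

Lemma hor_projZ (a : C) z Z : hor_proj z (a *: Z) = a *: hor_proj z Z.
Proof. by rewrite /hor_proj b13Zl; apply/rowP=> j; rewrite !mxE; ring. Qed.

Lemma hliftP k z (r : R) X Y :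
  hlift k z (r *: X + Y) = r%:C *: hlift k z X + hlift k z Y.
Proof.
by rewrite /hlift to_cplxP insP scalerDr scalerA mulrC -scalerA hor_projP.
Qed.

Lemma hlift_horizontal k z X : S52 z -> horizontal z (hlift k z X).
Proof.
rewrite /S52 /horizontal /= => Sz.
by rewrite /hlift /hor_proj -scaleNr addrC b13Pl Sz mulr1 addNr.
Qed.

Lemma hlift_cp_J k z X : hlift k z (cp_J X) = 'i *: hlift k z X.
Proof.
rewrite /hlift /cp_J to_realK -hor_projZ scalerA mulrC -scalerA.
congr (hor_proj z (_ *: (_ : 'rV__))).
have := insP k 'i (to_cplx X) 0; rewrite addr0 => ->.
suff -> : ins k 0 0 = 0 :> 'rV[C]_3 by rewrite addr0.
by apply/rowP=> j; rewrite !mxE; case: (unlift k j) => [i|]; rewrite ?mxE.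
Qed.

Lemma aff_scale k (a : C) z : a != 0 -> aff k (a *: z) = aff k z.
Proof.
move=> a0; congr to_real; apply/rowP=> j; rewrite !mxE.
by rewrite invfM mulrACA mulfV// mul1r.
Qed.

Lemma norm1_neq0 (a : C) : `|a| = 1 -> a != 0.
Proof. by move=> a1; rewrite -normr_eq0 a1 oner_eq0. Qed.

Lemma cp_chart_hopf k z (Sz : S52 z) : cp_chart k (hopf Sz) = aff k z.
Proof.
rewrite /cp_chart /=; case: xgetP => [y _ [a a1 <-]|/(_ z)[]].
  by rewrite aff_scale// norm1_neq0.
by exists 1; rewrite /= ?normr1// scale1r.
Qed.

Lemma daff_hlift k z X : z 0 k != 0 -> daff k z (hlift k z X) = X.
Proof.
move=> zk; rewrite /daff -[RHS]to_cplxK; congr to_real; apply/rowP=> j.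
rewrite [LHS]mxE; rewrite /hlift /hor_proj.
set c := b13 _ _; rewrite !mxE liftK unlift_none mulr0 sub0r.
rewrite !mxE; by field.
Qed.

Lemma hlift_daff k z Z : S52 z -> z 0 k != 0 -> horizontal z Z ->
  hlift k z (daff k z Z) = Z.
Proof.
move=> Sz zk hZ; rewrite /hlift /daff to_realK.
set V := _ *: ins _ _ _.
have -> : V = - (Z 0 k / z 0 k) *: z + Z.
  apply/rowP=> j; rewrite !mxE; case: unliftP => [i ->|->]; rewrite ?mxE;
    by field.
rewrite hor_projP /hor_proj Sz scale1r subrr scaler0 add0r.
by rewrite (hZ : b13 Z z = 0) scale0r subr0.
Qed.

Lemma cp_sec_aff k z : S52 z -> z 0 k != 0 ->
  exists2 a : C, `|a| = 1 & cp_sec k (aff k z) = a *: z.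
Proof.
move=> Sz zk.
have E : ins k 1 (to_cplx (aff k z)) = (z 0 k)^-1 *: z.
  rewrite /aff to_realK; apply/rowP=> j; rewrite !mxE.
  by case: unliftP => [i ->|->]; rewrite ?mxE ?mulVf// mulrC.
rewrite /cp_sec E b13Zl b13Zr (Sz : b13 z z = 1) mulr1.
set a := (z 0 k)^-1.
have a0 : a != 0 by rewrite invr_eq0.
have -> : complex.Re (a * a^*%C) = (complex.Re `|a|) ^+ 2.
  have : (a * a^*%C) = (complex.Re `|a|)%:C ^+ 2.
    by rewrite -[a^*%C]/(Num.conj a) -normCK RRe_real// normr_real.
  by move=> ->; rewrite -rmorphXn.
have na : `|a| = (complex.Re `|a|)%:C by rewrite RRe_real// normr_real.
have ra : 0 < complex.Re `|a|.
  by rewrite -ltcR -na normr_gt0.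
rewrite sqrtr_sqr gtr0_norm// scalerA.
exists ((complex.Re `|a|)^-1%:C * a) => //.
rewrite -[(complex.Re _)^-1%:C]/(real_complex R _) (fmorphV (real_complex R)).
rewrite normrM normfV /= -na normr_id mulVf// normr_eq0//.
Qed.

Lemma S52Z (a : C) z : `|a| = 1 -> S52 z -> S52 (a *: z).
Proof.
by move=> a1 Sz; rewrite /S52 /= b13Zl b13Zr (Sz : _ = _) mulr1 conjCM.
Qed.

Lemma cp_sec_S52 k z : S52 z -> z 0 k != 0 -> S52 (cp_sec k (aff k z)).
Proof. by move=> Sz zk; have [a a1 ->] := cp_sec_aff Sz zk; apply: S52Z. Qed.

Lemma hliftZ k (a : C) z X : `|a| = 1 ->
  hlift k (a *: z) X = a *: hlift k z X.
Proof.
move=> a1; rewrite /hlift mxE -scalerA; set V := _ *: ins _ _ _.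
rewrite /hor_proj b13Zl b13Zr mulrA conjCM// mul1r scalerBr !scalerA.
by rewrite [b13 V z * a]mulrC.
Qed.

Lemma form_cp_metric k w X Y : gform (cp_metric k w) X Y =
  complex.Re (b13 (hlift k (cp_sec k w) X) (hlift k (cp_sec k w) Y)).
Proof.
pose h X := hlift k (cp_sec k w) X; pose B X Y := complex.Re (b13 (h X) (h Y)).
have BPl r X1 X2 Y1 : B (r *: X1 + X2) Y1 = r * B X1 Y1 + B X2 Y1.
  rewrite /B /h hliftP b13Pl raddfD/=; congr (_ + _).
  by case: (b13 _ _) => /= *; rewrite mul0r subr0.
have BPr r X1 X2 Y1 : B Y1 (r *: X1 + X2) = r * B Y1 X1 + B Y1 X2.
  rewrite /B /h hliftP b13Pr raddfD/=; congr (_ + _).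
  by case: (b13 _ _) => /= *; rewrite oppr0 mul0r subr0.
have B0l Y1 : B 0 Y1 = 0.
  have := BPl 1 0 0 Y1; rewrite scale1r addr0 mul1r => /eqP.
  by rewrite -subr_eq0 opprD addNKr oppr_eq0 => /eqP.
have B0r Y1 : B Y1 0 = 0.
  have := BPr 1 0 0 Y1; rewrite scale1r addr0 mul1r => /eqP.
  by rewrite -subr_eq0 opprD addNKr oppr_eq0 => /eqP.
have BSl (s : seq 'I_(2 + 2)) (F : 'I_(2 + 2) -> R) Y1 :
    B (\sum_(i <- s) F i *: basis_vec R i) Y1
    = \sum_(i <- s) F i * B (basis_vec R i) Y1.
  by elim: s => [|i s IH]; rewrite ?big_nil ?B0l// !big_cons BPl IH.
have BSr (s : seq 'I_(2 + 2)) (F : 'I_(2 + 2) -> R) Y1 :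
    B Y1 (\sum_(i <- s) F i *: basis_vec R i)
    = \sum_(i <- s) F i * B Y1 (basis_vec R i).
  by elim: s => [|i s IH]; rewrite ?big_nil ?B0r// !big_cons BPr IH.
rewrite -/(h X) -/(h Y) -/(B X Y) [X in RHS]row_sum_delta [Y in RHS]row_sum_delta.
rewrite BSl /gform !mxE.
under [RHS]eq_bigr do rewrite BSr mulr_sumr.
rewrite exchange_big /=; apply: eq_bigr => j _.
rewrite !mxE mulr_suml; apply: eq_bigr => i _.
by rewrite !mxE -/(h _) -/(h _) -/(B _ _); ring.
Qed.

Lemma hopf_submersion k z Z W : S52 z -> z 0 k != 0 ->
  horizontal z Z -> horizontal z W ->
  gform (cp_metric k (aff k z)) (daff k z Z) (daff k z W)
  = complex.Re (b13 Z W).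
Proof.
move=> Sz zk hZ hW; rewrite form_cp_metric.
have [a a1 ->] := cp_sec_aff Sz zk.
by rewrite !hliftZ// !hlift_daff// b13Zl b13Zr mulrA conjCM// mul1r.
Qed.

Lemma sumsq_neq0 (a b : R) : a +i* b != 0 -> a ^+ 2 + b ^+ 2 != 0.
Proof.
by rewrite paddr_eq0 ?sqr_ge0// !sqrf_eq0 eq_complex.
Qed.
Lemma is_derive_Re_div (p P q Q : C) : q != 0 ->
  is_derive (0:R) (1:R) (fun t : R => complex.Re ((p + t%:C * P) / (q + t%:C * Q)))
   (complex.Re ((P * q - p * Q) / q ^+ 2)).
Proof.
case: p P q Q => [p1 p2] [P1 P2] [q1 q2] [Q1 Q2] /sumsq_neq0 q0 /=.
have q0' : (q1 * q1 - q2 * q2) ^+ 2 + (q1 * q2 + q2 * q1) ^+ 2 != 0.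
  by rewrite (_ : _ + _ = (q1 ^+ 2 + q2 ^+ 2) ^+ 2) ?expf_neq0//; ring.
have lin (a b : R) : is_derive (0:R) (1:R) (fun t : R => a + t * b) b.
  have -> : (fun t : R => a + t * b) = cst a + b \*: (@id R).
    by apply/funext => t; rewrite !fctE mulrC.
  by apply: is_derive_eq; rewrite add0r /GRing.scale /= mulr1.
pose f1 t := p1 + t * P1; pose f2 t := p2 + t * P2.
pose g1 t := q1 + t * Q1; pose g2 t := q2 + t * Q2.
have df1 : is_derive (0:R) (1:R) f1 P1 by exact: lin.
have df2 : is_derive (0:R) (1:R) f2 P2 by exact: lin.
have dg1 : is_derive (0:R) (1:R) g1 Q1 by exact: lin.
have dg2 : is_derive (0:R) (1:R) g2 Q2 by exact: lin.
have n0 : (g1 * g1 + g2 * g2) 0 != 0.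
  by rewrite !fctE /g1 /g2 !mul0r !addr0 -!expr2.
have dV := is_deriveV n0 (is_deriveD (is_deriveM dg1 dg1) (is_deriveM dg2 dg2)).
set F := (X in is_derive _ _ X _).
have -> : F = (f1 * g1 + f2 * g2) * (fun y => ((g1 * g1 + g2 * g2) y)^-1).
  apply/funext => t; rewrite /F !fctE /f1 /f2 /g1 /g2 !mul0r !subr0 !addr0 !expr2.
  by rewrite mulrN opprK !mulrA -mulrDl.
apply: is_derive_eq; rewrite !fctE /f1 /f2 /g1 /g2 /= !mul0r !addr0.
rewrite /GRing.scale /=.
rewrite -!expr2; field.
by rewrite q0 q0'.
Qed.

Lemma is_derive_Im_div (p P q Q : C) : q != 0 ->
  is_derive (0:R) (1:R) (fun t : R => complex.Im ((p + t%:C * P) / (q + t%:C * Q)))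
   (complex.Im ((P * q - p * Q) / q ^+ 2)).
Proof.
have ImE (x : C) : complex.Im x = complex.Re (- 'i * x).
  by case: x => a b /=; rewrite oppr0 mul0r sub0r mulN1r opprK.
move=> q0; rewrite ImE.
set F := (X in is_derive _ _ X _).
have -> : F = fun t => complex.Re ((- 'i * p + t%:C * (- 'i * P)) / (q + t%:C * Q)).
  by apply/funext => t; rewrite /F ImE; congr complex.Re; rewrite !mulrA;
     congr (_ / _); ring.
have -> : - 'i * ((P * q - p * Q) / q ^+ 2)
    = (- 'i * P * q - - 'i * p * Q) / q ^+ 2 by field.
exact: is_derive_Re_div.
Qed.

Lemma is_derive_aff k z Z : z 0 k != 0 ->
  is_derive (0 : R) 1 (fun t : R => aff k (z + t%:C *: Z)) (daff k z Z).
Proof.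
move=> zk.
pose q (j : 'I_2) t :=
  (z 0 (lift k j) + t%:C * Z 0 (lift k j)) / (z 0 k + t%:C * Z 0 k).
have E (i : 'I_1) (j : 'I_(2 + 2)) : is_derive (0 : R) 1
    (fun t : R => aff k (z + t%:C *: Z) i j) (daff k z Z i j).
  rewrite ord1 -(fintype.splitK j); case: (fintype.split j) => j' /=.
    rewrite [daff _ _ _ _ _]row_mxEl !mxE.
    have -> : (fun t : R => aff k (z + t%:C *: Z) 0 (lshift 2 j'))
        = (fun t => complex.Re (q j' t)).
      by apply/funext => t; rewrite [LHS]row_mxEl !mxE.
    exact: is_derive_Re_div.
  rewrite [daff _ _ _ _ _]row_mxEr !mxE.
  have -> : (fun t : R => aff k (z + t%:C *: Z) 0 (rshift 2 j'))
      = (fun t => complex.Im (q j' t)).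
    by apply/funext => t; rewrite [LHS]row_mxEr !mxE.
  exact: is_derive_Im_div.
have D : derivable (fun t : R => aff k (z + t%:C *: Z)) (0 : R) 1.
  by apply/derivable_mxP => i j; have [] := E i j.
apply: DeriveDef => //; rewrite derive_mx//.
by apply/matrixP=> i j; rewrite mxE; have [] := E i j.
Qed.

End ProjectiveSpaceTheory.

(* Main.v *)
Require Import Defs.
From HB Require Import structures.
From mathcomp Require Import all_boot all_order all_algebra.
From mathcomp Require Import complex.
From mathcomp Require Import all_classical all_reals all_analysis.
From mathcomp Require Import ring lra.

(* Let c(u,v,w) = <h(u,v), Jw>, which is symmetric for a Lagrangian surface. If e
   is a null vector with h(e,e) not proportional to Je, then isotropy along e
   gives c(e,e,e') = 0 for the other null direction e'; non-minimality then gives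
   c(e,e',e') <> 0, and isotropy along e' gives c(e',e',e') = 0. Hence the trace
   of c is a nowhere vanishing null 1-form, which supplies a smooth null coframe
   p, q in which c = lam q^3 + mu (q p^2 + p q p + p^2 q) with mu nonzero. Lift
   the surface to a map z into the cone of vectors of C^3 with b13 z z <> 0: the
   frame z, E1, E2 of C^3 formed with the horizontal lifts of the dual null vectors,
   rescaled so that mu = 1/2, satisfies Cartan's structure equations. Comparing
   their real and imaginary parts, the Levi-Civita connection form of the
   surface vanishes, so the surface is flat, while the Gauss equation gives it
   curvature 1. *)

Set Implicit Arguments.
Unset Strict Implicit.
Unset Printing Implicit Defensive.

Import Order.TTheory GRing.Theory Num.Theory.
Import numFieldNormedType.Exports.

Local Open Scope classical_set_scope.
Local Open Scope ring_scope.
Local Open Scope complex_scope.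

(** * Directional derivatives *)

Section DirectionalDerivatives.
Variables (R : realType) (n : nat).
Implicit Types (f : 'rV[R]_n -> R) (x u v : 'rV[R]_n).

(** The null vectors e, e' are found separately at each point, with no continuity between the
    choices. What varies smoothly is the metric trace of c: for a null coframe with metric p q + q p
    it is 2 mu p. Hence P = 2 mu p is smooth, and Q = q / (2 mu) is recovered from P and the metric.
    Passing to P, Q turns mu into 1/2, so that the skew part 2 i c of the hermitian connection has
    coefficient 1 on the mixed terms. The coefficient lam may stay without regularity: it is never
    differentiated, and it enters the structure equations only through lam q_i q_j, whose
    antisymmetrization is zero. Working with vectors of C^3 lets one hermitian connection carry the
    Levi-Civita connection in its real parts and c in its imaginary parts, so that the Gauss and
    Codazzi equations both come from the commutation of derivatives in C^3. Smoothness in a chart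
    speaks only of iterated partial derivatives; derivatives in arbitrary directions and the
    symmetry of mixed derivatives have to be derived from it. *)

Lemma is_derive_line f x v (s : R) : derivable f (x + s *: v) v ->
  is_derive s 1 (fun t : R => f (x + t *: v)) ('D_v f (x + s *: v)).
Proof.
have E : (fun h : R => h^-1 *: (((fun t : R => f (x + t *: v)) \o shift s) (h *: 1)
      - f (x + s *: v))) =
    (fun h : R => h^-1 *: ((f \o shift (x + s *: v)) (h *: v) - f (x + s *: v))).
  by apply/funext => h /=; rewrite -[h *: 1]/(h * 1) mulr1 scalerDl addrCA.
move=> df; split; first by rewrite /derivable E.
by rewrite /derive E.
Qed.

(** The bound on [c] by absolute values covers both signs of [h], so no orientation of the segment
    has to be tracked. *)
Lemma MVT_line f x v (h : R) :
  (forall t : R, `|t| <= `|h| -> derivable f (x + t *: v) v) ->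
  exists2 c, `|c| <= `|h| & f (x + h *: v) - f x = h * 'D_v f (x + c *: v).
Proof.
move=> df.
have D (t : R) (th : `|t| <= `|h|) :
    is_derive t (1:R) (fun t : R => f (x + t *: v)) ('D_v f (x + t *: v)).
  by apply: is_derive_line; exact: df.
have C (a b : R) : (forall t, a <= t <= b -> `|t| <= `|h|) ->
    {within `[a, b], continuous (fun t : R => f (x + t *: v))}.
  move=> ab; apply: derivable_within_continuous => t.
  by rewrite in_itv => /ab ta; have [] := D _ ta.
have [h0|h0] := leP 0 h.
  have H t : 0 <= t <= h -> `|t| <= `|h|.
    by move=> /andP[t0 th]; rewrite !ger0_norm.
  have [|c] := @MVT_segment R _ (fun t => 'D_v f (x + t *: v)) 0 h h0 _ (C _ _ H).
    by move=> t; rewrite in_itv => /andP[t0 th]; apply: D; apply: H; rewrite !ltW.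
  rewrite in_itv => /H ch; rewrite scale0r addr0 subr0 mulrC => E.
  by exists c.
have H t : h <= t <= 0 -> `|t| <= `|h|.
  by move=> /andP[ht t0]; rewrite !ler0_norm ?(ltW h0)// lerN2.
have [|c] := @MVT_segment R _ (fun t => 'D_v f (x + t *: v)) h 0 (ltW h0) _ (C _ _ H).
  by move=> t; rewrite in_itv => /andP[t0 th]; apply: D; apply: H; rewrite !ltW.
rewrite in_itv => /H ch; rewrite scale0r addr0 sub0r => E.
by exists c => //; rewrite -opprB E mulrN opprK mulrC.
Qed.

Lemma near_parallelogram (P : set 'rV[R]_n) x u v : (\forall y \near x, P y) ->
  exists2 d : R, 0 < d & forall a b : R, `|a| <= d -> `|b| <= d ->
    P (x + a *: u + b *: v).
Proof.
move=> /nbhs_normP[r /= r0 rP].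
have M0 : 0 < `|u| + `|v| + 1 by rewrite ltr_wpDl.
exists (r / 2 / (`|u| + `|v| + 1)); first by rewrite !divr_gt0.
move=> a b; set d := r / 2 / _ => ad bd; apply: rP => /=.
rewrite /ball_/= opprD addrA opprD addrA subrr sub0r -opprD normrN.
apply: le_lt_trans (ler_normD _ _) _; rewrite !normrZ.
have d0 : 0 <= d by rewrite !divr_ge0// ltW.
have : `|a| * `|u| + `|b| * `|v| <= d * (`|u| + `|v| + 1).
  rewrite !mulrDr mulr1 -[leLHS]addr0 lerD// lerD// ler_wpM2r//.
move=> /le_lt_trans; apply; rewrite /d divfK ?gt_eqF//.
by rewrite ltr_pdivrMr// ltr_pMr// ltr1n.
Qed.

(** The increment is split into a step along [v] from [x] followed by a step along [u]. The mean
    value theorem on each step, with continuity of both derivatives at [x], gives the limit. *)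
Lemma is_derive_dirD f x u v (a b : R) :
  (\forall y \near x, derivable f y u /\ derivable f y v) ->
  {for x, continuous ('D_u f)} -> {for x, continuous ('D_v f)} ->
  is_derive x (a *: u + b *: v) f (a * 'D_u f x + b * 'D_v f x).
Proof.
move=> df cu cv.
suff L : (fun h : R => h^-1 *: ((f \o shift x) (h *: (a *: u + b *: v)) - f x)) @ 0^'
    --> a * 'D_u f x + b * 'D_v f x.
  by split; [apply/cvg_ex; eexists; exact: L|exact/cvg_lim].
apply/cvgrPdist_lt => e e0.
have K0 : 0 < `|a| + `|b| + 1 by rewrite ltr_wpDl.
pose e' := e / (`|a| + `|b| + 1).
have e'0 : 0 < e' by rewrite divr_gt0.
have nu : \forall y \near x, `|'D_u f x - 'D_u f y| < e'.
  by move/cvgrPdist_lt : cu; apply.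
have nv : \forall y \near x, `|'D_v f x - 'D_v f y| < e'.
  by move/cvgrPdist_lt : cv; apply.
have [d d0 dP] := near_parallelogram u v (filterI (filterI nu nv) df).
near=> h.
have h0 : h != 0 by near: h; exact: nbhs_dnbhs_neq.
have hd : `|h| * (`|a| + `|b| + 1) <= d.
  rewrite -ler_pdivlMr//; near: h; apply: dnbhs0_le; exact: divr_gt0.
have ha : `|h * a| <= d.
  apply: le_trans hd; rewrite normrM ler_wpM2l// -addrA lerDl addr_ge0//.
have hb : `|h * b| <= d.
  apply: le_trans hd; rewrite normrM ler_wpM2l// addrAC lerDr addr_ge0//.
have [c ch Ec] : exists2 c, `|c| <= `|h * a| &
    f (x + (h * b) *: v + (h * a) *: u) - f (x + (h * b) *: v)
    = (h * a) * 'D_u f (x + (h * b) *: v + c *: u).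
  apply: MVT_line => t th.
  by have [_ [+ _]] := dP t (h * b) (le_trans th ha) hb; rewrite (addrAC x).
have [c' ch' Ec'] : exists2 c', `|c'| <= `|h * b| &
    f (x + (h * b) *: v) - f x = (h * b) * 'D_v f (x + c' *: v).
  apply: MVT_line => t th.
  have := dP 0 t; rewrite normr0 (ltW d0) scale0r addr0.
  by move=> /(_ isT (le_trans th hb))[_ []].
have -> : h^-1 *: ((f \o shift x) (h *: (a *: u + b *: v)) - f x)
    = a * 'D_u f (x + (h * b) *: v + c *: u) + b * 'D_v f (x + c' *: v).
  have -> : (f \o shift x) (h *: (a *: u + b *: v))
      = f (x + (h * b) *: v + (h * a) *: u).
    by rewrite /= scalerDr !scalerA addrC addrA (addrAC x).
  rewrite -(subrKA (f (x + (h * b) *: v))).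
  by rewrite Ec' Ec -[_ *: _]/(_ * _); field.
have [/= [A _] _] := dP c (h * b) (le_trans ch ha) hb.
have n0 : `|0 : R| <= d by rewrite normr0 ltW.
have [/= [_ B] _] := dP 0 c' n0 (le_trans ch' hb).
rewrite addrAC in A; rewrite scale0r addr0 in B.
rewrite opprD addrACA -!mulrBr.
apply: le_lt_trans (ler_normD _ _) _; rewrite !normrM.
apply: le_lt_trans (lerD (ler_wpM2l (normr_ge0 a) (ltW A))
                         (ler_wpM2l (normr_ge0 b) (ltW B))) _.
rewrite -mulrDl /e' mulrA ltr_pdivrMr// mulrC ltr_pM2l// ltrDl//.
Unshelve. all: by end_near. Qed.

(** The mean value theorem is applied twice: along [u] to the difference [f (y + h *: v) - f y],
    then along [v] to ['D_u f]. So [D] is a value of the mixed derivative near [x]. *)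
Lemma second_difference f x u v (e : R) : 0 < e ->
  (\forall y \near x, derivable f y u /\ derivable ('D_u f) y v) ->
  {for x, continuous ('D_v ('D_u f))} ->
  exists2 d : R, 0 < d & forall h, `|h| <= d ->
  exists2 D : R, `|'D_v ('D_u f) x - D| < e &
    f (x + h *: u + h *: v) - f (x + h *: u) - f (x + h *: v) + f x
    = h * (h * D).
Proof.
move=> e0 df c.
have nc : \forall y \near x, `|'D_v ('D_u f) x - 'D_v ('D_u f) y| < e.
  by move/cvgrPdist_lt : c; apply.
have [d d0 dP] := near_parallelogram u v (filterI nc df).
exists d => // h hd.
have d0' : `|0 : R| <= d by rewrite normr0 ltW.
pose phi y := f (y + h *: v) - f y.
have dphi (t : R) : `|t| <= `|h| -> is_derive (x + t *: u) u phi
    ('D_u f (x + t *: u + h *: v) - 'D_u f (x + t *: u)).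
  move=> th.
  have [_ [d1 _]] := dP t h (le_trans th hd) hd.
  have [_ [d2 _]] := dP t 0 (le_trans th hd) d0'.
  rewrite scale0r addr0 in d2.
  have i1 : is_derive (x + t *: u) u (fun y => f (y + h *: v))
      ('D_u f (x + t *: u + h *: v)).
    have E : (fun s : R => s^-1 *: (((fun y => f (y + h *: v)) \o shift (x + t *: u))
          (s *: u) - f (x + t *: u + h *: v)))
        = (fun s : R => s^-1 *: ((f \o shift (x + t *: u + h *: v)) (s *: u)
          - f (x + t *: u + h *: v))).
      by apply/funext => s /=; rewrite !addrA.
    by apply: DeriveDef; [move: d1; rewrite /derivable -E|rewrite /derive E].
  have i2 : is_derive (x + t *: u) u f ('D_u f (x + t *: u)) by apply/derivableP.
  exact: is_deriveB.
have [c1 c1h E1] : exists2 c, `|c| <= `|h| &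
    phi (x + h *: u) - phi x = h * 'D_u phi (x + c *: u).
  by apply: MVT_line => t /dphi[].
have [c2 c2h E2] : exists2 c, `|c| <= `|h| &
    'D_u f (x + c1 *: u + h *: v) - 'D_u f (x + c1 *: u)
     = h * 'D_v ('D_u f) (x + c1 *: u + c *: v).
  apply: (@MVT_line ('D_u f) (x + c1 *: u) v h) => t th.
  by have [_ [_]] := dP c1 t (le_trans c1h hd) (le_trans th hd).
exists ('D_v ('D_u f) (x + c1 *: u + c2 *: v)).
  by have [] := dP c1 c2 (le_trans c1h hd) (le_trans c2h hd).
rewrite -E2; have [_ <-] := dphi c1 c1h; rewrite -E1 /phi.
by rewrite opprB addrA addrAC.
Qed.

(** Schwarz's theorem: the second difference is symmetric in [u] and [v], so for one small [h] both
    mixed derivatives are within e / 2 of the same quotient. *)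
Lemma derive_comm f x u v :
  (\forall y \near x, derivable f y u /\ derivable ('D_u f) y v) ->
  (\forall y \near x, derivable f y v /\ derivable ('D_v f) y u) ->
  {for x, continuous ('D_v ('D_u f))} -> {for x, continuous ('D_u ('D_v f))} ->
  'D_v ('D_u f) x = 'D_u ('D_v f) x.
Proof.
move=> duv dvu cuv cvu; apply/eqP; rewrite -subr_eq0 -normr_eq0; apply/eqP.
apply/le_anti; rewrite normr_ge0 andbT; apply/ler_addgt0Pl => e e0.
rewrite addr0.
have e20 : 0 < e / 2 by rewrite divr_gt0.
have [d1 d10 d1P] := second_difference e20 duv cuv.
have [d2 d20 d2P] := second_difference e20 dvu cvu.
pose h := Num.min d1 d2.
have h0 : 0 < h by rewrite lt_min d10 d20.
have h1 : `|h| <= d1 by rewrite gtr0_norm// ge_min lexx.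
have h2 : `|h| <= d2 by rewrite gtr0_norm// ge_min lexx orbT.
have [D1 D1e E1] := d1P h h1.
have [D2 D2e E2] := d2P h h2.
have DD : D1 = D2.
  apply: (mulfI (lt0r_neq0 h0)); apply: (mulfI (lt0r_neq0 h0)).
  by rewrite -E1 -E2 (addrAC x (h *: v)); ring.
rewrite -(subrKA D1) {2}DD [e]splitr.
apply: le_trans (ler_normD _ _) _; rewrite lerD ?ltW// distrC//.
Qed.

End DirectionalDerivatives.

(** * Smooth complex-valued functions *)

Definition rpart (R : realType) (n : nat) (f : 'rV[R]_n -> R[i]) : 'rV[R]_n -> R :=
  fun y => complex.Re (f y).
Definition ipart (R : realType) (n : nat) (f : 'rV[R]_n -> R[i]) : 'rV[R]_n -> R :=
  fun y => complex.Im (f y).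

(* Locked, as are the other differential operators below: unification would
   otherwise unfold them down to limits of difference quotients. *)
HB.lock Definition cderive (R : realType) (n : nat) (v : 'rV[R]_n)
    (f : 'rV[R]_n -> R[i]) (x : 'rV[R]_n) : R[i] :=
  'D_v (rpart f) x +i* 'D_v (ipart f) x.

Section ComplexDerivatives.
Variables (R : realType) (n : nat).
Local Notation C := R[i].
Implicit Types (f g : 'rV[R]_n -> C) (x v : 'rV[R]_n).

Lemma cderiveE v f x : cderive v f x = 'D_v (rpart f) x +i* 'D_v (ipart f) x.
Proof. by rewrite unlock. Qed.

Definition is_cderive x v f (df : C) : Prop :=
  is_derive x v (rpart f) (complex.Re df) /\
  is_derive x v (ipart f) (complex.Im df).

Lemma rpart_cderive v f : rpart (cderive v f) = 'D_v (rpart f).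
Proof. by apply/funext => x; rewrite /rpart cderiveE. Qed.

Lemma ipart_cderive v f : ipart (cderive v f) = 'D_v (ipart f).
Proof. by apply/funext => x; rewrite /ipart cderiveE. Qed.

Lemma cderive_val x v f df : is_cderive x v f df -> cderive v f x = df.
Proof. by move=> [[_ r] [_ i]]; rewrite cderiveE r i; case: (df). Qed.

Lemma is_cderive_eq x v f df df' : is_cderive x v f df -> df = df' ->
  is_cderive x v f df'.
Proof. by move=> ? <-. Qed.

Lemma is_cderive_self x v f df : is_cderive x v f df ->
  is_cderive x v f (cderive v f x).
Proof. by move=> fd; rewrite (cderive_val fd). Qed.

Lemma is_cderive_near x v f g df : (\forall y \near x, f y = g y) ->
  is_cderive x v f df -> is_cderive x v g df.
Proof.
move=> fg [fr fi]; split; [apply: near_eq_is_derive fr|apply: near_eq_is_derive fi];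
  by move: fg; apply: filterS => y; rewrite /rpart /ipart => ->.
Qed.

Lemma cderive_near x v f g : (\forall y \near x, f y = g y) ->
  cderive v f x = cderive v g x.
Proof.
move=> fg; rewrite !cderiveE; congr (_ +i* _); apply: near_eq_derive;
  by move: fg; apply: filterS => y; rewrite /rpart /ipart => ->.
Qed.

Lemma is_cderive_cst x v (c : C) : is_cderive x v (fun=> c) 0.
Proof. by split; exact: is_derive_cst. Qed.

Lemma is_cderiveD x v f g df dg : is_cderive x v f df -> is_cderive x v g dg ->
  is_cderive x v (fun y => f y + g y) (df + dg).
Proof.
move=> [fr fi] [gr gi]; rewrite /is_cderive.
have -> : rpart (fun y => f y + g y) = rpart f + rpart g.
  by apply/funext => y; rewrite /rpart !fctE raddfD.
have -> : ipart (fun y => f y + g y) = ipart f + ipart g.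
  by apply/funext => y; rewrite /ipart !fctE raddfD.
by rewrite !raddfD/=; split; exact: is_deriveD.
Qed.

Lemma is_cderiveM x v f g df dg : is_cderive x v f df -> is_cderive x v g dg ->
  is_cderive x v (fun y => f y * g y) (df * g x + f x * dg).
Proof.
move=> [fr fi] [gr gi]; rewrite /is_cderive.
have -> : rpart (fun y => f y * g y) = rpart f * rpart g - ipart f * ipart g.
  by apply/funext => y; rewrite /rpart /ipart !fctE; case: (f y) (g y) => [? ?] [].
have -> : ipart (fun y => f y * g y) = rpart f * ipart g + ipart f * rpart g.
  apply/funext => y; rewrite /rpart /ipart !fctE.
  by case: (f y) (g y) => [a b] [c d] /=; rewrite addrC.
have Hr := is_deriveB (is_deriveM fr gr) (is_deriveM fi gi).
have Hi := is_deriveD (is_deriveM fr gi) (is_deriveM fi gr).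
split; [apply: (is_derive_eq Hr)|apply: (is_derive_eq Hi)];
  rewrite /rpart /ipart; case: (f x) (g x) df dg {fr fi gr gi Hr Hi}
    => [f1 f2] [g1 g2] [d1 d2] [e1 e2] /=;
  by rewrite /GRing.scale/=; ring.
Qed.

Lemma is_cderiveN x v f df : is_cderive x v f df ->
  is_cderive x v (fun y => - f y) (- df).
Proof.
move=> fd; have := is_cderiveM (is_cderive_cst x v (- 1)) fd.
by rewrite mul0r add0r mulN1r; under eq_fun do rewrite mulN1r.
Qed.

Lemma is_cderiveB x v f g df dg : is_cderive x v f df -> is_cderive x v g dg ->
  is_cderive x v (fun y => f y - g y) (df - dg).
Proof. by move=> fd /is_cderiveN; exact: is_cderiveD. Qed.

Lemma is_cderiveC x v f df : is_cderive x v f df ->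
  is_cderive x v (fun y => (f y)^*%C) df^*%C.
Proof.
move=> [fr fi]; rewrite /is_cderive.
have -> : rpart (fun y => (f y)^*%C) = rpart f.
  by apply/funext => y; rewrite /rpart; case: (f y).
have -> : ipart (fun y => (f y)^*%C) = - ipart f.
  by apply/funext => y; rewrite /ipart !fctE; case: (f y).
by case: df fr fi => a b fr fi; split; [|exact: is_deriveN].
Qed.

Lemma is_cderive_real x v (f : 'rV[R]_n -> R) (df : R) : is_derive x v f df ->
  is_cderive x v (fun y => (f y)%:C) df%:C.
Proof. by move=> fd; split=> //=; exact: is_derive_cst. Qed.

Lemma complex_invE (a : C) :
  a^-1 = a^*%C * ((complex.Re a ^+ 2 + complex.Im a ^+ 2)^-1)%:C.
Proof.
by case: a => a b; apply/eqP; rewrite eq_complex /= !mulr0 subr0 add0r eqxx mulNr/=.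
Qed.

(** The quotient is written as the conjugate of f over |f|^2, whose denominator is real. *)
Lemma is_cderiveV x v f df : f x != 0 -> is_cderive x v f df ->
  is_cderive x v (fun y => (f y)^-1) (- df / f x ^+ 2).
Proof.
move=> fx0 fd; have [fr fi] := fd.
pose N : 'rV[R]_n -> R := rpart f * rpart f + ipart f * ipart f.
have dN : derivable N x v.
  by have [] := is_deriveD (is_deriveM fr fr) (is_deriveM fi fi).
have N0 : N x != 0.
  rewrite /N !fctE -!expr2 /rpart /ipart.
  by move: fx0; case: (f x) => a b; exact: sumsq_neq0.
have NE : (fun y => (N y)%:C) = fun y => f y * (f y)^*%C.
  apply/funext => y; rewrite /N !fctE /rpart /ipart.
  by case: (f y) => a b; apply/eqP; rewrite eq_complex; apply/andP; split; apply/eqP => /=; ring.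
have dNE : ('D_v N x)%:C = df * (f x)^*%C + f x * df^*%C.
  rewrite -(cderive_val (is_cderiveM fd (is_cderiveC fd))) -NE.
  exact: (esym (cderive_val (is_cderive_real (DeriveDef dN erefl)))).
have dV := is_cderive_real (DeriveDef (derivableV N0 dN) (deriveV N0 dN)).
have := is_cderiveM (is_cderiveC fd) dV.
have -> : (fun y => (f y)^*%C * ((N y)^-1)%:C) = fun y => (f y)^-1.
  by apply/funext => y; rewrite complex_invE /N !fctE !expr2.
move=> H; apply: is_cderive_eq H _.
rewrite -[_ *: _]/(_ * _) rmorphM rmorphN !fmorphV rmorphXn/= dNE.
have -> : (N x)%:C = f x * (f x)^*%C by rewrite -[LHS]/((fun y => (N y)%:C) x) NE.
have : (f x)^*%C != 0 by rewrite conjc_eq0.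
by move: fx0; move: (f x) (f x)^*%C => a b a0 b0; field; rewrite a0 b0.
Qed.

End ComplexDerivatives.

Section ComplexContinuity.
Variables (R : realType) (n : nat).
Implicit Types (f g : 'rV[R]_n -> R[i]) (x : 'rV[R]_n).

Definition ccontinuous f x : Prop :=
  {for x, continuous (rpart f)} /\ {for x, continuous (ipart f)}.

Lemma continuous_near_eq (T : topologicalType) (p : T) (r s : T -> R) :
  (\forall y \near p, r y = s y) -> {for p, continuous r} -> {for p, continuous s}.
Proof.
move=> rs cr; suff : s @ p --> r p by rewrite (nbhs_singleton rs).
by apply: cvg_trans cr; apply: near_eq_cvg; move: rs; apply: filterS.
Qed.

Lemma ccontinuous_near f g x : (\forall y \near x, f y = g y) ->
  ccontinuous f x -> ccontinuous g x.
Proof.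
move=> fg [fr fi]; split; [apply: continuous_near_eq fr|apply: continuous_near_eq fi];
  by move: fg; apply: filterS => y; rewrite /rpart /ipart => ->.
Qed.

Lemma ccontinuous_cst x (c : R[i]) : ccontinuous (fun=> c) x.
Proof. by split; exact: cst_continuous. Qed.

Lemma ccontinuousD f g x : ccontinuous f x -> ccontinuous g x ->
  ccontinuous (fun y => f y + g y) x.
Proof.
move=> [fr fi] [gr gi]; split.
  rewrite (_ : rpart _ = rpart f + rpart g); first exact: continuousD.
  by apply/funext => y; rewrite /rpart !fctE raddfD.
rewrite (_ : ipart _ = ipart f + ipart g); first exact: continuousD.
by apply/funext => y; rewrite /ipart !fctE raddfD.
Qed.

Lemma ccontinuousM f g x : ccontinuous f x -> ccontinuous g x ->
  ccontinuous (fun y => f y * g y) x.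
Proof.
move=> [fr fi] [gr gi]; split.
  rewrite (_ : rpart _ = rpart f * rpart g - ipart f * ipart g).
    exact: (continuousB (continuousM fr gr) (continuousM fi gi)).
  by apply/funext => y; rewrite /rpart /ipart !fctE; case: (f y) (g y) => [? ?] [].
rewrite (_ : ipart _ = rpart f * ipart g + ipart f * rpart g).
  exact: (continuousD (continuousM fr gi) (continuousM fi gr)).
apply/funext => y; rewrite /rpart /ipart !fctE.
by case: (f y) (g y) => [a b] [c d] /=; rewrite addrC.
Qed.

Lemma ccontinuousC f x : ccontinuous f x -> ccontinuous (fun y => (f y)^*%C) x.
Proof.
move=> [fr fi]; split.
  rewrite (_ : rpart _ = rpart f)//.
  by apply/funext => y; rewrite /rpart; case: (f y).
rewrite (_ : ipart _ = - ipart f); first exact: continuousN.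
by apply/funext => y; rewrite /ipart !fctE; case: (f y).
Qed.

Lemma ccontinuousV f x : f x != 0 -> ccontinuous f x ->
  ccontinuous (fun y => (f y)^-1) x.
Proof.
move=> fx0 [fr fi].
pose N : 'rV[R]_n -> R := rpart f * rpart f + ipart f * ipart f.
have N0 : N x != 0.
  rewrite /N !fctE -!expr2 /rpart /ipart.
  by move: fx0; case: (f x) => a b; exact: sumsq_neq0.
have cN : {for x, continuous N} := continuousD (continuousM fr fr) (continuousM fi fi).
have cV : {for x, continuous (fun y => (N y)^-1)} by exact: (cvgV N0 cN).
split.
  rewrite (_ : rpart _ = rpart f * (fun y => (N y)^-1)).
    exact: (continuousM fr cV).
  apply/funext => y; rewrite /rpart complex_invE /N !fctE /rpart /ipart -!expr2.
  by case: (f y) => a b /=; rewrite mulr0 subr0.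
rewrite (_ : ipart _ = - ipart f * (fun y => (N y)^-1)).
  exact: (continuousM (continuousN fi) cV).
apply/funext => y; rewrite /ipart complex_invE /N !fctE /rpart /ipart -!expr2.
by case: (f y) => a b /=; rewrite mulr0 add0r.
Qed.

End ComplexContinuity.

(** * Complex-valued functions of class C^k and C^oo *)

Section ComplexSmooth.
Variables (R : realType) (n : nat) (U : set 'rV[R]_n).
Hypothesis oU : open U.
Local Notation C := R[i].
Local Notation e_ := (basis_vec R).
Implicit Types (f g : 'rV[R]_n -> C) (x : 'rV[R]_n).

(** The order is kept finite because closure under products and inverses is an induction on it: the
    derivative of such an expression involves the factors again, at one order less. *)
Fixpoint ccont_diff k f : Prop :=
  (forall x, U x -> ccontinuous f x) /\
  if k is k'.+1 then forall i,
      (forall x, U x -> is_cderive x (e_ i) f (cderive (e_ i) f x)) /\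
      ccont_diff k' (cderive (e_ i) f)
  else True.

Definition csmooth f : Prop := forall k, ccont_diff k f.

Lemma open_near x (P : set 'rV[R]_n) : U x -> (forall y, U y -> P y) ->
  \forall y \near x, P y.
Proof. by move=> Ux UP; apply: filterS (open_nbhs_nbhs (conj oU Ux)) => y /UP. Qed.

Lemma ccont_diff_eq k f g : (forall x, U x -> f x = g x) ->
  ccont_diff k f -> ccont_diff k g.
Proof.
have K f1 g1 : (forall x, U x -> f1 x = g1 x) -> (forall x, U x -> ccontinuous f1 x) ->
    forall x, U x -> ccontinuous g1 x.
  by move=> fg cf x Ux; exact: (ccontinuous_near (open_near Ux fg) (cf _ Ux)).
elim: k f g => [|k IH] f g fg [cf df]; first exact: (conj (K _ _ fg cf) I).
split; first exact: K cf.
move=> i; have [dfi cdf] := df i.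
have E x : U x -> cderive (e_ i) f x = cderive (e_ i) g x.
  by move=> Ux; exact: (cderive_near _ (open_near Ux fg)).
split; last exact: IH E cdf.
move=> x Ux; rewrite -E//; exact: (is_cderive_near (open_near Ux fg) (dfi _ Ux)).
Qed.

Lemma ccont_diff_cont k f : ccont_diff k f -> forall x, U x -> ccontinuous f x.
Proof. by case: k => [|k] []. Qed.

Lemma ccont_diffW k f : ccont_diff k.+1 f -> ccont_diff k f.
Proof.
elim: k f => [|k IH] f [cf df]; split=> // i.
by have [dfi /IH] := df i.
Qed.

(* Builds the next order of differentiability from a formula for the partial
   derivatives which is only asserted on the open set. *)
Lemma ccont_diffS k f (df : 'I_n -> 'rV[R]_n -> C) :
  (forall x, U x -> ccontinuous f x) ->
  (forall i x, U x -> is_cderive x (e_ i) f (df i x)) ->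
  (forall i, ccont_diff k (df i)) -> ccont_diff k.+1 f.
Proof.
move=> cf fdf cdf; split=> // i; split.
  by move=> x Ux; apply: is_cderive_self (fdf _ _ Ux).
by apply: ccont_diff_eq (cdf i) => x Ux; rewrite (cderive_val (fdf _ _ Ux)).
Qed.

Lemma ccont_diff_cst k (c : C) : ccont_diff k (fun=> c).
Proof.
elim: k c => [|k IH] c; first by split=> // x _; exact: ccontinuous_cst.
apply: (@ccont_diffS _ _ (fun _ _ => 0)) => [x _|i x _|i].
- exact: ccontinuous_cst.
- exact: is_cderive_cst.
- exact: IH.
Qed.

Lemma ccont_diffD k f g : ccont_diff k f -> ccont_diff k g ->
  ccont_diff k (fun x => f x + g x).
Proof.
elim: k f g => [|k IH] f g [cf df] [cg dg].
  by split=> // x Ux; exact: (ccontinuousD (cf _ Ux) (cg _ Ux)).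
apply: ccont_diffS => [x Ux|i x Ux|i].
- exact: (ccontinuousD (cf _ Ux) (cg _ Ux)).
- exact: (is_cderiveD ((df i).1 _ Ux) ((dg i).1 _ Ux)).
- exact: (IH _ _ (df i).2 (dg i).2).
Qed.

Lemma ccont_diffM k f g : ccont_diff k f -> ccont_diff k g ->
  ccont_diff k (fun x => f x * g x).
Proof.
elim: k f g => [|k IH] f g Cf Cg; have [cf df] := Cf; have [cg dg] := Cg.
  by split=> // x Ux; exact: (ccontinuousM (cf _ Ux) (cg _ Ux)).
apply: ccont_diffS => [x Ux|i x Ux|i].
- exact: (ccontinuousM (cf _ Ux) (cg _ Ux)).
- exact: (is_cderiveM ((df i).1 _ Ux) ((dg i).1 _ Ux)).
- exact: (ccont_diffD (IH _ _ (df i).2 (ccont_diffW Cg)) (IH _ _ (ccont_diffW Cf) (dg i).2)).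
Qed.

Lemma ccont_diffC k f : ccont_diff k f -> ccont_diff k (fun x => (f x)^*%C).
Proof.
elim: k f => [|k IH] f [cf df].
  by split=> // x Ux; exact: (ccontinuousC (cf _ Ux)).
apply: ccont_diffS => [x Ux|i x Ux|i].
- exact: (ccontinuousC (cf _ Ux)).
- exact: (is_cderiveC ((df i).1 _ Ux)).
- exact: (IH _ (df i).2).
Qed.

Lemma ccont_diffV k f : (forall x, U x -> f x != 0) -> ccont_diff k f ->
  ccont_diff k (fun x => (f x)^-1).
Proof.
move=> f0; elim: k f f0 => [|k IH] f f0 Cf; have [cf df] := Cf.
  by split=> // x Ux; exact: (ccontinuousV (f0 _ Ux) (cf _ Ux)).
apply: (@ccont_diffS _ _
    (fun i x => - 1 * cderive (e_ i) f x * ((f x)^-1 * (f x)^-1))) => [x Ux|i x Ux|i].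
- exact: (ccontinuousV (f0 _ Ux) (cf _ Ux)).
- apply: is_cderive_eq (is_cderiveV (f0 _ Ux) ((df i).1 _ Ux)) _.
  by rewrite mulN1r expr2 invfM.
- have CV := IH _ f0 (ccont_diffW Cf).
  exact: (ccont_diffM (ccont_diffM (ccont_diff_cst _ _) (df i).2) (ccont_diffM CV CV)).
Qed.

Lemma csmooth_eq f g : (forall x, U x -> f x = g x) -> csmooth f -> csmooth g.
Proof. by move=> fg sf k; exact: ccont_diff_eq (sf k). Qed.

Lemma csmooth_cst (c : C) : csmooth (fun=> c).
Proof. by move=> k; exact: ccont_diff_cst. Qed.

Lemma csmoothD f g : csmooth f -> csmooth g -> csmooth (fun x => f x + g x).
Proof. by move=> sf sg k; exact: ccont_diffD. Qed.

Lemma csmoothM f g : csmooth f -> csmooth g -> csmooth (fun x => f x * g x).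
Proof. by move=> sf sg k; exact: ccont_diffM. Qed.

Lemma csmoothN f : csmooth f -> csmooth (fun x => - f x).
Proof.
move=> sf; apply: csmooth_eq (csmoothM (csmooth_cst (- 1)) sf) => x _.
by rewrite mulN1r.
Qed.

Lemma csmoothB f g : csmooth f -> csmooth g -> csmooth (fun x => f x - g x).
Proof. by move=> sf sg; apply: csmoothD => //; exact: csmoothN. Qed.

Lemma csmoothC f : csmooth f -> csmooth (fun x => (f x)^*%C).
Proof. by move=> sf k; exact: ccont_diffC. Qed.

Lemma csmoothV f : (forall x, U x -> f x != 0) -> csmooth f ->
  csmooth (fun x => (f x)^-1).
Proof. by move=> f0 sf k; exact: ccont_diffV. Qed.

Lemma csmooth_cderive f i : csmooth f -> csmooth (cderive (e_ i) f).
Proof. by move=> sf k; have [_ /(_ i)[]] := sf k.+1. Qed.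

Lemma csmooth_is_cderive f i x : csmooth f -> U x ->
  is_cderive x (e_ i) f (cderive (e_ i) f x).
Proof. by move=> sf Ux; have [_ /(_ i)[+ _]] := sf 1; exact. Qed.

Lemma csmooth_cont f x : csmooth f -> U x -> ccontinuous f x.
Proof. by move=> sf Ux; exact: (ccont_diff_cont (sf 0)). Qed.

Lemma csmooth_comm f i j x : csmooth f -> U x ->
  cderive (e_ i) (cderive (e_ j) f) x = cderive (e_ j) (cderive (e_ i) f) x.
Proof.
move=> sf Ux.
have Hr a b : \forall y \near x,
    derivable (rpart f) y (e_ a) /\ derivable ('D_(e_ a) (rpart f)) y (e_ b).
  apply: open_near => // y Uy; rewrite -rpart_cderive.
  have [[r1 _] _] := csmooth_is_cderive a sf Uy.
  by have [[r2 _] _] := csmooth_is_cderive b (csmooth_cderive a sf) Uy.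
have Hi a b : \forall y \near x,
    derivable (ipart f) y (e_ a) /\ derivable ('D_(e_ a) (ipart f)) y (e_ b).
  apply: open_near => // y Uy; rewrite -ipart_cderive.
  have [_ [r1 _]] := csmooth_is_cderive a sf Uy.
  by have [_ [r2 _]] := csmooth_is_cderive b (csmooth_cderive a sf) Uy.
have cr a b : {for x, continuous ('D_(e_ a) ('D_(e_ b) (rpart f)))}.
  rewrite -!rpart_cderive.
  by have [] := csmooth_cont (csmooth_cderive a (csmooth_cderive b sf)) Ux.
have ci a b : {for x, continuous ('D_(e_ a) ('D_(e_ b) (ipart f)))}.
  rewrite -!ipart_cderive.
  by have [] := csmooth_cont (csmooth_cderive a (csmooth_cderive b sf)) Ux.
rewrite !cderiveE !rpart_cderive !ipart_cderive.
exact: (f_equal2 (@Complex R) (derive_comm (Hr j i) (Hr i j) (cr i j) (cr j i))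
  (derive_comm (Hi j i) (Hi i j) (ci i j) (ci j i))).
Qed.

End ComplexSmooth.

(** * The hermitian form on C^3 and moving frames *)

Section HermitianForm.
Variable R : realType.
Local Notation C := R[i].
Implicit Types (u v w z : 'rV[C]_3).

Lemma b13C u v : (b13 u v)^*%C = b13 v u.
Proof.
by rewrite /b13 !rmorphD !rmorphN !rmorphM /= !conjcK; ring.
Qed.

Lemma b13Dl u v w : b13 (u + v) w = b13 u w + b13 v w.
Proof. by have := b13Pl 1 u v w; rewrite scale1r mul1r. Qed.

Lemma b13Dr u v w : b13 w (u + v) = b13 w u + b13 w v.
Proof. by have := b13Pr 1 u v w; rewrite scale1r rmorph1 mul1r. Qed.

Lemma b13Bl u v w : b13 (u - v) w = b13 u w - b13 v w.
Proof. by rewrite b13Dl -scaleN1r b13Zl mulN1r. Qed.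

Lemma b13Br u v w : b13 w (u - v) = b13 w u - b13 w v.
Proof. by rewrite b13Dr -scaleN1r b13Zr rmorphN rmorph1 mulN1r. Qed.

(* Parseval identity for a frame z, E1, E2 whose Gram matrix is N times the one
   of a unit vector orthogonal to a hyperbolic pair. *)
Lemma b13_frame (N : C) z E1 E2 u v : N != 0 ->
  b13 z z = N -> b13 E1 E1 = 0 -> b13 E2 E2 = 0 -> b13 E1 E2 = N ->
  b13 z E1 = 0 -> b13 z E2 = 0 ->
  N * b13 u v = b13 u z * b13 z v + b13 u E1 * b13 E2 v + b13 u E2 * b13 E1 v.
Proof.
move=> N0 zz E11 E22 E12 zE1 zE2.
have [E21 E1z E2z] : [/\ b13 E2 E1 = N, b13 E1 z = 0 & b13 E2 z = 0].
  split; rewrite -b13C ?zE1 ?zE2 ?E12 ?rmorph0//.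
  by rewrite -zz b13C.
pose eta : 'M[C]_3 := \matrix_(i, j) ((i == j)%:R * (if i == 0 then -1 else 1)).
pose E (i : 'I_3) := if i == 0 then z else if i == 1 then E1 else E2.
pose M : 'M[C]_3 := \matrix_(i, j) E i 0 j.
pose A : 'M[C]_3 := \matrix_(i, j) (E j 0 i)^*%C.
pose J : 'M[C]_3 := \matrix_(i, j)
  (if i == 0 then (j == 0)%:R else if i == 1 then (j == 2)%:R else (j == 1)%:R).
have l1 : lift ord0 ord0 = 1 :> 'I_3 by apply/val_inj.
have l2 : lift ord0 (lift ord0 ord0) = 2 :> 'I_3 by apply/val_inj.
have b13E m n (X : 'M[C]_(m, 3)) (Y : 'M[C]_(3, n)) i j (x y : 'rV[C]_3) :
    (forall k, X i k = x 0 k) -> (forall k, Y k j = (y 0 k)^*%C) ->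
    (X *m eta *m Y) i j = b13 x y.
  move=> Xx Yy; rewrite !mxE !big_ord_recl big_ord0 !mxE.
  rewrite !big_ord_recl !big_ord0 !mxE /= !Xx !Yy /b13 l1 l2.
  by rewrite /=; ring.
have I3 (P : 'I_3 -> Prop) : P 0 -> P 1 -> P 2 -> forall i, P i.
  move=> P0 P1 P2 [[|[|[|//]]] i3]; [move: P0|move: P1|move: P2];
    by congr P; apply/val_inj.
have MA : M *m eta *m A = N *: J.
  apply/matrixP => i j; rewrite (b13E _ _ _ _ _ _ (E i) (E j)) => [|k|k]; rewrite ?mxE//.
  by move: i j; do 2 apply: (I3); rewrite /E/= ?(zz, E11, E22, E12, zE1, zE2, E21, E1z, E2z) ?mulr1 ?mulr0.
have JJ : J *m J = 1%:M.
  apply/matrixP => i j; rewrite !mxE !big_ord_recl big_ord0 !mxE l1 l2.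
  by move: i j; do 2 apply: (I3); rewrite /= ?(mulr0, mul0r, mulr1, addr0, add0r).
(* [M] has the frame as rows and [A] its conjugates as columns, so [M eta A = N J] with [J] an
   involution. The resulting right inverse of [M] is also a left inverse, and it is inserted in
   front of [eta] below. *)
have inv : (N^-1 *: (eta *m A *m J)) *m M = 1%:M.
  apply: mulmx1C; rewrite -scalemxAr !mulmxA MA -scalemxAl JJ scalerA mulVf// scale1r.
  by [].
pose v' : 'cV[C]_3 := \col_i (v 0 i)^*%C.
have uv : (u *m eta *m v') 0 0 = b13 u v.
  by rewrite (b13E _ _ _ _ _ _ u v) => [|k|k]//; rewrite mxE.
have uE j : (u *m eta *m A) 0 j = b13 u (E j).
  by rewrite (b13E _ _ _ _ _ _ u (E j)) => [|k|k]//; rewrite mxE.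
have Ev j : (M *m eta *m v') j 0 = b13 (E j) v.
  by rewrite (b13E _ _ _ _ _ _ (E j) v) => [|k|k]//; rewrite mxE.
have : u *m eta *m v' = N^-1 *: (u *m eta *m A *m J *m (M *m eta *m v')).
  rewrite -{1}[eta]mul1mx -inv -!(scalemxAl, scalemxAr); congr (_ *: _).
  by rewrite !mulmxA.
move=> /matrixP/(_ 0 0); rewrite uv => ->; rewrite mxE mulrA mulfV// mul1r.
rewrite mxE !big_ord_recl big_ord0 !Ev !mxE !big_ord_recl !big_ord0 !uE !mxE l1 l2.
by rewrite /E /=; ring.
Qed.

End HermitianForm.

HB.lock Definition vderive (R : realType) (n m : nat) (v : 'rV[R]_n)
    (E : 'rV[R]_n -> 'rV[R[i]]_m) (x : 'rV[R]_n) : 'rV[R[i]]_m :=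
  \row_a cderive v (fun y => E y 0 a) x.

Section VectorFields.
Variables (R : realType) (n m : nat).
Local Notation C := R[i].
Local Notation e_ := (basis_vec R).
Implicit Types (E F : 'rV[R]_n -> 'rV[C]_m) (x : 'rV[R]_n).

Lemma vderiveE v E x a : vderive v E x 0 a = cderive v (fun y => E y 0 a) x.
Proof. by rewrite unlock mxE. Qed.

Definition vsmooth (U : set 'rV[R]_n) E : Prop :=
  forall a, csmooth U (fun y => E y 0 a).

Lemma vsmoothD U E F : open U -> vsmooth U E -> vsmooth U F ->
  vsmooth U (fun x => E x + F x).
Proof.
move=> oU sE sF a; apply: csmooth_eq (csmoothD oU (sE a) (sF a)) => // x _.
by rewrite mxE.
Qed.

Lemma vsmoothZ U (f : 'rV[R]_n -> C) E : open U -> csmooth U f -> vsmooth U E ->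
  vsmooth U (fun x => f x *: E x).
Proof.
move=> oU sf sE a; apply: csmooth_eq (csmoothM oU sf (sE a)) => // x _.
by rewrite mxE.
Qed.

Lemma vsmoothB U E F : open U -> vsmooth U E -> vsmooth U F ->
  vsmooth U (fun x => E x - F x).
Proof.
move=> oU sE sF a; apply: csmooth_eq (csmoothB oU (sE a) (sF a)) => // x _.
by rewrite !mxE.
Qed.

Lemma vsmooth_vderive U i E : open U -> vsmooth U E -> vsmooth U (vderive (e_ i) E).
Proof.
move=> oU sE a; apply: csmooth_eq (csmooth_cderive i (sE a)) => // x _.
by rewrite vderiveE.
Qed.

Lemma vderiveZ U f E i x : open U -> csmooth U f -> vsmooth U E -> U x ->
  vderive (e_ i) (fun y => f y *: E y) x
  = cderive (e_ i) f x *: E x + f x *: vderive (e_ i) E x.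
Proof.
move=> oU sf sE Ux; apply/rowP => a; rewrite !mxE !vderiveE.
have H := is_cderiveM (csmooth_is_cderive i sf Ux) (csmooth_is_cderive i (sE a) Ux).
have -> : (fun y => (f y *: E y) 0 a) = fun y => f y * E y 0 a by apply/funext => y; rewrite mxE.
exact: cderive_val H.
Qed.

Lemma vderiveD U E F i x : open U -> vsmooth U E -> vsmooth U F -> U x ->
  vderive (e_ i) (fun y => E y + F y) x = vderive (e_ i) E x + vderive (e_ i) F x.
Proof.
move=> oU sE sF Ux; apply/rowP => a; rewrite !mxE !vderiveE.
have H := is_cderiveD (csmooth_is_cderive i (sE a) Ux) (csmooth_is_cderive i (sF a) Ux).
have -> : (fun y => (E y + F y) 0 a) = fun y => E y 0 a + F y 0 a by apply/funext => y; rewrite mxE.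
exact: cderive_val H.
Qed.

Lemma vderiveB U E F i x : open U -> vsmooth U E -> vsmooth U F -> U x ->
  vderive (e_ i) (fun y => E y - F y) x = vderive (e_ i) E x - vderive (e_ i) F x.
Proof.
move=> oU sE sF Ux; apply/rowP => a; rewrite !mxE !vderiveE.
have H := is_cderiveB (csmooth_is_cderive i (sE a) Ux) (csmooth_is_cderive i (sF a) Ux).
have -> : (fun y => (E y - F y) 0 a) = fun y => E y 0 a - F y 0 a by apply/funext => y; rewrite !mxE.
exact: cderive_val H.
Qed.

Lemma vderive_comm U E i j x : open U -> vsmooth U E -> U x ->
  vderive (e_ i) (vderive (e_ j) E) x = vderive (e_ j) (vderive (e_ i) E) x.
Proof.
move=> oU sE Ux; apply/rowP => a; rewrite [LHS]vderiveE [RHS]vderiveE.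
have H k : (fun y => vderive (e_ k) E y 0 a) = cderive (e_ k) (fun y => E y 0 a).
  by apply/funext => y; rewrite vderiveE.
have E1 := congr1 (fun g => cderive (e_ i) g x) (H j).
have E2 := congr1 (fun g => cderive (e_ j) g x) (H i).
exact: (etrans E1 (etrans (csmooth_comm oU i j (sE a) Ux) (esym E2))).
Qed.

End VectorFields.

Lemma is_cderive_b13_coord (R : realType) n (E F : 'rV[R]_n -> 'rV[R[i]]_3) x v
    (dE dF : 'rV[R[i]]_3) :
  (forall a, is_cderive x v (fun y => E y 0 a) (dE 0 a)) ->
  (forall a, is_cderive x v (fun y => F y 0 a) (dF 0 a)) ->
  is_cderive x v (fun y => b13 (E y) (F y)) (b13 dE (F x) + b13 (E x) dF).
Proof.
move=> EdE FdF; rewrite {1}/b13.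
have H a := is_cderiveM (EdE a) (is_cderiveC (FdF a)).
apply: is_cderive_eq (is_cderiveD (is_cderiveD (is_cderiveN (H 0)) (H 1)) (H 2)) _.
by rewrite /b13; ring.
Qed.

Section HermitianFields.
Variables (R : realType) (n : nat) (U : set 'rV[R]_n).
Hypothesis oU : open U.
Local Notation C := R[i].
Local Notation e_ := (basis_vec R).
Implicit Types (E F : 'rV[R]_n -> 'rV[C]_3) (x : 'rV[R]_n).

Lemma csmooth_b13 E F : vsmooth U E -> vsmooth U F ->
  csmooth U (fun x => b13 (E x) (F x)).
Proof.
move=> sE sF; rewrite /b13.
have H a := csmoothM oU (sE a) (csmoothC oU (sF a)).
by apply: csmoothD => //; apply: csmoothD => //; exact: csmoothN.
Qed.

Lemma is_cderive_b13 E F i x : vsmooth U E -> vsmooth U F -> U x ->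
  is_cderive x (e_ i) (fun y => b13 (E y) (F y))
    (b13 (vderive (e_ i) E x) (F x) + b13 (E x) (vderive (e_ i) F x)).
Proof.
by move=> sE sF Ux; apply: is_cderive_b13_coord => a; rewrite vderiveE;
  exact: csmooth_is_cderive.
Qed.

End HermitianFields.

(* z is an unnormalized lift of a map into CP^2_1: dividing the hermitian form by
   b13 z z gives the Fubini-Study form, theta is the connection form of the line
   bundle spanned by z, and tang lists the horizontal lifts of the coordinate
   vectors. The second fundamental form is the imaginary part of cubic. *)
HB.lock Definition herm (R : realType) (n : nat) (z : 'rV[R]_n -> 'rV[R[i]]_3)
    (x : 'rV[R]_n) (u v : 'rV[R[i]]_3) : R[i] := b13 u v / b13 (z x) (z x).

HB.lock Definition theta (R : realType) (n : nat) (z : 'rV[R]_n -> 'rV[R[i]]_3)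
    (i : 'I_n) (x : 'rV[R]_n) : R[i] :=
  herm z x (vderive (basis_vec R i) z x) (z x).

HB.lock Definition cov (R : realType) (n : nat) (z : 'rV[R]_n -> 'rV[R[i]]_3)
    (i : 'I_n) (E : 'rV[R]_n -> 'rV[R[i]]_3) (x : 'rV[R]_n) : 'rV[R[i]]_3 :=
  vderive (basis_vec R i) E x - theta z i x *: E x.

HB.lock Definition tang (R : realType) (n : nat) (z : 'rV[R]_n -> 'rV[R[i]]_3)
    (i : 'I_n) : 'rV[R]_n -> 'rV[R[i]]_3 := cov z i z.

HB.lock Definition gram (R : realType) (n : nat) (z : 'rV[R]_n -> 'rV[R[i]]_3)
    (i j : 'I_n) (x : 'rV[R]_n) : R[i] := herm z x (tang z i x) (tang z j x).

HB.lock Definition cubic (R : realType) (n : nat) (z : 'rV[R]_n -> 'rV[R[i]]_3)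
    (i j l : 'I_n) (x : 'rV[R]_n) : R[i] :=
  herm z x (cov z i (tang z j) x) (tang z l x).

(** * The hermitian connection along an unnormalized lift *)

Section HorizontalConnection.
Variables (R : realType) (n : nat) (U : set 'rV[R]_n).
Hypothesis oU : open U.
Local Notation C := R[i].
Local Notation e_ := (basis_vec R).
Variable z : 'rV[R]_n -> 'rV[C]_3.
Hypothesis sz : vsmooth U z.
Hypothesis z0 : forall x, U x -> b13 (z x) (z x) != 0.
Local Notation herm := (herm z).
Local Notation theta := (theta z).
Local Notation cov := (cov z).
Local Notation tang := (tang z).
Local Notation gram := (gram z).
Local Notation cubic := (cubic z).
Implicit Types (E F : 'rV[R]_n -> 'rV[C]_3) (x : 'rV[R]_n) (i j l : 'I_n).

Lemma hermE x u v : herm x u v = b13 u v / b13 (z x) (z x).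
Proof. by rewrite unlock. Qed.

Lemma thetaE i x : theta i x = herm x (vderive (e_ i) z x) (z x).
Proof. by rewrite unlock. Qed.

Lemma covE i E x : cov i E x = vderive (e_ i) E x - theta i x *: E x.
Proof. by rewrite unlock. Qed.

Lemma gramE i j x : gram i j x = herm x (tang i x) (tang j x).
Proof. by rewrite unlock. Qed.

Lemma cubicE i j l x : cubic i j l x = herm x (cov i (tang j) x) (tang l x).
Proof. by rewrite unlock. Qed.

Lemma tangE i : tang i = cov i z.
Proof. by rewrite unlock. Qed.

Lemma conj_z x : (b13 (z x) (z x))^*%C = b13 (z x) (z x).
Proof. exact: b13C. Qed.

Lemma hermC x u v : (herm x u v)^*%C = herm x v u.
Proof. by rewrite !hermE rmorphM fmorphV/= conj_z b13C. Qed.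

Lemma hermDl x u v w : herm x (u + v) w = herm x u w + herm x v w.
Proof. by rewrite !hermE b13Dl mulrDl. Qed.

Lemma hermDr x u v w : herm x w (u + v) = herm x w u + herm x w v.
Proof. by rewrite !hermE b13Dr mulrDl. Qed.

Lemma hermZl x a u v : herm x (a *: u) v = a * herm x u v.
Proof. by rewrite !hermE b13Zl mulrA. Qed.

Lemma hermZr x a u v : herm x u (a *: v) = a^*%C * herm x u v.
Proof. by rewrite !hermE b13Zr mulrA. Qed.

Lemma hermBl x u v w : herm x (u - v) w = herm x u w - herm x v w.
Proof. by rewrite !hermE b13Bl mulrBl. Qed.

Lemma hermBr x u v w : herm x w (u - v) = herm x w u - herm x w v.
Proof. by rewrite !hermE b13Br mulrBl. Qed.

Lemma herm_zz x : U x -> herm x (z x) (z x) = 1.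
Proof. by move=> Ux; rewrite !hermE divff// z0. Qed.

Lemma herm_tang_z i x : U x -> herm x (tang i x) (z x) = 0.
Proof. by move=> Ux; rewrite tangE covE hermBl hermZl herm_zz// mulr1 -thetaE subrr. Qed.

Lemma herm_z_tang i x : U x -> herm x (z x) (tang i x) = 0.
Proof. by move=> Ux; rewrite -hermC herm_tang_z// rmorph0. Qed.

Lemma csmooth_herm E F : vsmooth U E -> vsmooth U F ->
  csmooth U (fun x => herm x (E x) (F x)).
Proof.
move=> sE sF.
have -> : (fun x => herm x (E x) (F x)) = fun x => b13 (E x) (F x) / b13 (z x) (z x).
  by apply/funext => x; rewrite hermE.
apply: csmoothM => //; first exact: csmooth_b13.
by apply: csmoothV => //; exact: csmooth_b13.
Qed.

Lemma csmooth_theta i : csmooth U (theta i).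
Proof.
rewrite (_ : theta i = fun x => herm x (vderive (e_ i) z x) (z x)); last first.
  by apply/funext => x; rewrite thetaE.
by apply: csmooth_herm => //; exact: vsmooth_vderive.
Qed.

Lemma vsmooth_cov i E : vsmooth U E -> vsmooth U (cov i E).
Proof.
move=> sE.
rewrite (_ : cov i E = fun x => vderive (e_ i) E x - theta i x *: E x); last first.
  by apply/funext => x; rewrite covE.
apply: vsmoothB => //; first exact: vsmooth_vderive.
by apply: vsmoothZ => //; exact: csmooth_theta.
Qed.

Lemma vsmooth_tang i : vsmooth U (tang i).
Proof. by rewrite tangE; exact: vsmooth_cov. Qed.

(** The connection is hermitian: the derivative of the factor 1 / [b13 (z x) (z x)] contributes
    minus the sum of [theta] and its conjugate, which is what the two covariant derivatives
    subtract. *)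
Lemma is_cderive_herm E F i x : vsmooth U E -> vsmooth U F -> U x ->
  is_cderive x (e_ i) (fun y => herm y (E y) (F y))
    (herm x (cov i E x) (F x) + herm x (E x) (cov i F x)).
Proof.
move=> sE sF Ux.
have -> : (fun y => herm y (E y) (F y)) = fun y => b13 (E y) (F y) / b13 (z y) (z y).
  by apply/funext => y; rewrite hermE.
have := is_cderiveM (is_cderive_b13 i sE sF Ux)
  (is_cderiveV (z0 Ux) (is_cderive_b13 i sz sz Ux)).
move=> H; apply: is_cderive_eq H _.
have Et : herm x (z x) (vderive (e_ i) z x) = (theta i x)^*%C.
  by rewrite thetaE hermC.
have Et' : herm x (vderive (e_ i) z x) (z x) = theta i x .
  by rewrite thetaE.
rewrite !covE; move: (z0 Ux) Et Et'; rewrite !hermE.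
move: (b13 (z x) (z x)) (theta i x) => N t N0 Et Et'.
rewrite b13Bl b13Br b13Zl b13Zr -Et -Et'.
by field.
Qed.

Lemma covZ f E i x : csmooth U f -> vsmooth U E -> U x ->
  cov i (fun y => f y *: E y) x = cderive (e_ i) f x *: E x + f x *: cov i E x.
Proof.
move=> sf sE Ux; rewrite !covE (vderiveZ i oU)// scalerBr !scalerA [theta _ _ * _]mulrC.
by rewrite addrA.
Qed.

Lemma covD E F i x : vsmooth U E -> vsmooth U F -> U x ->
  cov i (fun y => E y + F y) x = cov i E x + cov i F x.
Proof.
by move=> sE sF Ux; rewrite !covE (vderiveD i oU)// scalerDr opprD addrACA.
Qed.

(** The second derivatives of [z] cancel, and what remains is the curvature of the line bundle: it
    is -2 i times the imaginary part of [gram i j], a multiple of the pulled-back Kaehler form. *)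
Lemma cderive_theta i j x : U x ->
  cderive (e_ i) (theta j) x - cderive (e_ j) (theta i) x
  = gram j i x - gram i j x.
Proof.
move=> Ux.
have sd k : vsmooth U (vderive (e_ k) z) by exact: vsmooth_vderive.
have H a b := cderive_val (is_cderive_herm a (sd b) sz Ux).
have T k : theta k = fun y => herm y (vderive (e_ k) z y) (z y).
  by apply/funext => y; rewrite thetaE.
rewrite {1}(T i) {1}(T j) (H i j) (H j i) !gramE !tangE !covE (vderive_comm i j oU)//.
have Ei : herm x (z x) (vderive (e_ i) z x) = (theta i x)^*%C.
  by rewrite thetaE hermC.
have Ej : herm x (z x) (vderive (e_ j) z x) = (theta j x)^*%C.
  by rewrite thetaE hermC.
have Ei' : herm x (vderive (e_ i) z x) (z x) = theta i x .
  by rewrite thetaE.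
have Ej' : herm x (vderive (e_ j) z x) (z x) = theta j x .
  by rewrite thetaE.
move: (vderive (e_ j) (vderive (e_ i) z) x) (herm_zz Ux) Ei Ej Ei' Ej'.
move: (vderive (e_ j) z x) (vderive (e_ i) z x) (theta i x) (theta j x) (z x).
move=> b a ti tj w c ww Ei Ej Ei' Ej'.
rewrite !(hermBl, hermBr, hermZl, hermZr) Ei Ej Ei' Ej' ww.
by ring.
Qed.

(* The line bundle spanned by z is flat along a Lagrangian surface, hence covariant
   derivatives commute. *)
Lemma cov_comm E i j x : vsmooth U E -> U x -> gram i j x = gram j i x ->
  cov i (cov j E) x = cov j (cov i E) x.
Proof.
move=> sE Ux gij.
have g0 : gram j i x - gram i j x = 0 by rewrite gij; exact: subrr.
have dth := subr0_eq (etrans (cderive_theta i j Ux) g0).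
have H a b : cov a (cov b E) x = vderive (e_ a) (vderive (e_ b) E) x
    - (cderive (e_ a) (theta b) x *: E x + theta b x *: vderive (e_ a) E x)
    - theta a x *: (vderive (e_ b) E x - theta b x *: E x).
  have se : vsmooth U (vderive (e_ b) E) by exact: vsmooth_vderive.
  have st := vsmoothZ oU (csmooth_theta b) sE.
  have -> : cov b E = fun x => vderive (e_ b) E x - theta b x *: E x.
    by apply/funext => y; rewrite covE.
  by rewrite covE (vderiveB a oU se st Ux) (vderiveZ a oU (csmooth_theta b) sE Ux).
rewrite (H i j) (H j i) (vderive_comm i j oU sE Ux) dth.
move: (vderive _ (vderive _ E) x) (vderive (e_ i) E x) (vderive (e_ j) E x).
move: (cderive _ _ x) (theta i x) (theta j x) (E x) => d ti tj e eij ei ej.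
by apply/rowP => a; rewrite !mxE; ring.
Qed.

End HorizontalConnection.

(** * The moving frame of a null coframe *)

Section NullFrame.
Variables (R : realType) (U : set 'rV[R]_2).
Hypothesis oU : open U.
Local Notation C := R[i].
Local Notation e_ := (basis_vec R).
Variable z : 'rV[R]_2 -> 'rV[C]_3.
Hypothesis sz : vsmooth U z.
Hypothesis z0 : forall x, U x -> b13 (z x) (z x) != 0.
Local Notation h := (herm z).
Local Notation D := (cov z).
Local Notation Z := (tang z).
Implicit Types (E F : 'rV[R]_2 -> 'rV[C]_3) (x : 'rV[R]_2) (i j l : 'I_2).

Hypothesis gram_sym : forall x, U x -> forall i j, gram z i j x = gram z j i x.

Lemma gram_real x i j : U x -> (gram z i j x)^*%C = gram z i j x.
Proof. by move=> Ux; rewrite [in LHS]gramE hermC -gramE (gram_sym Ux j i). Qed.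

(** After the Leibniz rule the two second covariant derivatives of [E] cancel by [cov_comm], so only
    products of first derivatives survive. *)
Lemma structure_equation E F i j x : vsmooth U E -> vsmooth U F -> U x ->
  cderive (e_ i) (fun y => h y (D j E y) (F y)) x
  - cderive (e_ j) (fun y => h y (D i E y) (F y)) x
  = h x (D j E x) (D i F x) - h x (D i E x) (D j F x).
Proof.
move=> sE sF Ux; have sD k : vsmooth U (D k E) by exact: vsmooth_cov.
have H a b := cderive_val (is_cderive_herm sz z0 a (sD b) sF Ux).
rewrite (H i j) (H j i) (cov_comm oU sz z0 sE Ux (gram_sym Ux i j)).
by rewrite opprD addrACA subrr add0r.
Qed.

(** Since [tang j] is the covariant derivative of [z], this is the commutation of covariant
    derivatives applied to [z] itself: the connection has no torsion. *)
Lemma cubicC12 x i j l : U x -> cubic z i j l x = cubic z j i l x.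
Proof. by move=> Ux; rewrite !cubicE !tangE (cov_comm oU sz z0 sz Ux (gram_sym Ux i j)). Qed.

Definition comb (a b : 'rV[R]_2 -> C) x : 'rV[C]_3 := a x *: Z 0 x + b x *: Z 1 x.

Lemma vsmooth_comb a b : csmooth U a -> csmooth U b -> vsmooth U (comb a b).
Proof.
by move=> sa sb; apply: vsmoothD => //; apply: vsmoothZ => //; exact: vsmooth_tang.
Qed.

Lemma herm_comb_r a b x u : (a x)^*%C = a x -> (b x)^*%C = b x ->
  h x u (comb a b x) = a x * h x u (Z 0 x) + b x * h x u (Z 1 x).
Proof.
rewrite /comb; move: (Z 0 x) (Z 1 x) => u0 u1 ra rb.
by rewrite hermDr !hermZr ra rb.
Qed.

Lemma herm_comb_l a b x u :
  h x (comb a b x) u = a x * h x (Z 0 x) u + b x * h x (Z 1 x) u.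
Proof.
by rewrite /comb; move: (Z 0 x) (Z 1 x) => u0 u1; rewrite hermDl !hermZl.
Qed.

Lemma cov_comb a b i x : csmooth U a -> csmooth U b -> U x ->
  D i (comb a b) x = cderive (e_ i) a x *: Z 0 x + a x *: D i (Z 0) x
                   + (cderive (e_ i) b x *: Z 1 x + b x *: D i (Z 1) x).
Proof.
move=> sa sb Ux.
have sZ k := vsmooth_tang oU sz z0 k.
have H0 := covZ oU z i sa (sZ 0) Ux; have H1 := covZ oU z i sb (sZ 1) Ux.
apply: (etrans _ (f_equal2 +%R H0 H1)).
exact: (covD oU z i (vsmoothZ oU sa (sZ 0)) (vsmoothZ oU sb (sZ 1)) Ux).
Qed.

Lemma cderive_real (a : 'rV[R]_2 -> C) i x : csmooth U a -> U x ->
  (forall y, U y -> (a y)^*%C = a y) -> (cderive (e_ i) a x)^*%C = cderive (e_ i) a x.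
Proof.
move=> sa Ux ra.
rewrite -(cderive_val (is_cderiveC (csmooth_is_cderive i sa Ux))).
exact: (cderive_near _ (open_near oU Ux ra)).
Qed.

(* The derivatives of the real coefficients do not contribute to the
   skew-hermitian part, which is therefore tensorial. *)
Lemma skew_cov_comb a b c d i x : csmooth U a -> csmooth U b ->
  csmooth U c -> csmooth U d ->
  (forall y, U y -> [/\ (a y)^*%C = a y, (b y)^*%C = b y, (c y)^*%C = c y & (d y)^*%C = d y]) ->
  U x ->
  let P := h x (D i (comb a b) x) (comb c d x) in
  let K j l := cubic z i j l x - (cubic z i j l x)^*%C in
  P - P^*%C = a x * c x * K 0 0 + a x * d x * K 0 1
            + b x * c x * K 1 0 + b x * d x * K 1 1.
Proof.
move=> sa sb sc sd rl Ux P K; rewrite /P /K !cubicE.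
have [ra rb rc rd] := rl _ Ux.
have ra' := cderive_real i sa Ux (fun y Uy => let: And4 r _ _ _ := rl y Uy in r).
have rb' := cderive_real i sb Ux (fun y Uy => let: And4 _ r _ _ := rl y Uy in r).
have G00 := gram_real 0 0 Ux; have G01 := gram_real 0 1 Ux.
have G10 := gram_real 1 0 Ux; have G11 := gram_real 1 1 Ux.
rewrite !gramE in G00 G01 G10 G11.
rewrite (herm_comb_r _ rc rd) (cov_comb i sa sb Ux).
move: (Z 0 x) (Z 1 x) (D i (Z 0) x) (D i (Z 1) x) G00 G01 G10 G11.
move: (cderive (e_ i) a x) (cderive (e_ i) b x) ra' rb' (a x) (b x) (c x) (d x) ra rb rc rd.
move=> a' b' ra' rb' a1 b1 c1 d1 ra rb rc rd u0 u1 v0 v1 r1 r2 r3 r4.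
rewrite !hermDl !hermZl.
move: (h x u0 u0) (h x u0 u1) (h x u1 u0) (h x u1 u1) r1 r2 r3 r4.
move: (h x v0 u0) (h x v0 u1) (h x v1 u0) (h x v1 u1).
move=> k1 k2 k3 k4 g1 g2 g3 g4 r1 r2 r3 r4.
rewrite !(rmorphD, rmorphM)/= ra' rb' ra rb rc rd r1 r2 r3 r4.
by ring.
Qed.

(* The moving frame z, E1, E2 with E1, E2 dual to the real null coframe q, p:
   Cartan's structure equations force the connection form of E1 to vanish, hence
   the surface to be flat, whereas they also give it curvature 1. *)
Lemma no_null_coframe (p q : 'I_2 -> 'rV[R]_2 -> C) (lam : 'rV[R]_2 -> C) x0 :
  (forall i, csmooth U (p i)) -> (forall i, csmooth U (q i)) ->
  (forall x i, U x -> (p i x)^*%C = p i x) ->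
  (forall x i, U x -> (q i x)^*%C = q i x) ->
  (forall x, U x -> (lam x)^*%C = lam x) ->
  (forall x, U x -> q 0 x * p 1 x - q 1 x * p 0 x != 0) ->
  (forall x i j, U x -> gram z i j x = p i x * q j x + q i x * p j x) ->
  (forall x i j l, U x -> cubic z i j l x - (cubic z i j l x)^*%C =
     'i%C * (lam x * q i x * q j x * q l x + q i x * p j x * p l x
          + p i x * q j x * p l x + p i x * p j x * q l x)) ->
  ~ U x0.
Proof.
move=> sp sq rp rq rl d0 Hg HC Ux0.
pose d x := q 0 x * p 1 x - q 1 x * p 0 x.
have sd : csmooth U d by apply: csmoothB => //; exact: csmoothM.
have sdV : csmooth U (fun x => (d x)^-1) by exact: csmoothV.
have rd x : U x -> (d x)^*%C = d x.
  by move=> Ux; rewrite /d !(rmorphB, rmorphM)/= !rp// !rq.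
(* Cramer's rule for q(E1) = p(E2) = 1 and p(E1) = q(E2) = 0. *)
pose t0 x := p 1 x * (d x)^-1; pose t1 x := - p 0 x * (d x)^-1.
pose s0 x := - q 1 x * (d x)^-1; pose s1 x := q 0 x * (d x)^-1.
have st0 : csmooth U t0 by exact: csmoothM.
have st1 : csmooth U t1 by apply: csmoothM => //; exact: csmoothN.
have ss0 : csmooth U s0 by apply: csmoothM => //; exact: csmoothN.
have ss1 : csmooth U s1 by exact: csmoothM.
have rts x : U x -> [/\ (t0 x)^*%C = t0 x, (t1 x)^*%C = t1 x,
    (s0 x)^*%C = s0 x & (s1 x)^*%C = s1 x].
  by move=> Ux; split; rewrite rmorphM fmorphV ?rmorphN/= rd// ?rp// rq.
pose E1 := comb t0 t1; pose E2 := comb s0 s1.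
have sE1 : vsmooth U E1 by exact: vsmooth_comb.
have sE2 : vsmooth U E2 by exact: vsmooth_comb.
(* The metric is p q + q p, so pairing with the vector dual to q returns p, and conversely. *)
have ZE1 x i : U x -> h x (Z i x) (E1 x) = p i x.
  move=> Ux; have [r1 r2 _ _] := rts x Ux.
  rewrite (herm_comb_r _ r1 r2) -!gramE !Hg// /t0 /t1.
  by move: (d0 x Ux); rewrite /d => dx; field.
have ZE2 x i : U x -> h x (Z i x) (E2 x) = q i x.
  move=> Ux; have [_ _ r1 r2] := rts x Ux.
  rewrite (herm_comb_r _ r1 r2) -!gramE !Hg// /s0 /s1.
  by move: (d0 x Ux); rewrite /d => dx; field.
have E11 x : U x -> h x (E1 x) (E1 x) = 0.
  by move=> Ux; rewrite herm_comb_l !ZE1// /t0 /t1; ring.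
have E12 x : U x -> h x (E1 x) (E2 x) = 1.
  move=> Ux; rewrite herm_comb_l !ZE2// /t0 /t1.
  by move: (d0 x Ux); rewrite /d => dx; field.
have E22 x : U x -> h x (E2 x) (E2 x) = 0.
  by move=> Ux; rewrite herm_comb_l !ZE2// /s0 /s1; ring.
have zE1 x : U x -> h x (z x) (E1 x) = 0.
  move=> Ux; have [r1 r2 _ _] := rts x Ux.
  by rewrite (herm_comb_r _ r1 r2) !(herm_z_tang z0)// !mulr0 addr0.
have zE2 x : U x -> h x (z x) (E2 x) = 0.
  move=> Ux; have [_ _ r1 r2] := rts x Ux.
  by rewrite (herm_comb_r _ r1 r2) !(herm_z_tang z0)// !mulr0 addr0.
have parseval x u v : U x -> h x u v = h x u (z x) * h x (z x) v
    + h x u (E1 x) * h x (E2 x) v + h x u (E2 x) * h x (E1 x) v.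
  move=> Ux; have N0 := z0 Ux.
  have := zE2 x Ux; have := zE1 x Ux; have := E22 x Ux; have := E12 x Ux; have := E11 x Ux.
  rewrite !hermE => /(canRL (divfK N0)) e11 /(canRL (divfK N0)) e12
    /(canRL (divfK N0)) e22 /(canRL (divfK N0)) ze1 /(canRL (divfK N0)) ze2.
  rewrite mul0r in e11; rewrite mul1r in e12; rewrite mul0r in e22.
  rewrite mul0r in ze1; rewrite mul0r in ze2.
  have F := b13_frame u v N0 erefl e11 e22 e12 ze1 ze2.
  have -> : b13 u v = (b13 u (z x) * b13 (z x) v + b13 u (E1 x) * b13 (E2 x) v
     + b13 u (E2 x) * b13 (E1 x) v) / b13 (z x) (z x).
    by rewrite -F mulrC mulKf.
  by field.
have const_herm E F c i x : vsmooth U E -> vsmooth U F ->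
    (forall y, U y -> h y (E y) (F y) = c) -> U x ->
    h x (D i E x) (F x) + h x (E x) (D i F x) = 0.
  move=> sE sF EF Ux.
  rewrite -(cderive_val (is_cderive_herm sz z0 i sE sF Ux)).
  rewrite (cderive_near _ (open_near oU Ux EF)).
  exact: cderive_val (is_cderive_cst _ _ _).
(* The real part of [W] is the Levi-Civita connection form of the surface in the null frame; by
   [skew12] its imaginary part is p / 2. *)
pose W i x := h x (D i E1 x) (E2 x).
have skew11 i x : U x ->
    h x (D i E1 x) (E1 x) - (h x (D i E1 x) (E1 x))^*%C = 'i%C * lam x * q i x.
  move=> Ux.
  rewrite (skew_cov_comb i st0 st1 st0 st1 _ Ux); last first.
    by move=> y /rts[].
  by rewrite !HC// /t0 /t1; move: (d0 x Ux); rewrite /d => dx; field.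
have skew12 i x : U x -> W i x - (W i x)^*%C = 'i%C * p i x.
  move=> Ux.
  rewrite (skew_cov_comb i st0 st1 ss0 ss1 _ Ux); last first.
    by move=> y /rts[].
  by rewrite !HC// /t0 /t1 /s0 /s1; move: (d0 x Ux); rewrite /d => dx; field.
have skew22 i x : U x ->
    h x (D i E2 x) (E2 x) - (h x (D i E2 x) (E2 x))^*%C = 'i%C * q i x.
  move=> Ux.
  rewrite (skew_cov_comb i ss0 ss1 ss0 ss1 _ Ux); last first.
    by move=> y /rts[].
  by rewrite !HC// /s0 /s1; move: (d0 x Ux); rewrite /d => dx; field.
have half (a b : C) : a - a^*%C = b -> a + a^*%C = 0 -> a = b / 2.
  move=> <- /eqP; rewrite addr_eq0 => /eqP E.
  have -> : a^*%C = - a by rewrite {2}E opprK.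
  by field.
have C11 i x : U x -> h x (D i E1 x) (E1 x) = 'i%C / 2 * (lam x * q i x).
  move=> Ux; rewrite (half _ _ (skew11 i x Ux)); first by field.
  by rewrite hermC; exact: const_herm E11 Ux.
have C22 i x : U x -> h x (D i E2 x) (E2 x) = 'i%C / 2 * q i x.
  move=> Ux; rewrite (half _ _ (skew22 i x Ux)); first by field.
  by rewrite hermC; exact: const_herm E22 Ux.
have C1D2 i x : U x -> h x (E1 x) (D i E2 x) = - W i x.
  move=> Ux; apply/eqP; rewrite -addr_eq0 addrC; apply/eqP.
  exact: const_herm E12 Ux.
have C10 i x : U x -> h x (D i E1 x) (z x) = - p i x.
  move=> Ux; apply/eqP; rewrite -addr_eq0 -(rp x i Ux) -(ZE1 x i Ux) hermC tangE.
  apply/eqP; apply: const_herm Ux => // y Uy.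
  by rewrite -hermC zE1// rmorph0.
have C20 i x : U x -> h x (D i E2 x) (z x) = - q i x.
  move=> Ux; apply/eqP; rewrite -addr_eq0 -(rq x i Ux) -(ZE2 x i Ux) hermC tangE.
  apply/eqP; apply: const_herm Ux => // y Uy.
  by rewrite -hermC zE2// rmorph0.
have ii : 'i%C * 'i%C = -1 :> C by rewrite -expr2 sqr_i.
have ci : ('i%C)^*%C = - 'i%C :> C.
  by apply/eqP; rewrite eq_complex /= oppr0 !eqxx.
have conjM (a b : C) : (a * b)^*%C = a^*%C * b^*%C by rewrite rmorphM.
have conjN (a : C) : (- a)^*%C = - a^*%C by rewrite rmorphN.
have conjB (a b : C) : (a - b)^*%C = a^*%C - b^*%C by rewrite rmorphB.
have cih : ('i%C / 2 : C)^*%C = - ('i%C / 2).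
  by rewrite conjM ci -[2^-1 : C]/((2%:R)^-1) conjc_inv conjc_nat mulNr.
have loc f g k x : U x -> (forall y, U y -> f y = g y) ->
    cderive (e_ k) f x = cderive (e_ k) g x.
  by move=> Ux fg; exact: (cderive_near _ (open_near oU Ux fg)).
have K1 k x : U x -> h x (D k z x) (E1 x) = p k x by rewrite -tangE; exact: ZE1.
have K2 k x : U x -> h x (D k z x) (E2 x) = q k x by rewrite -tangE; exact: ZE2.
have cW k x : U x -> (W k x)^*%C = W k x - 'i%C * p k x.
  by move=> Ux; rewrite -skew12//; ring.
have K2D1 k x : U x -> h x (E2 x) (D k E1 x) = W k x - 'i%C * p k x.
  by move=> Ux; rewrite -hermC -/(W k x) cW.
have K1D1 k x : U x -> h x (E1 x) (D k E1 x) = - ('i%C / 2) * (lam x * q k x).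
  move=> Ux; by rewrite -hermC C11// conjM cih conjM rl// rq.
have K2D2 k x : U x -> h x (E2 x) (D k E2 x) = - ('i%C / 2) * q k x.
  move=> Ux; by rewrite -hermC C22// conjM cih rq.
have D2K1 k x : U x -> h x (D k E2 x) (E1 x) = - W k x + 'i%C * p k x.
  by move=> Ux; rewrite -hermC C1D2// conjN cW//; ring.
have zD1 k x : U x -> h x (z x) (D k E1 x) = - p k x.
  by move=> Ux; rewrite -hermC C10// conjN rp.
have zD2 k x : U x -> h x (z x) (D k E2 x) = - q k x.
  by move=> Ux; rewrite -hermC C20// conjN rq.
have Dz0 k x : U x -> h x (D k z x) (z x) = 0.
  by move=> Ux; rewrite -tangE; exact: (herm_tang_z z0 k Ux).
have Dq x : U x -> cderive (e_ 0) (q 1) x - cderive (e_ 1) (q 0) x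
    = q 0 x * W 1 x - q 1 x * W 0 x - 'i%C / 2 * (p 1 x * q 0 x - p 0 x * q 1 x).
  move=> Ux; have := structure_equation 0 1 sz sE2 Ux.
  rewrite (loc _ (q 1) 0 x Ux (K2 1)) (loc _ (q 0) 1 x Ux (K2 0)) => ->.
  rewrite (parseval x (D 1 z x) (D 0 E2 x) Ux) (parseval x (D 0 z x) (D 1 E2 x) Ux).
  rewrite !Dz0// !K1// !K2// !K2D2// !C1D2//.
  by field.
(* The [lam] terms of the Parseval expansion are multiples of q_0 q_1 on both sides of the
   difference and cancel; the same happens in [D12]. *)
have Dp x : U x -> cderive (e_ 0) (p 1) x - cderive (e_ 1) (p 0) x
    = p 1 x * W 0 x - p 0 x * W 1 x.
  move=> Ux; have := structure_equation 0 1 sz sE1 Ux.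
  rewrite (loc _ (p 1) 0 x Ux (K1 1)) (loc _ (p 0) 1 x Ux (K1 0)) => ->.
  rewrite (parseval x (D 1 z x) (D 0 E1 x) Ux) (parseval x (D 0 z x) (D 1 E1 x) Ux).
  rewrite !Dz0// !K1// !K2// !K2D1// !K1D1//.
  by field.
have D22 x : U x -> 'i%C / 2 * (cderive (e_ 0) (q 1) x - cderive (e_ 1) (q 0) x)
    = 'i%C * (W 1 x * q 0 x - W 0 x * q 1 x) + (p 1 x * q 0 x - p 0 x * q 1 x) / 2.
  move=> Ux; have := structure_equation 0 1 sE2 sE2 Ux.
  have E k l : cderive (e_ k) (fun y => h y (D l E2 y) (E2 y)) x
      = 'i%C / 2 * cderive (e_ k) (q l) x.
    rewrite (loc _ (fun y => 'i%C / 2 * q l y) k x Ux (C22 l)).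
    rewrite (cderive_val (is_cderiveM (is_cderive_cst x (e_ k) ('i%C / 2))
      (csmooth_is_cderive k (sq l) Ux))).
    by rewrite mul0r add0r.
  rewrite !E -mulrBr => ->.
  rewrite (parseval x (D 1 E2 x) (D 0 E2 x) Ux) (parseval x (D 0 E2 x) (D 1 E2 x) Ux).
  rewrite !C20// !zD2// !D2K1// !C22// !K2D2// !C1D2//.
  have <- : - ('i%C * 'i%C) * ((p 1 x * q 0 x - p 0 x * q 1 x) / 2) =
     (p 1 x * q 0 x - p 0 x * q 1 x) / 2 by rewrite ii opprK mul1r.
  by field.
(* Gauss equation: the products W_0 W_1 cancel as well, and only the components along [z], which
   carry the curvature of the ambient space, survive. *)
have D12 x : U x -> cderive (e_ 0) (W 1) x - cderive (e_ 1) (W 0) x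
    = p 1 x * q 0 x - p 0 x * q 1 x.
  move=> Ux; rewrite (structure_equation 0 1 sE1 sE2 Ux).
  rewrite (parseval x (D 1 E1 x) (D 0 E2 x) Ux) (parseval x (D 0 E1 x) (D 1 E2 x) Ux).
  rewrite !C10// !zD2// !C11// !K2D2// !C1D2// /W.
  by field.
have sW k : csmooth U (W k).
  by apply: csmooth_herm => //; exact: vsmooth_cov.
(* The right side of [D12] is real, while the conjugate of W is W - i p. Conjugating [D12] therefore
   gives dp = 0, and [Dp] turns this into a relation between p and W. *)
have Dp0 x : U x -> p 1 x * W 0 x - p 0 x * W 1 x = 0.
  move=> Ux; rewrite -Dp//.
  have E k l : (cderive (e_ k) (W l) x)^*%C
      = cderive (e_ k) (W l) x - 'i%C * cderive (e_ k) (p l) x.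
    rewrite -(cderive_val (is_cderiveC (csmooth_is_cderive k (sW l) Ux))).
    rewrite (loc _ (fun y => W l y - 'i%C * p l y) k x Ux (cW l)).
    rewrite (cderive_val (is_cderiveB (csmooth_is_cderive k (sW l) Ux)
      (is_cderiveM (is_cderive_cst x (e_ k) 'i%C)
      (csmooth_is_cderive k (sp l) Ux)))).
    by rewrite mul0r add0r.
  have := congr1 (fun a : C => a^*%C) (D12 x Ux).
  rewrite !(conjB, conjM) !E !rp// !rq// -D12// => H.
  have i0 : 'i%C != 0 :> C by apply/eqP => i0; move: ii; rewrite i0 mul0r => /eqP; rewrite eq_sym oppr_eq0 oner_eq0.
  apply: (mulfI i0); rewrite mulr0 -[RHS](subrr (cderive (e_ 0) (W 1) x - cderive (e_ 1) (W 0) x)).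
  by rewrite -{2}H; ring.
(* Eliminating dq between [Dq] and [D22] shows that W - (i / 2) p has zero wedge with q; by [Dp0] it
   also has zero wedge with p, and p, q are independent. *)
have WE k x : U x -> W k x = 'i%C / 2 * p k x.
  move=> Ux; have H1 := Dp0 x Ux; have H2 := D22 x Ux; rewrite Dq// in H2.
  have HQ : q 0 x * W 1 x - q 1 x * W 0 x
      = 'i%C / 2 * (p 1 x * q 0 x - p 0 x * q 1 x).
    move/eqP: H2; rewrite -subr_eq0 => /eqP H2.
    pose Q := q 0 x * W 1 x - q 1 x * W 0 x; pose P := p 1 x * q 0 x - p 0 x * q 1 x.
    have H3 : - ('i%C / 2) * Q - ('i%C * 'i%C) / 4 * P - P / 2 = 0.
      rewrite -[RHS]H2 /Q /P; move: (W 0 x) (W 1 x) ('i%C : C) => w0 w1 i.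
      by field.
    (* [field] treats the imaginary unit as an indeterminate, so the identity displays the factor i
       i + 1, which vanishes afterwards. *)
    have HQ : Q - 'i%C / 2 * P = ('i%C * 'i%C + 1) * (Q + P * 'i%C / 2)
        + 2 * 'i%C * (- ('i%C / 2) * Q - ('i%C * 'i%C) / 4 * P - P / 2).
      by field.
    by apply/eqP; rewrite -subr_eq0 -/Q -/P HQ H3 ii addNr mul0r mulr0 addr0.
  have dV : d x * (W k x - 'i%C / 2 * p k x) = 0.
    have [->|->] : k = 0 \/ k = 1.
      by move: k => [[|[|//]] ?]; [left|right]; exact/val_inj.
    - rewrite (_ : _ * _ = q 0 x * (p 1 x * W 0 x - p 0 x * W 1 x)
        + p 0 x * (q 0 x * W 1 x - q 1 x * W 0 x
          - 'i%C / 2 * (p 1 x * q 0 x - p 0 x * q 1 x))); last by rewrite /d; field.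
      by rewrite H1 HQ subrr !mulr0 addr0.
    - rewrite (_ : _ * _ = q 1 x * (p 1 x * W 0 x - p 0 x * W 1 x)
        + p 1 x * (q 0 x * W 1 x - q 1 x * W 0 x
          - 'i%C / 2 * (p 1 x * q 0 x - p 0 x * q 1 x))); last by rewrite /d; field.
      by rewrite H1 HQ subrr !mulr0 addr0.
  by move/eqP: dV; rewrite mulf_eq0 (negPf (d0 x Ux)) /= subr_eq0 => /eqP.
(* Now dW = (i / 2) dp = 0, whereas [D12] makes it a nonzero determinant. *)
have := D12 x0 Ux0.
have E k l : cderive (e_ k) (W l) x0 = 'i%C / 2 * cderive (e_ k) (p l) x0.
  rewrite (loc _ (fun y => 'i%C / 2 * p l y) k x0 Ux0 (WE l)).
  rewrite (cderive_val (is_cderiveM (is_cderive_cst x0 (e_ k) ('i%C / 2))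
      (csmooth_is_cderive k (sp l) Ux0))).
  by rewrite mul0r add0r.
rewrite !E -mulrBr Dp// Dp0// mulr0 => /eqP; rewrite eq_sym => /eqP dd.
by move: (d0 x0 Ux0); rewrite [X in X - _]mulrC [X in _ - X]mulrC dd eqxx.
Qed.

End NullFrame.

Lemma csmooth_sub (R : realType) n (U V : set 'rV[R]_n) (f : 'rV[R]_n -> R[i]) :
  V `<=` U -> csmooth U f -> csmooth V f.
Proof.
move=> VU sf k; move: (sf k) => {sf}.
elim: k f => [|k IH] f [cf df]; split=> //; try by move=> x /VU /cf.
move=> i; have [dfi /IH] := df i; split=> // x /VU; exact: dfi.
Qed.

(** * A smooth null coframe from pointwise normal forms *)

Section NullCubic.
Variables (R : realType) (U : set 'rV[R]_2).
Hypothesis oU : open U.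
Local Notation C := R[i].
Variable z : 'rV[R]_2 -> 'rV[C]_3.
Hypothesis sz : vsmooth U z.
Hypothesis z0 : forall x, U x -> b13 (z x) (z x) != 0.
Implicit Types (x : 'rV[R]_2) (i j l : 'I_2).

(* p and q are the coframe dual to a pair of null vectors. *)
Lemma no_null_cubic x0 :
  (forall x, U x -> exists (p q : 'I_2 -> R) (lam mu : R),
    [/\ mu != 0, q 0 * p 1 - q 1 * p 0 != 0,
        forall i j, gram z i j x = (p i * q j + q i * p j)%:C &
        forall i j l, cubic z i j l x - (cubic z i j l x)^*%C =
          'i%C * (2 * (lam * q i * q j * q l + mu * (q i * p j * p l
              + p i * q j * p l + p i * p j * q l)))%:C]) ->
  ~ U x0.
Proof.
move=> HP Ux0.
have gram_sym x : U x -> forall i j, gram z i j x = gram z j i x.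
  move=> Ux i j; have [p [q [lam [mu [_ _ g _]]]]] := HP x Ux.
  by rewrite !g; congr (_%:C); ring.
pose K i j l x := cubic z i j l x - (cubic z i j l x)^*%C.
pose det x := gram z 0 0 x * gram z 1 1 x - gram z 0 1 x * gram z 0 1 x.
(* The adjugate of the 2 by 2 metric makes [tr l x / det x] the metric trace of [K] in its first two
   indices. As K is 2 i c, the factor -i / 2 in [P] extracts the trace of c, which is 2 mu p. *)
pose tr l x := gram z 1 1 x * K 0 0 l x - 2 * gram z 0 1 x * K 0 1 l x
               + gram z 0 0 x * K 1 1 l x.
pose P l x := - 'i%C / 2 * (tr l x / det x).
have c2 r : (r%:C == 0 :> C) = (r == 0) by rewrite eq_complex /= eqxx andbT.
have ii : - 'i%C * 'i%C = 1 :> C by rewrite mulNr -expr2 sqr_i opprK.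
have HK x : U x -> exists (p q : 'I_2 -> R) (lam mu : R),
    [/\ mu != 0 /\ q 0 * p 1 - q 1 * p 0 != 0,
        forall i j, gram z i j x = (p i * q j + q i * p j)%:C,
        forall i j l, K i j l x =
          'i%C * (2 * (lam * q i * q j * q l + mu * (q i * p j * p l
              + p i * q j * p l + p i * p j * q l)))%:C,
        det x != 0 & forall l, P l x = (2 * mu * p l)%:C].
  move=> Ux; have [p [q [lam [mu [mu0 pq0 g k]]]]] := HP x Ux.
  have dE : det x = (- (q 0 * p 1 - q 1 * p 0) ^+ 2)%:C.
    by rewrite /det !g -!rmorphM -rmorphB/=; congr (_%:C); ring.
  have dx0 : det x != 0.
    by rewrite dE c2 oppr_eq0 expf_neq0.
  exists p, q, lam, mu; split => // l.
  have -> : P l x = (- 'i%C * 'i%C) * ((2 * mu * p l)%:C * det x / det x).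
    rewrite /P !mulrA; congr (_ / _); rewrite /tr /K !k !g dE.
    rewrite !(rmorphD, rmorphB, rmorphN, rmorphM, rmorphXn, rmorph_nat) /=.
    move: (p 0)%:C (p 1)%:C (q 0)%:C (q 1)%:C (p l)%:C (q l)%:C lam%:C mu%:C ('i%C : C).
    move=> p0 p1 q0 q1 pl ql la m i.
    by field.
  by rewrite ii mul1r mulfK.
have sZ i : vsmooth U (tang z i) by exact: vsmooth_tang.
have sg i j : csmooth U (gram z i j).
  rewrite (_ : gram z i j = fun x => herm z x (tang z i x) (tang z j x)); last first.
    by apply/funext => x; rewrite gramE.
  exact: csmooth_herm.
have sK i j l : csmooth U (K i j l).
  have sc : csmooth U (cubic z i j l).
    rewrite (_ : cubic z i j l = fun x => herm z x (cov z i (tang z j) x) (tang z l x)).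
      by apply: csmooth_herm => //; exact: vsmooth_cov.
    by apply/funext => x; rewrite cubicE.
  by apply: csmoothB => //; exact: csmoothC.
have sdet : csmooth U det by apply: csmoothB => //; exact: csmoothM.
have det0 x : U x -> det x != 0 by move=> /HK[p [q [lam [mu []]]]].
have str l : csmooth U (tr l).
  apply: csmoothD => //; last exact: csmoothM.
  apply: csmoothB => //; first exact: csmoothM.
  by apply: csmoothM => //; apply: csmoothM => //; exact: csmooth_cst.
have sP l : csmooth U (P l).
  apply: csmoothM => //; first exact: csmooth_cst.
  by apply: csmoothM => //; exact: csmoothV.
have [p0 [q0 [lam0 [mu0 [[mu00 pq0] _ _ _ P0]]]]] := HK x0 Ux0.
have [a Pa] : exists a, P a x0 != 0.
  have [p00|] := eqVneq (p0 0) 0; last first.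
    by exists 0; rewrite P0 c2 !mulf_neq0// pnatr_eq0.
  exists 1; rewrite P0 c2 !mulf_neq0 ?pnatr_eq0//.
  by apply: contra_neq pq0 => p01; rewrite p00 p01 !mulr0 subr0.
pose V := [set x | U x /\ P a x != 0].
have VU : V `<=` U by move=> x [].
have oV : open V.
  rewrite openE => x [Ux Pax].
  have PE y : U y -> P a y = (rpart (P a) y)%:C.
    by move=> /HK[p [q [lam [mu [_ _ _ _ PE]]]]]; rewrite /rpart PE.
  have [cP _] := csmooth_cont (sP a) Ux.
  rewrite PE// c2 in Pax.
  have H1 : \forall y \near x, U y := open_nbhs_nbhs (conj oU Ux).
  have H2 : \forall y \near x, rpart (P a) y != 0 by exact: (cvgr_neq0 _ cP Pax).
  suff : \forall y \near x, V y by [].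
  apply: filterS2 H1 H2 => y Uy Py.
  by split=> //; rewrite PE// c2.
(* From g_al = p_a q_l + q_a p_l and g_aa = 2 p_a q_a one solves for q_l after division by p_a,
   hence the restriction to [V]. With P in place of p the solution is q / (2 mu). *)
pose Q l x := (gram z a l x - P l x * gram z a a x / (2 * P a x)) / P a x.
have sgV i j := csmooth_sub VU (sg i j).
have sPV l := csmooth_sub VU (sP l).
have sQ l : csmooth V (Q l).
  have Pa0 x : V x -> P a x != 0 by case.
  have s2P : csmooth V (fun x => 2 * P a x).
    by apply: csmoothM => //; exact: csmooth_cst.
  apply: csmoothM => //; last exact: csmoothV.
  apply: csmoothB => //; apply: csmoothM => //; first exact: csmoothM.
  by apply: csmoothV => // x /Pa0 Px; rewrite mulf_neq0// pnatr_eq0.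
have HQ x : V x -> exists (p q : 'I_2 -> R) (lam mu : R),
    [/\ mu != 0 /\ q 0 * p 1 - q 1 * p 0 != 0,
        forall i j, gram z i j x = (p i * q j + q i * p j)%:C,
        forall i j l, K i j l x =
          'i%C * (2 * (lam * q i * q j * q l + mu * (q i * p j * p l
              + p i * q j * p l + p i * p j * q l)))%:C,
        forall l, Q l x = (q l / (2 * mu))%:C &
        forall l, P l x = (2 * mu * p l)%:C].
  move=> [Ux Pax]; have [p [q [lam [mu [[mu1 pq1] g k _ PE]]]]] := HK x Ux.
  exists p, q, lam, mu; split => // l.
  have pa0 : p a != 0.
    by move: Pax; rewrite PE c2; apply: contraNneq => ->; rewrite mulr0.
  have r0 (r : R) : r != 0 -> r%:C != 0 :> C by rewrite c2.
  rewrite /Q !g !PE !(rmorphD, rmorphB, rmorphM, fmorphV, rmorph_nat) /=.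
  move: (p a)%:C (p l)%:C (q a)%:C (q l)%:C mu%:C (r0 _ pa0) (r0 _ mu1).
  by move=> pa pl qa ql m pa1 m1; field; rewrite pa1 m1.
(* Only the reality of [lam] matters, so a pointwise choice suffices, with the dummy value 0 outside
   [V]. *)
have /choice[lam Hlam] : forall x, exists l : C, V x -> l^*%C = l /\
    forall i j k, K i j k x =
     'i%C * (l * Q i x * Q j x * Q k x + Q i x * P j x * P k x
          + P i x * Q j x * P k x + P i x * P j x * Q k x).
  move=> x; have [Vx|] := pselect (V x); last by exists 0.
  have [p [q [l [mu [[mu1 pq1] g k QE PE]]]]] := HQ x Vx.
  (* Substituting q = 2 mu Q in 2 lam q_i q_j q_k produces the factor 2 (2 mu)^3. *)
  exists (16 * l * mu ^+ 3)%:C => _; split; first by rewrite conjc_real.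
  move=> i j m; rewrite k !QE !PE; congr (_ * _).
  rewrite -!(rmorphM, rmorphD) /=; congr (_%:C); field; exact: mu1.
have V0 : V x0 by [].
have gV x : V x -> forall i j, gram z i j x = gram z j i x by move=> /VU /gram_sym.
apply: (no_null_coframe oV _ _ gV (p := P) (q := Q) (lam := lam)) V0 => //.
- by move=> i; exact: csmooth_sub VU (sz i).
- by move=> x /VU /z0.
- by move=> x i /HQ[p [q [l [m [_ _ _ _ ->]]]]]; rewrite conjc_real.
- by move=> x i /HQ[p [q [l [m [_ _ _ -> _]]]]]; rewrite conjc_real.
- by move=> x /Hlam[].
- move=> x /HQ[p [q [l [m [[m0 pq1] _ _ QE PE]]]]].
  rewrite !QE !PE -!rmorphM -rmorphB/= c2.
  by rewrite (_ : _ - _ = q 0 * p 1 - q 1 * p 0)//; field.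
- move=> x i j /HQ[p [q [l [m [[m0 pq1] g _ QE PE]]]]].
  by rewrite g !QE !PE -!rmorphM -rmorphD/=; congr (_%:C); field.
- by move=> x i j k /Hlam[_ H]; exact: H.
Qed.

End NullCubic.

(** * The Fubini-Study metric in affine charts *)

Section BilinearForm.
Variables (R : realType) (n : nat).
Implicit Types (G : 'M[R]_n) (u v w : 'rV[R]_n).

Lemma gformDl G u v w : gform G (u + v) w = gform G u w + gform G v w.
Proof. by rewrite /gform !mulmxDl mxE. Qed.

Lemma gformZl G (a : R) u w : gform G (a *: u) w = a * gform G u w.
Proof. by rewrite /gform -!scalemxAl mxE. Qed.

Lemma gformDr G u v w : gform G w (u + v) = gform G w u + gform G w v.
Proof. by rewrite /gform linearD mulmxDr mxE. Qed.

Lemma gformZr G (a : R) u w : gform G w (a *: u) = a * gform G w u.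
Proof. by rewrite /gform linearZ -scalemxAr mxE. Qed.

Lemma gform_basis G i j : gform G (basis_vec R i) (basis_vec R j) = G i j.
Proof.
by rewrite /gform /basis_vec -rowE trmx_delta -colE !mxE.
Qed.

Lemma gform_basis_r G u j : gform G u (basis_vec R j) = (u *m G) 0 j.
Proof. by rewrite /gform /basis_vec trmx_delta -colE mxE. Qed.

End BilinearForm.

Section FubiniStudy.
Variables (R : realType) (k : 'I_3).
Local Notation C := R[i].
Implicit Types (u w X Y : 'rV[R]_(2 + 2)) (z : 'rV[C]_3).

(** The section with k-th entry 1 is affine in [w]: the square root in [cp_sec] disappears, at the
    price of dividing hermitian products by [cone_norm]. *)
Definition cone_pt w : 'rV[C]_3 := ins k 1 (to_cplx w).
Definition cone_vec X : 'rV[C]_3 := ins k 0 (to_cplx X).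
Definition cone_norm w : C := b13 (cone_pt w) (cone_pt w).
Definition cone_lift w X : 'rV[C]_3 :=
  cone_vec X - (b13 (cone_vec X) (cone_pt w) / cone_norm w) *: cone_pt w.

Lemma cone_vecP (r : R) X Y :
  cone_vec (r *: X + Y) = r%:C *: cone_vec X + cone_vec Y.
Proof. by rewrite /cone_vec to_cplxP insP. Qed.

Lemma cone_liftP w (r : R) X Y :
  cone_lift w (r *: X + Y) = r%:C *: cone_lift w X + cone_lift w Y.
Proof.
rewrite /cone_lift cone_vecP b13Pl.
move: (cone_vec X) (cone_vec Y) (cone_pt w) (cone_norm w) => x y z N.
by apply/rowP => a; rewrite !mxE; ring.
Qed.

Lemma cone_liftD w X Y : cone_lift w (X + Y) = cone_lift w X + cone_lift w Y.
Proof. by rewrite -[X]scale1r cone_liftP scale1r scale1r. Qed.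

Lemma cone_lift0 w : cone_lift w 0 = 0.
Proof.
by have /eqP := cone_liftD w 0 0; rewrite addr0 -subr_eq0 opprD addNKr oppr_eq0 => /eqP.
Qed.

Lemma cone_liftZ w (r : R) X : cone_lift w (r *: X) = r%:C *: cone_lift w X.
Proof. by rewrite -[r *: X]addr0 cone_liftP cone_lift0 addr0. Qed.

Lemma cone_liftN w X : cone_lift w (- X) = - cone_lift w X.
Proof. by rewrite -scaleN1r cone_liftZ rmorphN rmorph1 scaleN1r. Qed.

Lemma cone_lift_sum (I : Type) (s : seq I) w (F : I -> 'rV[R]_(2 + 2)) :
  cone_lift w (\sum_(i <- s) F i) = \sum_(i <- s) cone_lift w (F i).
Proof.
by elim: s => [|i s IH]; rewrite ?big_nil ?cone_lift0// !big_cons cone_liftD IH.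
Qed.

Lemma cone_norm_real w : cone_norm w = (complex.Re (cone_norm w))%:C.
Proof.
have := b13C (cone_pt w) (cone_pt w); rewrite -/(cone_norm w).
by case: (cone_norm w) => a b [] /eqP; rewrite eqr_oppLR => bb;
   rewrite (_ : b = 0)//; lra.
Qed.

Lemma cone_pt_k w : cone_pt w 0 k = 1.
Proof. by rewrite mxE unlift_none. Qed.

Section Point.
Variable w : 'rV[R]_(2 + 2).
Hypothesis Nw : 0 < complex.Re (cone_norm w).

Lemma cone_norm_neq0 : cone_norm w != 0.
Proof.
by rewrite cone_norm_real eq_complex /= eqxx andbT gt_eqF.
Qed.

Lemma b13_cone_lift_pt X : b13 (cone_lift w X) (cone_pt w) = 0.
Proof.
by rewrite /cone_lift b13Bl b13Zl divfK ?subrr//; exact: cone_norm_neq0.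
Qed.

Lemma b13_pt_cone_lift X : b13 (cone_pt w) (cone_lift w X) = 0.
Proof. by rewrite -b13C b13_cone_lift_pt rmorph0. Qed.

Lemma b13_cone_lift X Y : b13 (cone_lift w X) (cone_lift w Y) =
  b13 (cone_vec X) (cone_vec Y)
  - b13 (cone_vec X) (cone_pt w) * b13 (cone_pt w) (cone_vec Y) / cone_norm w.
Proof.
rewrite {1}/cone_lift b13Bl b13Zl b13_pt_cone_lift mulr0 subr0.
rewrite /cone_lift b13Br b13Zr; congr (_ - _).
by rewrite rmorphM fmorphV/= b13C b13C -/(cone_norm w); ring.
Qed.

(** The unit lift [cp_sec] is a real multiple r of [cone_pt] with r^2 = 1 / N, and horizontal lifts
    scale by the same r. *)
Lemma gform_cp_metric X Y : gform (cp_metric k w) X Y =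
  complex.Re (b13 (cone_lift w X) (cone_lift w Y) / cone_norm w).
Proof.
rewrite form_cp_metric.
pose r := (Num.sqrt (complex.Re (cone_norm w)))^-1.
have rr : r%:C * r%:C = (cone_norm w)^-1.
  rewrite [in RHS]cone_norm_real -fmorphV -rmorphM /r -invfM -expr2 sqr_sqrtr// ltW//.
have N0 := cone_norm_neq0.
have E V : hlift k (cp_sec k w) V = r%:C *: cone_lift w V.
  rewrite /hlift /hor_proj -/(cone_vec V) /cp_sec -/(cone_pt w) -/(cone_norm w) -/r.
  rewrite mxE cone_pt_k mulr1 b13Zl b13Zr conjc_real /cone_lift scalerBr !scalerA.
  congr (_ - _ *: _); rewrite -rr; ring.
rewrite !E b13Zl b13Zr conjc_real; congr complex.Re.
by rewrite -rr; ring.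
Qed.

Lemma cone_lift_cp_J X : cone_lift w (cp_J X) = 'i%C *: cone_lift w X.
Proof.
have E : cone_vec (cp_J X) = 'i%C *: cone_vec X.
  rewrite /cone_vec /cp_J to_realK; apply/rowP => j; rewrite !mxE.
  by case: (unlift k j) => [a|]; rewrite ?mxE ?mulr0.
rewrite /cone_lift E b13Zl; move: (cone_vec X) (cone_pt w) (cone_norm w) => x z N.
by apply/rowP => a; rewrite !mxE; ring.
Qed.

Lemma b13_nondegenerate z : (forall u : 'rV[C]_3, b13 z u = 0) -> z = 0.
Proof.
move=> H; apply/rowP => a; rewrite mxE.
have := H (delta_mx 0 a); rewrite /b13 !mxE /=.
by case: a => [[|[|[|//]]] ?] /=; rewrite ?(conjc0, conjc1, mulr0, mulr1, addr0, add0r, oppr0)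
  => /eqP; rewrite ?oppr_eq0 => /eqP <-; congr (z _ _); apply/val_inj.
Qed.

Lemma cone_vec_eq0 X : cone_vec X = 0 -> X = 0.
Proof.
move=> X0; apply: (can_inj (@to_cplxK R)); apply/rowP => j.
have := congr1 (fun z : 'rV[C]_3 => z 0 (lift k j)) X0.
rewrite /cone_vec mxE liftK => ->.
by rewrite !mxE.
Qed.

(** The k-th entry is 0 on [cone_vec] and 1 on [cone_pt], so it reads off the coefficient of the
    projection, which must vanish. *)
Lemma cone_lift_eq0 X : cone_lift w X = 0 -> X = 0.
Proof.
move=> /[dup] L0 /(congr1 (fun z : 'rV[C]_3 => z 0 k)).
rewrite /cone_lift; set c := _ / _; rewrite !mxE unlift_none mulr1 sub0r.
move=> /eqP; rewrite oppr_eq0 => /eqP c0.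
by move: L0; rewrite /cone_lift -/c c0 scale0r subr0 => /cone_vec_eq0.
Qed.

Lemma cone_span z : exists (c : C) Y, z = c *: cone_pt w + cone_lift w Y.
Proof.
pose Y := to_real (\row_j (z - z 0 k *: cone_pt w) 0 (lift k j)).
exists (z 0 k + b13 (cone_vec Y) (cone_pt w) / cone_norm w), Y.
have -> : z = z 0 k *: cone_pt w + cone_vec Y.
  apply/rowP => a; rewrite !mxE /Y to_realK; case: unliftP => [j ->|->].
    by rewrite !mxE liftK !mxE; ring.
  by rewrite mulr1 addr0.
have -> : (z 0 k *: cone_pt w + cone_vec Y) 0 k = z 0 k.
  by rewrite !mxE !unlift_none mulr1 addr0.
rewrite /cone_lift; move: (cone_vec Y) (cone_pt w) (_ / _) (z 0 k) => y p c d.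
by apply/rowP => a; rewrite !mxE; ring.
Qed.

(** Testing against [Y] and [cp_J Y] kills the real and the imaginary part of the hermitian product;
    the lifts and [cone_pt w] together span C^3, where [b13] is nondegenerate. *)
Lemma cone_lift_nondegenerate X :
  (forall Y, gform (cp_metric k w) X Y = 0) -> X = 0.
Proof.
move=> H; apply: cone_lift_eq0; apply: b13_nondegenerate => u.
have b0 Y : b13 (cone_lift w X) (cone_lift w Y) = 0.
  have := H (cp_J Y); have := H Y; rewrite !gform_cp_metric cone_lift_cp_J b13Zr.
  have N0 := cone_norm_neq0; set b := b13 _ _ => Hr Hi.
  suff : b / cone_norm w = 0.
    by move=> /eqP; rewrite mulf_eq0 invr_eq0 (negPf N0) orbF => /eqP.
  move: Hr Hi; rewrite -mulrA; case: (b / cone_norm w) => r i /= -> Hi.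
  by apply/eqP; rewrite eq_complex /= eqxx; apply/eqP; lra.
by have [c [Y ->]] := cone_span u; rewrite b13Dr b13Zr b13_cone_lift_pt mulr0 b0 addr0.
Qed.

Lemma cp_metric_unit : cp_metric k w \in unitmx.
Proof.
rewrite -row_free_unit; apply: inj_row_free => X X0.
by apply: cone_lift_nondegenerate => Y; rewrite /gform X0 mul0mx mxE.
Qed.

End Point.
End FubiniStudy.

(** * Christoffel symbols and bilinearity of the Levi-Civita derivative *)

Section Christoffel.
Variables (R : realType) (n : nat).
Implicit Types (g : 'rV[R]_n -> 'M[R]_n) (x u v w : 'rV[R]_n) (i j l m : 'I_n).
Local Notation e_ := (basis_vec R).

Lemma koszul g x i j l : g x \in unitmx -> (g x)^T = g x ->
  \sum_m christoffel g x i j m * g x m l =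
  2^-1 * ('D_(e_ i) (fun y => g y j l) x + 'D_(e_ j) (fun y => g y i l) x
          - 'D_(e_ l) (fun y => g y i j) x).
Proof.
move=> gu gs; pose S l' : R := 'D_(e_ i) (fun y => g y j l') x
  + 'D_(e_ j) (fun y => g y i l') x - 'D_(e_ l') (fun y => g y i j) x.
rewrite -/(S l).
have E m : christoffel g x i j m * g x m l
    = 2^-1 * \sum_l' S l' * (g x l m * invmx (g x) m l').
  rewrite /christoffel -mulrA; congr (_ * _); rewrite mulr_suml.
  apply: eq_bigr => l' _; rewrite -/(S l') -[in g x m l]gs mxE.
  by rewrite mulrAC mulrC [invmx _ _ _ * _]mulrC.
under eq_bigr => m _ do rewrite E.
rewrite -mulr_sumr exchange_big /=; congr (_ * _).
under eq_bigr => l' _ do rewrite -mulr_sumr.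
have E2 l' : \sum_m g x l m * invmx (g x) m l' = (l == l')%:R.
  by have /matrixP/(_ l l') := mulmxV gu; rewrite !mxE => ->.
under eq_bigr => l' _ do rewrite E2.
rewrite (bigD1 l)//= eqxx mulr1 big1 ?addr0// => l' ll'.
by rewrite eq_sym (negPf ll') mulr0.
Qed.

Lemma levi_civitaE g x u v : levi_civita g x u v =
  \sum_i \sum_j (u 0 i * v 0 j) *: \row_m christoffel g x i j m.
Proof.
apply/rowP => m; rewrite mxE summxE; apply: eq_bigr => i _.
by rewrite summxE; apply: eq_bigr => j _; rewrite !mxE.
Qed.

Lemma levi_civitaPl g x (r : R) u v w : levi_civita g x (r *: u + v) w
  = r *: levi_civita g x u w + levi_civita g x v w.
Proof.
apply/rowP => m; rewrite !mxE mulr_sumr -big_split /=; apply: eq_bigr => i _.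
rewrite mulr_sumr -big_split /=; apply: eq_bigr => j _.
by rewrite !mxE; ring.
Qed.

Lemma levi_civitaPr g x (r : R) u v w : levi_civita g x w (r *: u + v)
  = r *: levi_civita g x w u + levi_civita g x w v.
Proof.
apply/rowP => m; rewrite !mxE mulr_sumr -big_split /=; apply: eq_bigr => i _.
rewrite mulr_sumr -big_split /=; apply: eq_bigr => j _.
by rewrite !mxE; ring.
Qed.

Lemma levi_civita_basis g x i j :
  levi_civita g x (e_ i) (e_ j) = \row_m christoffel g x i j m.
Proof.
apply/rowP => m; rewrite !mxE (bigD1 i)//= [X in _ + X]big1 ?addr0 => [|a ai].
  rewrite (bigD1 j)//= [X in _ + X]big1 ?addr0 => [|b bj].
    by rewrite !mxE !eqxx !mul1r.
  by rewrite !mxE (negPf bj) andbF mulr0 mul0r.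
by rewrite big1// => b _; rewrite !mxE (negPf ai) andbF !mul0r.
Qed.

Lemma bilinear_expand (V : lmodType R[i]) (B : 'rV[R]_n -> 'rV[R]_n -> V) :
  (forall (r : R) u v w, B (r *: u + v) w = r%:C *: B u w + B v w) ->
  (forall (r : R) u v w, B w (r *: u + v) = r%:C *: B w u + B w v) ->
  forall u v, B u v = \sum_i \sum_j (u 0 i * v 0 j)%:C *: B (e_ i) (e_ j).
Proof.
move=> Bl Br.
have D0 (f : 'rV[R]_n -> V) : (forall (r : R) u v, f (r *: u + v) = r%:C *: f u + f v) ->
    forall u, f u = \sum_i (u 0 i)%:C *: f (e_ i).
  move=> fP; have f0 : f 0 = 0.
    have /eqP := fP 1 0 0; rewrite !scale1r addr0 -subr_eq0 opprD addNKr oppr_eq0.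
    by move=> /eqP.
  move=> u; rewrite {1}[u]row_sum_delta.
  have H (s : seq 'I_n) : f (\sum_(i <- s) u 0 i *: delta_mx 0 i)
      = \sum_(i <- s) (u 0 i)%:C *: f (e_ i).
    by elim: s => [|i s IH]; rewrite ?big_nil// !big_cons fP IH.
  exact: H.
move=> u v; rewrite (D0 (B ^~ v)) => [|r u1 v1]; last exact: Bl.
apply: eq_bigr => i _; rewrite (D0 (B (e_ i))) => [|r u1 v1]; last exact: Br.
rewrite scaler_sumr; apply: eq_bigr => j _.
by rewrite scalerA -rmorphM.
Qed.

End Christoffel.

Section Coordinates.
Variables (R : realType) (n : nat).
Local Notation e_ := (basis_vec R).

Lemma is_derive_coord (x v : 'rV[R]_n) a : is_derive x v (fun y => y 0 a) (v 0 a).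
Proof.
have D : derivable (@id 'rV[R]_n) x v by exact: derivable_id.
have /derivable_mxP Da := D.
apply: DeriveDef; first exact: Da.
by have := derive_mx D; rewrite derive_id => /rowP/(_ a) ->; rewrite mxE.
Qed.

Lemma csmooth_coord (U : set 'rV[R]_n) a : open U -> csmooth U (fun y => (y 0 a)%:C).
Proof.
move=> oU.
have K x : U x -> ccontinuous (fun y : 'rV[R]_n => (y 0 a)%:C) x.
  by move=> _; split; [exact: coord_continuous|exact: cst_continuous].
case=> [|k]; first by split.
apply: (@ccont_diffS _ _ _ oU _ _ (fun i _ => (e_ i 0 a)%:C)) => //.
  by move=> i x _; apply: is_cderive_real; exact: is_derive_coord.
by move=> i; exact: ccont_diff_cst.
Qed.

End Coordinates.

(** * The Levi-Civita connection of the Fubini-Study metric *)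

Section FubiniStudyConnection.
Variables (R : realType) (k : 'I_3).
Local Notation C := R[i].
Local Notation e_ := (basis_vec R).
Local Notation L := (cone_lift k).
Local Notation W := (cone_vec k).
Local Notation Z := (cone_pt k).
Local Notation N := (cone_norm k).
Implicit Types (u v w X Y : 'rV[R]_(2 + 2)).

Lemma to_cplxE w j :
  to_cplx w 0 j = (w 0 (lshift 2 j))%:C + 'i%C * (w 0 (rshift 2 j))%:C.
Proof.
by rewrite !mxE; apply/eqP; rewrite eq_complex /=; apply/andP; split; apply/eqP; ring.
Qed.

Lemma is_cderive_cone_pt w v a : is_cderive w v (fun y => Z y 0 a) (W v 0 a).
Proof.
rewrite /cone_pt /cone_vec mxE; case: (unliftP k a) => [j ->|->].
  have -> : (fun y => ins k 1 (to_cplx y) 0 (lift k j)) =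
      fun y : 'rV[R]_(2 + 2) => (y 0 (lshift 2 j))%:C + 'i%C * (y 0 (rshift 2 j))%:C.
    by apply/funext => y; rewrite mxE liftK to_cplxE.
  rewrite to_cplxE.
  apply: is_cderive_eq (is_cderiveD (is_cderive_real (is_derive_coord _ _ _))
    (is_cderiveM (is_cderive_cst _ _ _) (is_cderive_real (is_derive_coord _ _ _)))) _.
  by rewrite mul0r add0r.
have -> : (fun y : 'rV[R]_(2 + 2) => ins k 1 (to_cplx y) 0 k) = fun=> 1.
  by apply/funext => y; rewrite mxE unlift_none.
exact: is_cderive_cst.
Qed.

Lemma vsmooth_cone_pt : vsmooth [set: 'rV[R]_(2 + 2)] (Z : _ -> 'rV[C]_3).
Proof.
move=> a; rewrite /cone_pt; case: (unliftP k a) => [j ->|->].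
  have -> : (fun y => ins k 1 (to_cplx y) 0 (lift k j)) =
      fun y : 'rV[R]_(2 + 2) => (y 0 (lshift 2 j))%:C + 'i%C * (y 0 (rshift 2 j))%:C.
    by apply/funext => y; rewrite mxE liftK to_cplxE.
  apply: csmoothD; first exact: openT.
    exact: csmooth_coord openT.
  apply: csmoothM; first exact: openT.
    exact: csmooth_cst openT _.
  exact: csmooth_coord openT.
have -> : (fun y : 'rV[R]_(2 + 2) => ins k 1 (to_cplx y) 0 k) = fun=> 1.
  by apply/funext => y; rewrite mxE unlift_none.
exact: csmooth_cst openT _.
Qed.

Lemma cone_norm_gt0_near w : 0 < complex.Re (N w) ->
  \forall y \near w, 0 < complex.Re (N y).
Proof.
have [cN _] := csmooth_cont (csmooth_b13 openT vsmooth_cone_pt vsmooth_cone_pt) (I : setT w).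
exact: (cvgr_gt _ cN).
Qed.

Section Point.
Variable w : 'rV[R]_(2 + 2).
Hypothesis Nw : 0 < complex.Re (N w).

(** The derivative, as the affine point moves along [V], of <X, Y> / N - <X, z> <z, Y> / N^2, with X
    and Y held constant. *)
Definition dmetric (V X Y : 'rV[C]_3) : C :=
  let z := Z w in let Nv := b13 V z + b13 z V in
  - Nv / N w ^+ 2 * b13 X Y - (b13 X V * b13 z Y + b13 X z * b13 V Y) / N w ^+ 2
  + 2 * Nv * b13 X z * b13 z Y / N w ^+ 3.

Lemma derive_cp_metric v i j : 'D_v (fun y => cp_metric k y i j) w =
  complex.Re (dmetric (W v) (W (e_ i)) (W (e_ j))).
Proof.
set X := W (e_ i); set Y := W (e_ j).
pose F y : C := b13 X Y * (N y)^-1 - b13 X (Z y) * b13 (Z y) Y * ((N y)^-1 * (N y)^-1).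
rewrite (@near_eq_derive _ _ _ _ (rpart F)); last first.
  apply: filterS (cone_norm_gt0_near Nw) => y Ny.
  rewrite -gform_basis gform_cp_metric// b13_cone_lift// /rpart; congr complex.Re.
  by rewrite /F -/X -/Y mulrBl -!mulrA.
have N0 := cone_norm_neq0 Nw.
have dz a := is_cderive_cone_pt w v a.
have d0 (c : C) a : is_cderive w v (fun=> c) ((0 : 'rV[C]_3) 0 a).
  by rewrite mxE; exact: is_cderive_cst.
have dX a := d0 (X 0 a) a; have dY a := d0 (Y 0 a) a.
have dN := is_cderiveV N0 (is_cderive_b13_coord dz dz).
have := is_cderiveB (is_cderiveM (is_cderive_cst w v (b13 X Y)) dN)
  (is_cderiveM (is_cderiveM (is_cderive_b13_coord dX dz) (is_cderive_b13_coord dz dY))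
    (is_cderiveM dN dN)).
have b0l (u : 'rV[C]_3) : b13 0 u = 0 :> C by rewrite -(scale0r (0 : 'rV[C]_3)) b13Zl mul0r.
have b0r (u : 'rV[C]_3) : b13 u 0 = 0 :> C by rewrite -b13C b0l rmorph0.
rewrite -/(F) => - [[_ ->] _]; congr complex.Re.
rewrite /dmetric b0l b0r.
by field.
Qed.

(** [T] is the hermitian product with the lift of [Y] of the expected Christoffel vector -(<U, z> V
    + <V, z> U) / N. *)
Lemma dmetric_koszul (U V Y : 'rV[C]_3) :
  let S := dmetric U V Y + dmetric V U Y - dmetric Y U V in
  let T := - (N w)^-1 * (b13 U (Z w) * (b13 V Y - b13 V (Z w) * b13 (Z w) Y / N w)
                   + b13 V (Z w) * (b13 U Y - b13 U (Z w) * b13 (Z w) Y / N w)) / N w in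
  complex.Re S = 2 * complex.Re T.
Proof.
move=> S T.
(* Real parts are replaced by sums with conjugates, which makes the claim a field identity between
   the hermitian products. *)
have ReE (a b : C) : a + a^*%C = 2 * (b + b^*%C) -> complex.Re a = 2 * complex.Re b.
  case: a b => [a1 a2] [b1 b2] /eqP; rewrite eq_complex /= => /andP[/eqP + _].
  by move=> H; lra.
apply: ReE; rewrite /S /T /dmetric.
have N0 := cone_norm_neq0 Nw.
have cN : (N w)^*%C = N w by rewrite /cone_norm b13C.
have cM (a b : C) : (a * b)^*%C = a^*%C * b^*%C by rewrite rmorphM.
have cD (a b : C) : (a + b)^*%C = a^*%C + b^*%C by rewrite rmorphD.
have cB (a : C) : (- a)^*%C = - a^*%C by rewrite rmorphN.
have cX (a : C) m : (a ^+ m)^*%C = a^*%C ^+ m by rewrite rmorphXn.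
have [c1 c2 c3] : [/\ (b13 U (Z w))^*%C = b13 (Z w) U, (b13 V (Z w))^*%C = b13 (Z w) V
  & (b13 Y (Z w))^*%C = b13 (Z w) Y] by rewrite !b13C.
have [c4 c5 c6] : [/\ (b13 (Z w) U)^*%C = b13 U (Z w), (b13 (Z w) V)^*%C = b13 V (Z w)
  & (b13 (Z w) Y)^*%C = b13 Y (Z w)] by rewrite !b13C.
have [c7 c8 c9] : [/\ (b13 U V)^*%C = b13 V U, (b13 V Y)^*%C = b13 Y V
  & (b13 U Y)^*%C = b13 Y U] by rewrite !b13C.
have [d7 d8] : (b13 V U)^*%C = b13 U V /\ (b13 Y V)^*%C = b13 V Y by rewrite !b13C.
move: (b13 U (Z w)) (b13 V (Z w)) (b13 Y (Z w)) (b13 (Z w) U) (b13 (Z w) V)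
  (b13 (Z w) Y) (b13 U V) (b13 V Y) (b13 U Y) (b13 V U) (b13 Y V) (b13 Y U)
  (N w) cN N0 c1 c2 c3 c4 c5 c6 c7 c8 c9 d7 d8.
move=> uz vz yz zu zv zy uv vy uy vu yv yu n cN N0 c1 c2 c3 c4 c5 c6 c7 c8 c9 d7 d8.
rewrite !(cD, cB, cM, cX, conjc_inv, conjc_nat).
rewrite cN c1 c2 c3 c4 c5 c6 c7 c8 c9 d7 d8.
by field.
Qed.

Lemma cone_lift_to_real (c : C) (x y : 'rV[C]_2) :
  L w (to_real (c *: x + y)) = c *: L w (to_real x) + L w (to_real y).
Proof.
have E : W (to_real (c *: x + y)) = c *: W (to_real x) + W (to_real y).
  by rewrite /cone_vec !to_realK insP.
rewrite /cone_lift E b13Pl.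
move: (W (to_real x)) (W (to_real y)) (Z w) (N w) => a b z n.
by apply/rowP => i; rewrite !mxE; ring.
Qed.

Lemma cp_metric_sym : (cp_metric k w)^T = cp_metric k w.
Proof.
apply/matrixP => i j; rewrite [LHS]mxE [LHS]mxE [RHS]mxE -b13C.
by move: (b13 _ _) => [].
Qed.

(** The symbols are complex bilinear in affine coordinates, as for any Kaehler metric in holomorphic
    ones. Since the real metric is invertible, it is enough to compare products with coordinate
    vectors, where the Koszul formula applies. *)
Lemma cone_lift_christoffel i j :
  L w (\row_m christoffel (cp_metric k) w i j m) =
  - (N w)^-1 * b13 (W (e_ i)) (Z w) *: L w (e_ j)
  + - (N w)^-1 * b13 (W (e_ j)) (Z w) *: L w (e_ i).
Proof.
set c1 := _ * b13 (W (e_ i)) _; set c2 := _ * b13 (W (e_ j)) _.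
pose xi := \row_m christoffel (cp_metric k) w i j m.
pose g0 : 'rV[R]_(2 + 2) :=
  to_real (c1 *: to_cplx (e_ j) + (c2 *: to_cplx (e_ i) + 0)).
have L0 : L w (to_real 0) = 0.
  rewrite (_ : to_real 0 = 0) ?cone_lift0//; apply: (can_inj (@to_cplxK R)).
  by rewrite to_realK; apply/rowP => a; rewrite !mxE.
have Lg : L w g0 = c1 *: L w (e_ j) + c2 *: L w (e_ i).
  by rewrite /g0 !cone_lift_to_real !to_cplxK L0 addr0.
rewrite -Lg -/xi; congr (L w _).
have ReDB (a b c : C) :
  complex.Re a + complex.Re b - complex.Re c = complex.Re (a + b - c) by case: a b c => [? ?] [? ?] [].
have gu := cp_metric_unit Nw.
apply: (can_inj (mulmxK gu)); apply/rowP => l.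
rewrite [LHS]mxE; under eq_bigr => m _ do rewrite [xi _ _]mxE.
rewrite (koszul _ _ _ gu cp_metric_sym) !derive_cp_metric ReDB.
rewrite dmetric_koszul mulKf ?pnatr_eq0//.
rewrite -gform_basis_r gform_cp_metric//; congr complex.Re.
rewrite Lg b13Dl !b13Zl !b13_cone_lift// /c1 /c2.
by field; exact: cone_norm_neq0.
Qed.

Lemma cone_lift_levi_civita u v :
  L w (levi_civita (cp_metric k) w u v) =
  - (N w)^-1 * b13 (W u) (Z w) *: L w v + - (N w)^-1 * b13 (W v) (Z w) *: L w u.
Proof.
pose B u v := - (N w)^-1 * b13 (W u) (Z w) *: L w v
              + - (N w)^-1 * b13 (W v) (Z w) *: L w u.
have Bl (r : R) u1 v1 w1 : B (r *: u1 + v1) w1 = r%:C *: B u1 w1 + B v1 w1.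
  rewrite /B cone_vecP b13Pl cone_liftP.
  move: (L w u1) (L w v1) (L w w1) => a b c.
  by apply/rowP => i; rewrite !mxE; ring.
have Br (r : R) u1 v1 w1 : B w1 (r *: u1 + v1) = r%:C *: B w1 u1 + B w1 v1.
  rewrite /B cone_vecP b13Pl cone_liftP.
  move: (L w u1) (L w v1) (L w w1) => a b c.
  by apply/rowP => i; rewrite !mxE; ring.
rewrite -/(B u v) (bilinear_expand Bl Br) levi_civitaE cone_lift_sum.
apply: eq_bigr => i _; rewrite cone_lift_sum; apply: eq_bigr => j _.
by rewrite cone_liftZ cone_lift_christoffel.
Qed.

End Point.
End FubiniStudyConnection.

(** * The lift of a surface *)

Lemma sum_ord2 (V : nmodType) (F : 'I_2 -> V) : \sum_i F i = F 0 + F 1.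
Proof.
rewrite !big_ord_recl big_ord0 addr0; congr (F _ + F _); exact/val_inj.
Qed.

Section SmoothMaps.
Variables (R : realType) (n m : nat) (U : set 'rV[R]_n).
Hypothesis oU : open U.
Local Notation e_ := (basis_vec R).
Implicit Types (X : 'rV[R]_n -> 'rV[R]_m) (x : 'rV[R]_n).

Lemma smooth_on_partial X i : smooth_on U X -> smooth_on U ('D_(e_ i) X).
Proof.
move=> sX s x Ux.
have E : partials s ('D_(e_ i) X) = partials (rcons s i) X.
  by rewrite /partials foldr_rcons.
by rewrite E; exact: sX.
Qed.

Lemma smooth_on_is_cderive X i a x : smooth_on U X -> U x ->
  is_cderive x (e_ i) (fun y => (X y 0 a)%:C) (('D_(e_ i) X x) 0 a)%:C.
Proof.
move=> sX Ux; have [_ /(_ i) /= dX] := sX [::] x Ux.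
apply: is_cderive_real; rewrite (derive_mx dX) mxE.
have /derivable_mxP/(_ 0 a) dXa := dX.
exact: DeriveDef.
Qed.

Lemma smooth_on_csmooth X a : smooth_on U X -> csmooth U (fun y => (X y 0 a)%:C).
Proof.
move=> sX k; elim: k X sX => [|k IH] X sX.
  split=> // x Ux; have [cX _] := sX [::] x Ux.
  split; last exact: cst_continuous.
  have : {for x, continuous ((fun M : 'rV[R]_m => M 0 a) \o X)}.
    by apply: continuous_comp; [exact: cX|exact: coord_continuous].
  exact.
apply: (@ccont_diffS _ _ _ oU _ _ (fun i x => (('D_(e_ i) X x) 0 a)%:C)).
- exact: ccont_diff_cont (IH X sX).
- by move=> i x Ux; exact: smooth_on_is_cderive.
- by move=> i; apply: IH; exact: smooth_on_partial.
Qed.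

End SmoothMaps.

Section PlaneMaps.
Variables (R : realType) (m : nat) (U : set 'rV[R]_2).
Hypothesis oU : open U.
Local Notation e_ := (basis_vec R).
Implicit Types (X : 'rV[R]_2 -> 'rV[R]_m) (x v : 'rV[R]_2).

(** [smooth_on] concerns coordinate directions only; continuity of the partial derivatives extends
    it to every direction, entry by entry. *)
Lemma smooth_on_derive X x v : smooth_on U X -> U x ->
  is_derive x v X (\sum_i v 0 i *: 'D_(e_ i) X x).
Proof.
move=> sX Ux.
have vE : v = v 0 0 *: e_ 0 + v 0 1 *: e_ 1.
  by rewrite {1}[v]row_sum_delta sum_ord2.
rewrite (sum_ord2 (fun i => v 0 i *: 'D_(e_ i) X x)).
set d := _ + _.
have D j : is_derive x v (fun y => X y 0 j) (d 0 j).
  have -> : d 0 j = v 0 0 * 'D_(e_ 0) X x 0 j + v 0 1 * 'D_(e_ 1) X x 0 j.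
    by rewrite /d; move: ('D_(e_ 0) X x) ('D_(e_ 1) X x) => a b; rewrite !mxE.
  have dX b y : U y -> is_derive y (e_ b) (fun y => X y 0 j) ('D_(e_ b) X y 0 j).
    by move=> Uy; have [] := smooth_on_is_cderive b j sX Uy.
  have E b y : U y -> 'D_(e_ b) (fun y => X y 0 j) y = 'D_(e_ b) X y 0 j.
    by move=> Uy; have [_ ->] := dX b y Uy.
  have c b : {for x, continuous ('D_(e_ b) (fun y => X y 0 j))}.
    have [+ _] := csmooth_cont (smooth_on_csmooth oU j (smooth_on_partial b sX)) Ux.
    apply: continuous_near_eq; apply: (open_near oU Ux) => y Uy.
    by rewrite E.
  have H : \forall y \near x, derivable (fun y => X y 0 j) y (e_ 0) /\
      derivable (fun y => X y 0 j) y (e_ 1).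
    apply: (open_near oU Ux) => y Uy.
    by have [d0 _] := dX 0 y Uy; have [d1 _] := dX 1 y Uy.
  by have := is_derive_dirD (v 0 0) (v 0 1) H (c 0) (c 1); rewrite -vE !E.
have dX : derivable X x v.
  by apply/derivable_mxP => i j; rewrite ord1; have [] := D j.
apply: DeriveDef => //; rewrite derive_mx//.
by apply/rowP => j; rewrite mxE; have [] := D j.
Qed.

End PlaneMaps.

(** * The second fundamental form through the hermitian connection *)

Section SurfaceInChart.
Variables (R : realType) (k : 'I_3) (U : set 'rV[R]_2).
Hypothesis oU : open U.
Local Notation C := R[i].
Local Notation e_ := (basis_vec R).
Variable X : 'rV[R]_2 -> 'rV[R]_(2 + 2).
Hypothesis sX : smooth_on U X.
Hypothesis NX : forall x, U x -> 0 < complex.Re (cone_norm k (X x)).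
Implicit Types (x : 'rV[R]_2) (i j l : 'I_2).
Local Notation dX i := ('D_(e_ i) X).
Local Notation g := (cp_metric k).

Definition surf_lift x : 'rV[C]_3 := cone_pt k (X x).
Local Notation Z := (tang surf_lift).
Local Notation h := (herm surf_lift).

Lemma lift_neq0 x : U x -> b13 (surf_lift x) (surf_lift x) != 0.
Proof. by move=> Ux; exact: cone_norm_neq0 (NX Ux). Qed.

Lemma csmooth_to_cplx (Y : 'rV[R]_2 -> 'rV[R]_(2 + 2)) j : smooth_on U Y ->
  csmooth U (fun x => to_cplx (Y x) 0 j).
Proof.
move=> sY.
apply: csmooth_eq (csmoothD oU (smooth_on_csmooth oU (lshift 2 j) sY)
  (csmoothM oU (csmooth_cst oU 'i%C) (smooth_on_csmooth oU (rshift 2 j) sY))) => //.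
by move=> x _; rewrite to_cplxE.
Qed.

Lemma is_cderive_to_cplx (Y : 'rV[R]_2 -> 'rV[R]_(2 + 2)) i j x :
  smooth_on U Y -> U x ->
  is_cderive x (e_ i) (fun y => to_cplx (Y y) 0 j) (to_cplx ('D_(e_ i) Y x) 0 j).
Proof.
move=> sY Ux; rewrite to_cplxE.
have -> : (fun y => to_cplx (Y y) 0 j) =
    fun y => (Y y 0 (lshift 2 j))%:C + 'i%C * (Y y 0 (rshift 2 j))%:C.
  by apply/funext => y; rewrite to_cplxE.
have := is_cderiveD (smooth_on_is_cderive i (lshift 2 j) sY Ux)
  (is_cderiveM (is_cderive_cst x (e_ i) 'i%C) (smooth_on_is_cderive i (rshift 2 j) sY Ux)).
by rewrite mul0r add0r.
Qed.

Lemma vsmooth_ins (Y : 'rV[R]_2 -> 'rV[R]_(2 + 2)) c : smooth_on U Y ->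
  vsmooth U (fun x => ins k c (to_cplx (Y x))).
Proof.
move=> sY a; case: (unliftP k a) => [j ->|->].
  apply: csmooth_eq (csmooth_to_cplx j sY) => // x _.
  by rewrite [RHS]mxE liftK.
apply: csmooth_eq (csmooth_cst oU c) => // x _.
by rewrite mxE unlift_none.
Qed.

Lemma vderive_ins (Y : 'rV[R]_2 -> 'rV[R]_(2 + 2)) c i x : smooth_on U Y -> U x ->
  vderive (e_ i) (fun x => ins k c (to_cplx (Y x))) x = cone_vec k ('D_(e_ i) Y x).
Proof.
move=> sY Ux; apply/rowP => a; rewrite vderiveE; apply: cderive_val.
rewrite /cone_vec mxE; case: (unliftP k a) => [j ->|->].
  have -> : (fun y => ins k c (to_cplx (Y y)) 0 (lift k j))
      = fun y => to_cplx (Y y) 0 j.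
    by apply/funext => y; rewrite mxE liftK.
  exact: is_cderive_to_cplx.
have -> : (fun y => ins k c (to_cplx (Y y)) 0 k) = fun=> c.
  by apply/funext => y; rewrite mxE unlift_none.
exact: is_cderive_cst.
Qed.

Lemma vsmooth_lift : vsmooth U surf_lift.
Proof. exact: vsmooth_ins. Qed.

Lemma vderive_lift i x : U x -> vderive (e_ i) surf_lift x = cone_vec k (dX i x).
Proof. exact: vderive_ins. Qed.

Lemma thetaX i x : U x ->
  theta surf_lift i x = b13 (cone_vec k (dX i x)) (surf_lift x) / cone_norm k (X x).
Proof. by move=> Ux; rewrite thetaE vderive_lift// hermE. Qed.

Lemma tang_lift i x : U x -> Z i x = cone_lift k (X x) (dX i x).
Proof. by move=> Ux; rewrite tangE covE vderive_lift// thetaX. Qed.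

Lemma gform_herm x Y1 Y2 : U x -> gform (g (X x)) Y1 Y2 =
  complex.Re (h x (cone_lift k (X x) Y1) (cone_lift k (X x) Y2)).
Proof. by move=> Ux; rewrite gform_cp_metric ?NX// hermE. Qed.

Lemma gform_gram i j x : U x ->
  gform (g (X x)) (dX i x) (dX j x) = complex.Re (gram surf_lift i j x).
Proof. by move=> Ux; rewrite gform_herm// gramE !tang_lift. Qed.

Lemma induced_gram i j x : U x ->
  induced_metric X g x i j = complex.Re (gram surf_lift i j x).
Proof. by move=> Ux; rewrite mxE gform_gram. Qed.

Hypothesis gram_sym : forall x, U x -> forall i j,
  gram surf_lift i j x = gram surf_lift j i x.
Hypothesis ind_unit : forall x, U x -> induced_metric X g x \in unitmx.
Local Notation cubic := (cubic surf_lift).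

Let sl := vsmooth_lift.
Let l0 := lift_neq0.
Let sZ := vsmooth_tang oU sl l0.

Lemma derive_induced l i j x : U x ->
  'D_(e_ l) (fun y => induced_metric X g y i j) x =
  complex.Re (cubic l i j x) + complex.Re (cubic l j i x).
Proof.
move=> Ux; rewrite (@near_eq_derive _ _ _ _ (rpart (fun y => h y (Z i y) (Z j y)))).
  have [[_ ->] _] := is_cderive_herm sl l0 l (sZ i) (sZ j) Ux.
  by rewrite -cubicE -hermC -cubicE raddfD/=; case: (cubic l j i x).
by apply: (open_near oU Ux) => y Uy; rewrite induced_gram// gramE.
Qed.

Lemma cubic_sym12 i j l x : U x -> cubic i j l x = cubic j i l x.
Proof. by move=> Ux; exact: (cubicC12 oU sl l0 gram_sym). Qed.

Lemma induced_sym x : U x -> (induced_metric X g x)^T = induced_metric X g x.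
Proof.
move=> Ux; apply/matrixP => i j; rewrite [LHS]mxE !induced_gram//.
by rewrite gram_sym.
Qed.

(** The real part of the connection is metric by [derive_induced] and torsion-free by [cubic_sym12],
    so the Koszul formula identifies it with the Levi-Civita connection of the induced metric. *)
Lemma christoffel_induced i j l x : U x ->
  \sum_m christoffel (induced_metric X g) x i j m * induced_metric X g x m l
  = complex.Re (cubic i j l x).
Proof.
move=> Ux; rewrite (koszul i j l (ind_unit Ux) (induced_sym Ux)) !derive_induced//.
rewrite (cubic_sym12 j i l Ux) (cubic_sym12 l i j Ux) (cubic_sym12 l j i Ux).
move: (complex.Re _) (complex.Re _) (complex.Re _) => a b c.
by field.
Qed.

Lemma herm_cone_vec x Y l : U x ->
  h x (cone_vec k Y) (Z l x) = h x (cone_lift k (X x) Y) (Z l x).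
Proof.
move=> Ux; rewrite /cone_lift hermBl hermZl -/(surf_lift x) (herm_z_tang l0)//.
by rewrite mulr0 subr0.
Qed.

(** Paired with tangent lifts, the ambient covariant derivative of a coordinate field gives [cubic].
    Its tangential part accounts for the real part, by [christoffel_induced], and the Gauss formula
    removes exactly that. *)
Lemma herm_sff_basis i j l x : U x ->
  h x (cone_lift k (X x) (sff X g x (e_ i) (e_ j))) (Z l x)
  = 'i%C * (complex.Im (cubic i j l x))%:C.
Proof.
move=> Ux.
have [xi Exi] : {xi | xi = levi_civita (induced_metric X g) x (e_ i) (e_ j)} :=
  exist _ _ erefl.
have [dxi Edxi] : {dxi | dxi = 'D_xi X x} :=
  exist _ _ erefl.
have [dd Edd] : {dd | dd = 'D_(e_ i) (dX j) x} :=
  exist _ _ erefl.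
have [lc Elc] : {lc | lc = levi_civita g (X x) (dX i x) (dX j x)} :=
  exist _ _ erefl.
have -> : sff X g x (e_ i) (e_ j) = dd + lc - dxi.
  by rewrite Edd Elc Edxi Exi.
have Hxi : h x (cone_lift k (X x) dxi) (Z l x) = (complex.Re (cubic i j l x))%:C.
  have TE m : cone_lift k (X x) (dX m x) = Z m x by rewrite tang_lift.
  have LD : cone_lift k (X x) dxi = (xi 0 0)%:C *: Z 0 x + (xi 0 1)%:C *: Z 1 x.
    have [_ D] := smooth_on_derive oU xi sX Ux.
    rewrite Edxi D sum_ord2 cone_liftD.
    apply: f_equal2; apply: etrans (cone_liftZ _ _ _ _) _.
      exact: (f_equal _ (TE 0)).
    exact: (f_equal _ (TE 1)).
  have G m : h x (Z m x) (Z l x) = (induced_metric X g x m l)%:C.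
    rewrite induced_gram// -gramE.
    have := gram_real gram_sym m l Ux.
    by case: (gram _ _ _ _) => r s [] rs; congr (_ +i* _); lra.
  rewrite LD -christoffel_induced// sum_ord2 hermDl.
  move: (hermZl surf_lift x (xi 0 0)%:C (Z 0 x) (Z l x)) => ->.
  move: (hermZl surf_lift x (xi 0 1)%:C (Z 1 x) (Z l x)) => ->.
  rewrite (G 0) (G 1) -!rmorphM -rmorphD /= Exi levi_civita_basis.
  by rewrite [X in X * _ + _]mxE [X in _ + X * _]mxE.
have [di Edi] : {di | di = 'D_(e_ i) X x} :=
  exist _ _ erefl.
have [dj Edj] : {dj | dj = 'D_(e_ j) X x} :=
  exist _ _ erefl.
have Ti : Z i x = cone_lift k (X x) di by rewrite Edi; exact: tang_lift.
have Tj : Z j x = cone_lift k (X x) dj by rewrite Edj; exact: tang_lift.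
have ti : theta surf_lift i x = b13 (cone_vec k di) (surf_lift x) / cone_norm k (X x).
  by rewrite Edi; exact: thetaX.
have tj : theta surf_lift j x = b13 (cone_vec k dj) (surf_lift x) / cone_norm k (X x).
  by rewrite Edj; exact: thetaX.
have Vi : vderive (e_ i) surf_lift x = cone_vec k di by rewrite Edi; exact: vderive_lift.
have Vj : vderive (e_ j) surf_lift x = cone_vec k dj by rewrite Edj; exact: vderive_lift.
(* The Christoffel terms of the ambient metric are the two [theta] corrections that appear in
   [cov]. *)
have Hlc : cone_lift k (X x) lc = - theta surf_lift i x *: Z j x + - theta surf_lift j x *: Z i x.
  rewrite -Edi -Edj in Elc; rewrite Elc cone_lift_levi_civita ?NX// Ti Tj ti tj.
  by congr (_ *: _ + _ *: _); rewrite mulNr mulrC.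
have Vij : vderive (e_ i) (vderive (e_ j) surf_lift) x = cone_vec k dd.
  rewrite Edd; apply: etrans (vderive_ins 0 i (smooth_on_partial j sX) Ux).
  apply/rowP => a; rewrite !vderiveE; apply: cderive_near.
  by apply: (open_near oU Ux) => y Uy; rewrite vderive_lift.
have cz : cov surf_lift i (Z j) x = cone_vec k dd - theta surf_lift j x *: cone_vec k di
      - cderive (e_ i) (theta surf_lift j) x *: surf_lift x - theta surf_lift i x *: Z j x.
  have vs : vsmooth U (vderive (e_ j) surf_lift) by exact: vsmooth_vderive.
  have st : csmooth U (theta surf_lift j) by exact: csmooth_theta.
  have ZE : Z j = fun y => vderive (e_ j) surf_lift y - theta surf_lift j y *: surf_lift y.
    by apply/funext => y; rewrite tangE covE.
  rewrite covE {1}ZE (vderiveB i oU vs (vsmoothZ oU st sl) Ux).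
  rewrite (vderiveZ i oU st sl Ux) Vij Vi.
  by rewrite opprD addrA [_ - _ *: surf_lift x - _]addrAC.
have Hcub : cubic i j l x = h x (cone_lift k (X x) dd) (Z l x)
   - theta surf_lift j x * h x (Z i x) (Z l x) - theta surf_lift i x * h x (Z j x) (Z l x).
  rewrite -(herm_cone_vec dd l Ux) cubicE cz !hermBl !hermZl (herm_z_tang l0)//.
  by rewrite (herm_cone_vec di l Ux) -Ti mulr0 subr0.
rewrite (cone_liftD k (X x) (dd + lc)) (cone_liftD k (X x) dd) cone_liftN.
move: Hxi Hlc Hcub; move: (cone_lift k (X x) dd) (cone_lift k (X x) lc)
  (cone_lift k (X x) dxi) => A B D Hxi -> Hcub.
rewrite hermBl Hxi hermDl hermDl !hermZl.
have -> : h x A (Z l x) = cubic i j l x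
   + theta surf_lift i x * h x (Z j x) (Z l x) + theta surf_lift j x * h x (Z i x) (Z l x).
  by rewrite Hcub; ring.
move: (h x (Z i x) (Z l x)) (h x (Z j x) (Z l x)) (theta surf_lift i x) (theta surf_lift j x) => a b c d.
have -> : 'i%C * (complex.Im (cubic i j l x))%:C = cubic i j l x - (complex.Re (cubic i j l x))%:C.
  by case: (cubic i j l x) => r s; apply/eqP; rewrite eq_complex /=; apply/andP; split; apply/eqP; ring.
by ring.
Qed.

End SurfaceInChart.

(** * Lorentzian planes and isotropy *)

Lemma ord2E (i : 'I_2) : i = 0 \/ i = 1.
Proof. by case: i => [[|[|//]] ?]; [left|right]; exact/val_inj. Qed.

Section LorentzianPlane.
Variable R : realType.
Implicit Types (G : 'M[R]_2) (u v w e : 'rV[R]_2).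

Lemma gform2 G u v : gform G u v =
  u 0 0 * v 0 0 * G 0 0 + u 0 0 * v 0 1 * G 0 1
  + u 0 1 * v 0 0 * G 1 0 + u 0 1 * v 0 1 * G 1 1.
Proof. by rewrite /gform !mxE sum_ord2 !mxE !sum_ord2; ring. Qed.

Lemma lorentzian_nondegenerate G u v w : G^T = G ->
  gform G u u = -1 -> gform G v v = 1 -> gform G u v = 0 ->
  w *m G = 0 -> w = 0.
Proof.
move=> Gs uu vv uv wG.
have G10 : G 1 0 = G 0 1 by rewrite -{1}Gs mxE.
have W0 : w 0 0 * G 0 0 + w 0 1 * G 0 1 = 0.
  by have /rowP/(_ 0) := wG; rewrite !mxE sum_ord2 G10.
have W1 : w 0 0 * G 0 1 + w 0 1 * G 1 1 = 0.
  by have /rowP/(_ 1) := wG; rewrite !mxE sum_ord2.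
(* Lagrange's identity: the Gram determinant of u, v is det G times the square of their wedge. *)
have D : (G 0 0 * G 1 1 - G 0 1 ^+ 2) * (u 0 0 * v 0 1 - u 0 1 * v 0 0) ^+ 2 = -1.
  transitivity (gform G u u * gform G v v - gform G u v ^+ 2).
    by rewrite !gform2 G10; ring.
  by rewrite uu vv uv; ring.
have D0 : G 0 0 * G 1 1 - G 0 1 ^+ 2 != 0.
  by apply/eqP => D0; move: D; rewrite D0 mul0r => /eqP; rewrite eq_sym oppr_eq0 oner_eq0.
have Z : w 0 0 = 0 /\ w 0 1 = 0.
  split; apply: (mulfI D0); rewrite mulr0.
    transitivity (G 1 1 * (w 0 0 * G 0 0 + w 0 1 * G 0 1)
      - G 0 1 * (w 0 0 * G 0 1 + w 0 1 * G 1 1)); first by ring.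
    by rewrite W0 W1 !mulr0 subr0.
  transitivity (G 0 0 * (w 0 0 * G 0 1 + w 0 1 * G 1 1)
      - G 0 1 * (w 0 0 * G 0 0 + w 0 1 * G 0 1)); first by ring.
  by rewrite W0 W1 !mulr0 subr0.
apply/rowP => i; rewrite mxE; have [w0 w1] := Z.
have [->|->] := ord2E i.
  exact: w0.
exact: w1.
Qed.

Lemma null_complement G e : G^T = G -> (forall w, w *m G = 0 -> w = 0) ->
  e <> 0 -> gform G e e = 0 -> exists2 e', gform G e' e' = 0 & gform G e e' = 1.
Proof.
move=> Gs Gnd e0 ee.
(* For this w the product <e, w> is the Euclidean square norm of w, nonzero by nondegeneracy. Adding
   a multiple of e then makes w null, and dividing by s normalizes its product with e. *)
pose w := e *m G; pose s := gform G e w.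
have sE : s = w 0 0 ^+ 2 + w 0 1 ^+ 2.
  by rewrite /s /gform -/w mxE sum_ord2 !mxE !expr2.
have s0 : s != 0.
  apply/eqP => s0; apply: e0; apply: Gnd; rewrite -/w.
  move/eqP: s0; rewrite sE paddr_eq0 ?sqr_ge0// !sqrf_eq0 => /andP[/eqP a /eqP b].
  apply/rowP => i; rewrite [RHS]mxE.
  by have [->|->] := ord2E i.
have we : gform G w e = s.
  have G10 : G 1 0 = G 0 1 by rewrite -{1}Gs mxE.
  by rewrite /s !gform2 G10; ring.
exists (s^-1 *: (w + (- gform G w w / (2 * s)) *: e)).
  rewrite !(gformZl, gformZr, gformDl, gformDr) ee we -/s.
  by field; rewrite s0.
by rewrite !(gformZl, gformZr, gformDl, gformDr) ee -/s mulr0 addr0 mulVf.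
Qed.

(** The three equations say that G is p q + q p for the dual coframe, cleared of denominators. *)
Lemma null_basis_wedge G e e' : G^T = G -> gform G e e = 0 ->
  gform G e' e' = 0 -> gform G e e' = 1 ->
  [/\ e 0 0 * e' 0 1 - e 0 1 * e' 0 0 != 0,
    G 0 0 * (e 0 0 * e' 0 1 - e 0 1 * e' 0 0) ^+ 2 = - 2 * e 0 1 * e' 0 1,
    G 0 1 * (e 0 0 * e' 0 1 - e 0 1 * e' 0 0) ^+ 2
      = e 0 0 * e' 0 1 + e 0 1 * e' 0 0 &
    G 1 1 * (e 0 0 * e' 0 1 - e 0 1 * e' 0 0) ^+ 2 = - 2 * e 0 0 * e' 0 0].
Proof.
move=> Gs; have G10 : G 1 0 = G 0 1 by rewrite -{1}Gs mxE.
rewrite !gform2 G10; move: (e 0 0) (e 0 1) (e' 0 0) (e' 0 1) (G 0 0) (G 0 1) (G 1 1).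
move=> a b c d g00 g01 g11 E1 E2 E3; split.
- apply/eqP => w0; have : (g00 * g11 - g01 ^+ 2) * (a * d - b * c) ^+ 2 = - 1.
    transitivity ((a * a * g00 + a * b * g01 + b * a * g01 + b * b * g11)
      * (c * c * g00 + c * d * g01 + d * c * g01 + d * d * g11)
      - (a * c * g00 + a * d * g01 + b * c * g01 + b * d * g11) ^+ 2); first by ring.
    by rewrite E1 E2 E3; ring.
  by rewrite w0 expr0n mulr0 => /eqP; rewrite eq_sym oppr_eq0 oner_eq0.
- transitivity (d ^+ 2 * (a * a * g00 + a * b * g01 + b * a * g01 + b * b * g11)
   - 2 * b * d * (a * c * g00 + a * d * g01 + b * c * g01 + b * d * g11)
   + b ^+ 2 * (c * c * g00 + c * d * g01 + d * c * g01 + d * d * g11)); first by ring.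
  by rewrite E1 E2 E3; ring.
- transitivity (- c * d * (a * a * g00 + a * b * g01 + b * a * g01 + b * b * g11)
   + (a * d + b * c) * (a * c * g00 + a * d * g01 + b * c * g01 + b * d * g11)
   - a * b * (c * c * g00 + c * d * g01 + d * c * g01 + d * d * g11)); first by ring.
  by rewrite E1 E2 E3; ring.
- transitivity (c ^+ 2 * (a * a * g00 + a * b * g01 + b * a * g01 + b * b * g11)
   - 2 * a * c * (a * c * g00 + a * d * g01 + b * c * g01 + b * d * g11)
   + a ^+ 2 * (c * c * g00 + c * d * g01 + d * c * g01 + d * d * g11)); first by ring.
  by rewrite E1 E2 E3; ring.
Qed.

(** This turns the trace of the second fundamental form into h(e, e') + h(e', e), the form in which
    non-minimality is used. *)
Lemma invmx_null_basis G e e' : G^T = G -> gform G e e = 0 ->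
  gform G e' e' = 0 -> gform G e e' = 1 ->
  invmx G = e^T *m e' + e'^T *m e.
Proof.
move=> Gs ee e'e' ee'; have [w0 g00 g01 g11] := null_basis_wedge Gs ee e'e' ee'.
have G10 : G 1 0 = G 0 1 by rewrite -{1}Gs mxE.
set K := _ + _.
have w2 := expf_neq0 2 w0.
have E00 := canRL (mulfK w2) g00; have E01 := canRL (mulfK w2) g01.
have E11 := canRL (mulfK w2) g11.
have GK : G *m K = 1%:M.
  apply/matrixP => i j; rewrite !mxE sum_ord2 !mxE !big_ord1 !mxE.
  by have [->|->] := ord2E i; have [->|->] := ord2E j;
    rewrite ?G10 ?E00 E01 ?E11 /= ?mulr1n ?mulr0n; field.
have [Gu _] := mulmx1_unit GK.
by rewrite -[LHS]mulmx1 -GK mulmxA mulVmx// mul1mx.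
Qed.

Definition tri (c : 'I_2 -> 'I_2 -> 'I_2 -> R) u v w : R :=
  \sum_i \sum_j \sum_l u 0 i * v 0 j * w 0 l * c i j l.

Lemma null_basis_coframe G (c : 'I_2 -> 'I_2 -> 'I_2 -> R) e e' : G^T = G ->
  (forall i j l, c i j l = c j i l) -> (forall i j l, c i j l = c i l j) ->
  gform G e e = 0 -> gform G e' e' = 0 -> gform G e e' = 1 ->
  tri c e e e' = 0 -> tri c e' e' e' = 0 -> tri c e e' e' != 0 ->
  exists (p q : 'I_2 -> R) (lam mu : R),
    [/\ mu != 0, q 0 * p 1 - q 1 * p 0 != 0,
        forall i j, G i j = p i * q j + q i * p j &
        forall i j l, c i j l = lam * q i * q j * q l + mu * (q i * p j * p l
              + p i * q j * p l + p i * p j * q l)].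
Proof.
move=> Gs c12 c23 ee e'e' ee' t112 t222 t122.
have [w0 g00 g01 g11] := null_basis_wedge Gs ee e'e' ee'.
have G10 : G 1 0 = G 0 1 by rewrite -{1}Gs mxE.
have w2 := expf_neq0 2 w0.
have E00 := canRL (mulfK w2) g00; have E01 := canRL (mulfK w2) g01.
have E11 := canRL (mulfK w2) g11.
pose W := e 0 0 * e' 0 1 - e 0 1 * e' 0 0.
(* The coframe dual to e', e: p(e') = q(e) = 1 and p(e) = q(e') = 0. *)
pose p (i : 'I_2) := (if i == 0 then - e 0 1 else e 0 0) / W.
pose q (i : 'I_2) := (if i == 0 then e' 0 1 else - e' 0 0) / W.
exists p, q, (tri c e e e), (tri c e e' e'); split => //.
- rewrite /p /q /= (_ : _ - _ = W^-1) ?invr_neq0//.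
  by rewrite /W; field.
- move=> i j; rewrite /p /q /W.
  by have [->|->] := ord2E i; have [->|->] := ord2E j; rewrite ?G10 ?E00 ?E01 ?E11 /=; field.
move=> i j l.
(* c in the dual coframe, including the two components that vanish *)
have -> : c i j l = tri c e e e * q i * q j * q l
   + tri c e e e' * (p i * q j * q l + q i * p j * q l + q i * q j * p l)
   + tri c e e' e' * (q i * p j * p l + p i * q j * p l + p i * p j * q l)
   + tri c e' e' e' * p i * p j * p l.
  rewrite /tri !sum_ord2.
  have c010 : c 0 1 0 = c 0 0 1 by rewrite c23.
  have c100 : c 1 0 0 = c 0 0 1 by rewrite c12 c23.
  have c101 : c 1 0 1 = c 0 1 1 by rewrite c12.
  have c110 : c 1 1 0 = c 0 1 1 by rewrite c23 c12.
  rewrite /p /q /W.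
  by have [->|->] := ord2E i; have [->|->] := ord2E j; have [->|->] := ord2E l;
    rewrite /= ?c010 ?c100 ?c101 ?c110; field.
by rewrite t112 t222; ring.
Qed.

End LorentzianPlane.

(** * Pointwise algebra of isotropy, non-minimality and Type 1 *)

Section PointwiseType1.
Variables (R : realType) (k : 'I_3) (w : 'rV[R]_(2 + 2)).
Local Notation C := R[i].
Hypothesis Nw : 0 < complex.Re (cone_norm k w).
Local Notation L := (cone_lift k w).
Local Notation z := (cone_pt k w).
Local Notation N := (cone_norm k w).
Variables (t : 'I_2 -> 'rV[R]_(2 + 2)) (s : 'I_2 -> 'I_2 -> 'rV[R]_(2 + 2)).
Variables (G : 'M[R]_2) (c : 'I_2 -> 'I_2 -> 'I_2 -> R).
Hypothesis HG : forall i j, b13 (L (t i)) (L (t j)) / N = (G i j)%:C.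
Hypothesis Hs : forall i j l, b13 (L (s i j)) (L (t l)) / N = 'i%C * (c i j l)%:C.
Hypothesis Gs : G^T = G.
Hypothesis c12 : forall i j l, c i j l = c j i l.
Hypothesis c23 : forall i j l, c i j l = c i l j.
Implicit Types (u v e : 'rV[R]_2).

(** With [t] the coordinate tangent vectors of the surface and [s] the values of h on them, [push u]
    is the tangent vector with coefficients u and [push2 u v] is h(u, v). The hypothesis [Hs] says
    that h is normal, with c as its products with J of tangent vectors. *)
Definition push u : 'rV[R]_(2 + 2) := \sum_i u 0 i *: t i.
Definition push2 u v : 'rV[R]_(2 + 2) := \sum_i \sum_j (u 0 i * v 0 j) *: s i j.

Let N0 : N != 0 := cone_norm_neq0 Nw.

Lemma lift_push u : L (push u) = (u 0 0)%:C *: L (t 0) + (u 0 1)%:C *: L (t 1).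
Proof. by rewrite /push sum_ord2 cone_liftD !cone_liftZ. Qed.

Lemma b13_push u v : b13 (L (push u)) (L (push v)) / N = (gform G u v)%:C.
Proof.
rewrite (lift_push u) (lift_push v) gform2.
rewrite !rmorphD !rmorphM /= -(HG 0 0) -(HG 0 1) -(HG 1 0) -(HG 1 1).
move: (L (t 0)) (L (t 1)) N N0 => a b n n0.
rewrite !(b13Dl, b13Dr) !b13Zl !b13Zr !conjc_real.
by field.
Qed.

Lemma lift_push2 u v : L (push2 u v) =
  (u 0 0 * v 0 0)%:C *: L (s 0 0) + (u 0 0 * v 0 1)%:C *: L (s 0 1)
  + ((u 0 1 * v 0 0)%:C *: L (s 1 0) + (u 0 1 * v 0 1)%:C *: L (s 1 1)).
Proof. by rewrite /push2 !sum_ord2 !cone_liftD !cone_liftZ. Qed.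

Lemma b13_push2 u v e :
  b13 (L (push2 u v)) (L (push e)) / N = 'i%C * (tri c u v e)%:C.
Proof.
rewrite (lift_push2 u v) (lift_push e) /tri !sum_ord2.
have H i j l : (c i j l)%:C = - 'i%C * (b13 (L (s i j)) (L (t l)) / N).
  by rewrite Hs mulNr mulrA -expr2 sqr_i mulN1r opprK.
rewrite !rmorphD !rmorphM /= !H {H}.
move: (L (s 0 0)) (L (s 0 1)) (L (s 1 0)) (L (s 1 1)) => s00 s01 s10 s11.
move: (L (t 0)) (L (t 1)) N N0 => a b n n0.
rewrite !(b13Dl, b13Dr) !b13Zl !b13Zr !conjc_real.
have ii : - ('i%C * 'i%C) = 1 :> C by rewrite -expr2 sqr_i opprK.
by rewrite -[LHS]mul1r -[X in X * _ = _]ii; field.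
Qed.

Section NullBasis.
Variables e e' : 'rV[R]_2.
Hypotheses (ee : gform G e e = 0) (e'e' : gform G e' e' = 0) (ee' : gform G e e' = 1).

Lemma parseval_null_basis (x y : 'rV[C]_3) : N * b13 x y =
  b13 x z * b13 z y + b13 x (L (push e)) * b13 (L (push e')) y
  + b13 x (L (push e')) * b13 (L (push e)) y.
Proof.
have F u v r : gform G u v = r -> b13 (L (push u)) (L (push v)) = r%:C * N.
  by move=> <-; rewrite -b13_push divfK.
apply: b13_frame => //; rewrite ?b13_pt_cone_lift//.
- by rewrite (F _ _ _ ee) mul0r.
- by rewrite (F _ _ _ e'e') mul0r.
- by rewrite (F _ _ _ ee') mul1r.
Qed.

Lemma cone_lift_null_basis_eq0 Y : b13 (L Y) (L (push e)) = 0 ->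
  b13 (L Y) (L (push e')) = 0 -> Y = 0.
Proof.
move=> Ye Ye'; apply: (cone_lift_eq0 (k := k) (w := w)); apply: b13_nondegenerate => u.
apply: (mulfI N0); rewrite parseval_null_basis Ye Ye' (b13_cone_lift_pt Nw).
by rewrite !mul0r !addr0 mulr0.
Qed.

(** By Parseval, as h(u, v) has no component along z; isotropy thereby becomes the vanishing of a
    product of two components of c. *)
Lemma gform_push2 u v : gform (cp_metric k w) (push2 u v) (push2 u v)
  = 2 * tri c u v e * tri c u v e'.
Proof.
rewrite gform_cp_metric//.
have H f : b13 (L (push2 u v)) (L (push f)) = 'i%C * (tri c u v f)%:C * N.
  by rewrite -b13_push2 divfK.
have cN : N^*%C = N by rewrite /cone_norm b13C.
have ci : ('i%C)^*%C = - 'i%C :> C.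
  by apply/eqP; rewrite eq_complex /= oppr0 !eqxx.
have cM (a b : C) : (a * b)^*%C = a^*%C * b^*%C by rewrite rmorphM.
have H' f : b13 (L (push f)) (L (push2 u v)) = - 'i%C * (tri c u v f)%:C * N.
  by rewrite -b13C H !cM ci conjc_real cN.
have := parseval_null_basis (L (push2 u v)) (L (push2 u v)).
rewrite (H e) (H e') (H' e) (H' e') (b13_cone_lift_pt Nw) mul0r add0r.
move: (b13 (L (push2 u v)) (L (push2 u v))) => B E.
rewrite (_ : B / N = (2 * tri c u v e * tri c u v e')%:C)//.
apply: (mulfI (expf_neq0 2 N0)).
have ii : - ('i%C * 'i%C) = 1 :> C by rewrite -expr2 sqr_i opprK.
rewrite -[RHS]mul1r -[X in _ = X * _]ii !rmorphM rmorph_nat /=.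
rewrite (_ : N ^+ 2 * (B / N) = N * B); last by field.
by rewrite E; ring.
Qed.

End NullBasis.

Lemma type1_cubic_shape :
  (exists u v, [/\ gform G u u = -1, gform G v v = 1 & gform G u v = 0]) ->
  (forall v, v <> 0 -> gform G v v = 0 ->
     gform (cp_metric k w) (push2 v v) (push2 v v) = 0) ->
  \sum_i \sum_j invmx G i j *: s i j <> 0 ->
  (exists2 v, v <> 0 /\ gform G v v = 0 & forall a b : R,
     a *: push2 v v + b *: cp_J (push v) = 0 -> a = 0 /\ b = 0) ->
  exists (p q : 'I_2 -> R) (lam mu : R),
    [/\ mu != 0, q 0 * p 1 - q 1 * p 0 != 0,
        forall i j, G i j = p i * q j + q i * p j &
        forall i j l, c i j l = lam * q i * q j * q l + mu * (q i * p j * p l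
              + p i * q j * p l + p i * p j * q l)].
Proof.
move=> [u [v [uu vv uv]]] iso nmin [e [e0 ee] ind].
have Gnd x := lorentzian_nondegenerate Gs uu vv uv (w := x).
have [e' e'e' ee'] := null_complement Gs Gnd e0 ee.
have t12 a b d : tri c a b d = tri c b a d.
  by rewrite /tri !sum_ord2 !(c12 1 0); ring.
have t23 a b d : tri c a b d = tri c a d b.
  by rewrite /tri !sum_ord2 !(c23 _ 1 0); ring.
have H f a b : b13 (L (push2 a b)) (L (push f)) = 'i%C * (tri c a b f)%:C * N.
  by rewrite -b13_push2 divfK.
(* Otherwise h(e, e) and c(e, e, e') J e have the same products with e and e', hence are equal,
   against linear independence. *)
have t111 : tri c e e e != 0.
  apply/eqP => t0; have E : push2 e e = tri c e e e' *: cp_J (push e).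
    apply/eqP; rewrite -subr_eq0 -scaleNr; apply/eqP.
    have B f : b13 (L (push2 e e + - tri c e e e' *: cp_J (push e))) (L (push f))
        = 'i%C * (tri c e e f - tri c e e e' * gform G e f)%:C * N.
      rewrite cone_liftD cone_liftZ cone_lift_cp_J.
      have := H f e e; have : b13 (L (push e)) (L (push f)) = (gform G e f)%:C * N.
        by rewrite -b13_push divfK.
      move: (L (push2 e e)) (L (push e)) (L (push f)) => a b d bd ad.
      by rewrite b13Dl !b13Zl ad bd rmorphB rmorphM rmorphN /=; ring.
    apply: (cone_lift_null_basis_eq0 ee e'e' ee').
      by rewrite B t0 ee mulr0 subr0 mulr0 mul0r.
    by rewrite B ee' mulr1 subrr mulr0 mul0r.
  have [|/eqP] := ind 1 (- tri c e e e').
    by rewrite scale1r scaleNr E subrr.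
  by rewrite oner_eq0.
have t112 : tri c e e e' = 0.
  have := iso e e0 ee; rewrite (gform_push2 ee e'e' ee') => /eqP.
  by rewrite !mulf_eq0 pnatr_eq0 (negPf t111) /= => /eqP.
(* With c(e, e, e') = 0 already known, c(e, e', e') = 0 would annihilate h(e, e'), hence the trace
   of h. *)
have t122 : tri c e e' e' != 0.
  apply/eqP => t0; apply: nmin.
  have S0 : push2 e e' = 0.
    apply: (cone_lift_null_basis_eq0 ee e'e' ee').
      by rewrite H t23 t112 mulr0 mul0r.
    by rewrite H t0 mulr0 mul0r.
  have S0' : push2 e' e = 0.
    apply: (cone_lift_null_basis_eq0 ee e'e' ee').
      by rewrite H t12 t23 t112 mulr0 mul0r.
    by rewrite H t12 t0 mulr0 mul0r.
  transitivity (push2 e e' + push2 e' e); last by rewrite S0 S0' addr0.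
  rewrite (invmx_null_basis Gs ee e'e' ee') /push2 -big_split /=.
  apply: eq_bigr => i _; rewrite -big_split /=; apply: eq_bigr => j _.
  by rewrite -scalerDl; congr (_ *: _); rewrite !mxE !big_ord1 !mxE.
have e'0 : e' <> 0.
  move=> e'0; move: ee'; rewrite e'0 -(scale0r 0) gformZr mul0r => /eqP.
  by rewrite eq_sym oner_eq0.
have t222 : tri c e' e' e' = 0.
  have := iso e' e'0 e'e'; rewrite (gform_push2 ee e'e' ee') => /eqP.
  rewrite !mulf_eq0 pnatr_eq0 /= => /orP[|/eqP//].
  by rewrite t23 t12 (negPf t122).
exact: (null_basis_coframe Gs c12 c23 ee e'e' ee' t112 t222 t122).
Qed.

End PointwiseType1.

(** * Nonexistence in a chart *)

Lemma bilinear_expand2 (R : realType) (V : lmodType R)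
    (B : 'rV[R]_2 -> 'rV[R]_2 -> V) :
  (forall (r : R) u v w, B (r *: u + v) w = r *: B u w + B v w) ->
  (forall (r : R) u v w, B w (r *: u + v) = r *: B w u + B w v) ->
  forall u v, B u v =
    \sum_i \sum_j (u 0 i * v 0 j) *: B (basis_vec R i) (basis_vec R j).
Proof.
move=> Bl Br u v.
have B0l w : B 0 w = 0.
  have /eqP := Bl 1 0 0 w; rewrite !scale1r addr0 -subr_eq0 opprD addNKr oppr_eq0.
  by move=> /eqP.
have B0r w : B w 0 = 0.
  have /eqP := Br 1 0 0 w; rewrite !scale1r addr0 -subr_eq0 opprD addNKr oppr_eq0.
  by move=> /eqP.
rewrite {1}[u]row_sum_delta {1}[v]row_sum_delta !sum_ord2.
rewrite -[X in B (_ + X)]addr0 -[X in B _ (_ + X)]addr0 !Bl !Br !B0l !B0r !addr0.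
by rewrite !scalerDr !scalerA !scaler0 !addr0.
Qed.

(** * Bilinearity of the second fundamental form *)

Section SecondFundamentalForm.
Variables (R : realType) (k : 'I_3) (U : set 'rV[R]_2).
Hypothesis oU : open U.
Local Notation e_ := (basis_vec R).
Variable X : 'rV[R]_2 -> 'rV[R]_(2 + 2).
Hypothesis sX : smooth_on U X.
Variable x : 'rV[R]_2.
Hypothesis Ux : U x.
Implicit Types (u v w : 'rV[R]_2).
Local Notation g := (cp_metric k).

Lemma derive_push v : 'D_v X x = push (fun i => 'D_(e_ i) X x) v.
Proof. by have [_ ->] := smooth_on_derive oU v sX Ux. Qed.

Lemma smooth_on_deriveP (Y : 'rV[R]_2 -> 'rV[R]_(2 + 2)) (r : R) u v :
  smooth_on U Y -> 'D_(r *: u + v) Y x = r *: 'D_u Y x + 'D_v Y x.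
Proof.
move=> sY; have D w := derive_val (is_derive := smooth_on_derive oU w sY Ux).
apply: etrans (D _) _; apply: etrans _ (esym (f_equal2 (fun a b => r *: a + b) (D u) (D v))).
rewrite scaler_sumr -big_split /=; apply: eq_bigr => i _.
by rewrite !mxE scalerDl scalerA.
Qed.

Lemma derive_derive v w : 'D_v (fun y => 'D_w X y) x =
  w 0 0 *: 'D_v ('D_(e_ 0) X) x + w 0 1 *: 'D_v ('D_(e_ 1) X) x.
Proof.
have E : \forall y \near x, (fun y => 'D_w X y) y =
    (w 0 0 \*: 'D_(e_ 0) X + w 0 1 \*: 'D_(e_ 1) X) y.
  apply: (open_near oU Ux) => y Uy.
  by have [_ ->] := smooth_on_derive oU w sX Uy; rewrite sum_ord2.
apply: etrans (near_eq_derive v E) _.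
have D i := smooth_on_derive oU v (smooth_on_partial i sX) Ux.
have d i : derivable ('D_(e_ i) X) x v by have [] := D i.
apply: etrans (deriveD (derivableZ (d 0)) (derivableZ (d 1))) _.
exact: (f_equal2 +%R (deriveZ _ (d 0)) (deriveZ _ (d 1))).
Qed.

Let B1 v w := 'D_v (fun y => 'D_w X y) x.
Let B2 v w := levi_civita g (X x) ('D_v X x) ('D_w X x).
Let B3 v w := 'D_(levi_civita (induced_metric X g) x v w) X x.

Let lin2 (V : lmodType R) (r w0 w1 : R) (a b c d : V) :
  w0 *: (r *: a + b) + w1 *: (r *: c + d)
  = r *: (w0 *: a + w1 *: c) + (w0 *: b + w1 *: d).
Proof. by rewrite !scalerDr !scalerA ![r * _]mulrC addrACA. Qed.

Let lin2r (V : lmodType R) (r u0 u1 v0 v1 : R) (a b : V) :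
  (r * u0 + v0) *: a + (r * u1 + v1) *: b
  = r *: (u0 *: a + u1 *: b) + (v0 *: a + v1 *: b).
Proof. by rewrite !scalerDl scalerDr !scalerA addrACA. Qed.

Let B1l (r : R) u v w : B1 (r *: u + v) w = r *: B1 u w + B1 v w.
Proof.
have D i := smooth_on_deriveP r u v (smooth_on_partial i sX).
apply: etrans (derive_derive (r *: u + v) w) _.
apply: etrans (f_equal2 (fun a b => w 0 0 *: a + w 0 1 *: b) (D 0) (D 1)) _.
apply: etrans (lin2 _ _ _ _ _ _ _) _.
exact: (esym (f_equal2 (fun a b => r *: a + b) (derive_derive u w) (derive_derive v w))).
Qed.

Let B1r (r : R) u v w : B1 w (r *: u + v) = r *: B1 w u + B1 w v.
Proof.
have M i : (r *: u + v) 0 i = r * u 0 i + v 0 i by rewrite !mxE.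
have [a Ea] : {a | a = 'D_w ('D_(e_ 0) X) x} := exist _ _ erefl.
have [b Eb] : {b | b = 'D_w ('D_(e_ 1) X) x} := exist _ _ erefl.
have E f : B1 w f = f 0 0 *: a + f 0 1 *: b.
  by rewrite Ea Eb; exact: derive_derive.
by rewrite !E (M 0) (M 1) lin2r.
Qed.

Let B2l (r : R) u v w : B2 (r *: u + v) w = r *: B2 u w + B2 v w.
Proof. by rewrite /B2 (smooth_on_deriveP r u v sX) levi_civitaPl. Qed.

Let B2r (r : R) u v w : B2 w (r *: u + v) = r *: B2 w u + B2 w v.
Proof. by rewrite /B2 (smooth_on_deriveP r u v sX) levi_civitaPr. Qed.

Let B3l (r : R) u v w : B3 (r *: u + v) w = r *: B3 u w + B3 v w.
Proof. by rewrite /B3 levi_civitaPl (smooth_on_deriveP _ _ _ sX). Qed.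

Let B3r (r : R) u v w : B3 w (r *: u + v) = r *: B3 w u + B3 w v.
Proof. by rewrite /B3 levi_civitaPr (smooth_on_deriveP _ _ _ sX). Qed.

(** Each of the three terms of the Gauss formula is bilinear, the first by smoothness of the partial
    derivatives; null vectors can thus be handled through the coordinate values of h. *)
Lemma sff_push2 v w : sff X g x v w = push2 (fun i j => sff X g x (e_ i) (e_ j)) v w.
Proof.
have E a b : sff X g x a b = B1 a b + B2 a b - B3 a b by [].
apply: (bilinear_expand2 (B := sff X g x)) => r a b c; rewrite !E ?B1l ?B2l ?B3l ?B1r ?B2r ?B3r.
  move: (B1 a c) (B2 a c) (B3 a c) (B1 b c) (B2 b c) (B3 b c) => a1 a2 a3 b1 b2 b3.
  by apply/rowP => i; rewrite !mxE; ring.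
move: (B1 c a) (B2 c a) (B3 c a) (B1 c b) (B2 c b) (B3 c b) => a1 a2 a3 b1 b2 b3.
by apply/rowP => i; rewrite !mxE; ring.
Qed.

End SecondFundamentalForm.

Section IsotropicChart.
Variables (R : realType) (k : 'I_3) (U : set 'rV[R]_2).
Hypothesis oU : open U.
Local Notation C := R[i].
Local Notation e_ := (basis_vec R).
Variable X : 'rV[R]_2 -> 'rV[R]_(2 + 2).
Hypothesis sX : smooth_on U X.
Hypothesis NX : forall x, U x -> 0 < complex.Re (cone_norm k (X x)).
Local Notation g := (cp_metric k).
Local Notation z := (surf_lift k X).

(** <J X_i, X_j> is the real part of i times [gram i j], so the hypothesis makes the hermitian
    matrix [gram] real. *)
Lemma lagrangian_gram x : U x ->
  (forall i j, gform (g (X x)) (cp_J ('D_(e_ i) X x)) ('D_(e_ j) X x) = 0) ->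
  forall i j, gram z i j x = gram z j i x.
Proof.
move=> Ux lag i j.
have := lag i j; rewrite (gform_herm NX _ _ Ux) cone_lift_cp_J hermZl.
rewrite -(tang_lift k sX i Ux) -(tang_lift k sX j Ux) -gramE.
have -> : gram z j i x = (gram z i j x)^*%C by rewrite !gramE hermC.
case: (gram z i j x) => a b /= H.
have b0 : b = 0 by lra.
by rewrite b0 oppr0.
Qed.

Lemma no_type1_chart :
  (forall x, U x -> forall i j,
     gform (g (X x)) (cp_J ('D_(e_ i) X x)) ('D_(e_ j) X x) = 0) ->
  (forall x, U x -> signature11 X g x) ->
  (forall x, U x -> forall v, lightlike X g x v ->
     gform (g (X x)) (sff X g x v v) (sff X g x v v) = 0) ->
  (forall x, U x -> sff_trace X g x <> 0) ->
  (forall x, U x -> exists2 v, lightlike X g x v & forall a b : R,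
     a *: sff X g x v v + b *: cp_J ('D_v X x) = 0 -> a = 0 /\ b = 0) ->
  forall x, ~ U x.
Proof.
move=> lag sig iso nmin ty.
have gs x (Ux : U x) := lagrangian_gram Ux (lag x Ux).
have sl : vsmooth U z := vsmooth_lift k oU sX.
have l0 x : U x -> b13 (z x) (z x) != 0 := @lift_neq0 _ _ _ _ NX x.
have Gs x : U x -> (induced_metric X g x)^T = induced_metric X g x.
  by move=> Ux; exact: (induced_sym sX NX gs Ux).
have Gu x : U x -> induced_metric X g x \in unitmx.
  move=> Ux; have [u [v [uu vv uv]]] := sig x Ux.
  rewrite -row_free_unit; apply: inj_row_free => w.
  exact: (lorentzian_nondegenerate (Gs x Ux) uu vv uv).
move=> x0; apply: (@no_null_cubic _ _ oU _ sl l0 x0) => x Ux.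
have gr i j : gram z i j x = (induced_metric X g x i j)%:C.
  rewrite (induced_gram sX NX)//; have := gram_real gs i j Ux.
  by case: (gram _ _ _ _) => r s [] rs; congr (_ +i* _); lra.
pose c i j l := complex.Im (cubic z i j l x).
have c12 i j l : c i j l = c j i l.
  by rewrite /c (cubic_sym12 oU sX NX gs i j l Ux).
have sZ i : vsmooth U (tang z i) := vsmooth_tang oU sl l0 i.
(* The derivative of the real function [gram z j l] is [cubic z i j l] plus the conjugate of
   [cubic z i l j]; its imaginary part vanishes. *)
have c23 i j l : c i j l = c i l j.
  have sg : csmooth U (gram z j l).
    rewrite (_ : gram z j l = fun x => herm z x (tang z j x) (tang z l x)).
      exact: csmooth_herm.
    by apply/funext => y; rewrite gramE.
  have := cderive_real oU i sg Ux (fun y Uy => gram_real gs j l Uy).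
  have -> : cderive (e_ i) (gram z j l) x = cubic z i j l x + (cubic z i l j x)^*%C.
    have -> : gram z j l = fun x => herm z x (tang z j x) (tang z l x).
      by apply/funext => y; rewrite gramE.
    rewrite (cderive_val (is_cderive_herm sl l0 i (sZ j) (sZ l) Ux)).
    by rewrite !cubicE hermC.
  by rewrite /c; case: (cubic _ _ _ _ _) (cubic _ _ _ _ _) => [a b] [a' b'] [] /= H; lra.
have [d Ed] : {d : 'I_2 -> _ | d = fun i => 'D_(e_ i) X x} := exist _ _ erefl.
have Ti i : tang z i x = cone_lift k (X x) (d i).
  by rewrite Ed; exact: (tang_lift k sX i Ux).
have [S ES] : {S : 'I_2 -> 'I_2 -> _ | S = fun i j => sff X g x (e_ i) (e_ j)} :=
  exist _ _ erefl.
have HG i j : b13 (cone_lift k (X x) (d i)) (cone_lift k (X x) (d j)) / cone_norm k (X x)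
    = (induced_metric X g x i j)%:C.
  by rewrite -!Ti -gr gramE hermE.
have Hs i j l : b13 (cone_lift k (X x) (S i j)) (cone_lift k (X x) (d l)) / cone_norm k (X x)
    = 'i%C * (c i j l)%:C.
  rewrite /c -(herm_sff_basis oU sX NX gs Gu i j l Ux) hermE ES.
  by rewrite (Ti l).
have Epush v : 'D_v X x = push d v by rewrite Ed; exact: (derive_push oU sX Ux).
have Epush2 v w : sff X g x v w = push2 S v w.
  by rewrite ES; exact: (sff_push2 k oU sX Ux).
have [] := type1_cubic_shape (NX Ux) HG Hs (Gs x Ux) c12 c23 (sig x Ux).
- by move=> v v0 vv; rewrite -Epush2; apply: iso.
- by have := nmin x Ux; rewrite /sff_trace ES.
- have [v lv H] := ty x Ux; exists v; first exact: lv.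
  by move=> a b E; apply: H; rewrite (Epush2 v v) (Epush v); exact: E.
move=> p [q [lam [mu [mu0 pq0 Gpq cpq]]]].
exists p, q, lam, mu; split=> //.
  by move=> i j; rewrite gr Gpq.
move=> i j l; rewrite -cpq /c; case: (cubic _ _ _ _ _) => a b.
by apply/eqP; rewrite eq_complex /=; apply/andP; split; apply/eqP; ring.
Qed.

End IsotropicChart.

(** * Affine charts cover the projective space, and the theorem *)

Section AffineCharts.
Variable R : realType.
Local Notation C := R[i].

Lemma cone_pt_aff k (z : 'rV[C]_3) : z 0 k != 0 ->
  cone_pt k (aff k z) = (z 0 k)^-1 *: z.
Proof.
move=> zk; rewrite /cone_pt /aff to_realK; apply/rowP => j; rewrite !mxE.
by case: unliftP => [i ->|->]; rewrite ?mxE ?mulVf// mulrC.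
Qed.

(** Over a point z of the unit pseudosphere [cone_pt] is z / z_k, so the norm is 1 / |z_k|^2. *)
Lemma cone_norm_cp_chart k (P : CP21 R) : cp_dom k P ->
  0 < complex.Re (cone_norm k (cp_chart k P)).
Proof.
case: P => F [z Sz FE]; have -> : MkCP21 (ex_intro2 _ _ z Sz FE) = hopf Sz.
  by move: (FE); rewrite FE => FE'; rewrite /hopf; congr (MkCP21 (ex_intro2 _ _ z Sz _));
    exact: Prop_irrelevance.
move=> [_ [a a1 <-] ak]; rewrite cp_chart_hopf.
have zk : z 0 k != 0 by move: ak; rewrite mxE mulf_eq0 negb_or => /andP[].
rewrite /cone_norm cone_pt_aff// b13Zl b13Zr (Sz : b13 z z = 1) mulr1.
have : (z 0 k)^-1 != 0 by rewrite invr_eq0.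
case: (z 0 k)^-1 => r s /sumsq_neq0 rs /=.
by rewrite mulrN opprK -!expr2 lt_neqAle eq_sym rs addr_ge0// sqr_ge0.
Qed.

Lemma cp_dom_cover (P : CP21 R) : exists k, cp_dom k P.
Proof.
case: P => F [z Sz FE].
have zF : F z by rewrite FE; exists 1; rewrite /= ?normr1// scale1r.
suff [k zk] : exists k, z 0 k != 0 by exists k, z.
apply: contrapT => H; have z0 k : z 0 k = 0.
  by apply/eqP; apply: contrapT => /negP zk; apply: H; exists k.
by move: Sz; rewrite /S52 /= /b13 !z0 !mul0r oppr0 !addr0 => /eqP; rewrite eq_sym oner_eq0.
Qed.

End AffineCharts.

Theorem theorem5p3 (R : realType) :
  ~ exists (M : surface R) (f : M -> CP21 R),
      [/\ immersion f, lorentzian f, lagrangian f,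
          proper_lightlike_isotropic f & type1 f].
Proof.
move=> [M [f [imm lor lag [iso nmin] ty]]].
have [p _] := surf_nonempty M.
have [c ac cp] := atlas_cover p.
have [k kp] := cp_dom_cover (f p).
have [U [[oU Up] Uc Uk sX]] := (imm p).1 c k ac cp kp.
have [_ _ cK _ _] := atlas_homeo ac.
(* Every y in U is the coordinate of a point of M lying in the same two chart domains, so the
   hypotheses can all be read in the fixed pair [c], [k]. *)
have at_chart (P : chart R M -> 'I_3 -> 'rV[R]_2 -> Prop) :
    (forall q, in_charts f P q) -> forall y, U y -> P c k y.
  move=> HP y Uy; have [q cq qy] := Uc y Uy.
  rewrite -qy; apply: HP => //.
  by have := Uk y Uy; rewrite -qy cK.
apply: (no_type1_chart oU sX _ _ _ _ _ _ Up) => [y Uy|y Uy i j||||].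
- exact: cone_norm_cp_chart (Uk y Uy).
(* The coordinate vector X_i is tangent, so J X_i lies in J T = N, and its product with X_j is
   zero. *)
- have [JT _] := at_chart _ lag y Uy.
  have : Defs.normal_space (loc f c k) (cp_metric k) y (cp_J ('D_(basis_vec R i) (loc f c k) y)).
    by rewrite -JT; exists ('D_(basis_vec R i) (loc f c k) y) => //; exists (basis_vec R i).
  exact.
- exact: at_chart lor.
- exact: at_chart iso.
- exact: at_chart nmin.
- exact: at_chart ty.
Qed.
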